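(* Fix an integer $d\ge 2$. For each $n$ let $\mathbf p=\mathbf p(n)=(p_1,\dots,p_d)\in(0,1]^d$, and suppose that $\min_{i=1,\dots,d-1}\liminf_{n\to\infty}p_i>0$, $np_d(1-p_d)\to\infty$ and $p_d=o(1)$ as $n\to\infty$. Let $A_n$ and $A_n^+$ denote the unsigned and signed adjacency matrices of the multi-parameter random simplicial complex $Y_d(n,\mathbf p)$, respectively, and let $m_n(\mathbf p)=nd\left(\prod_{r=1}^{d}p_r^{\binom dr}\right)(1-p_d)$. Then both $$\mu_{\frac{A_n}{\sqrt{m_n(\mathbf p)}}}\xrightarrow{\;w\;}\mu_{sc}\qquad\text{and}\qquad \mu_{\frac{A_n^+}{\sqrt{m_n(\mathbf p)}}}\xrightarrow{\;w\;}\mu_{sc}$$ in probability as $n\to\infty$.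
   Context: Simplicial complexes: a simplicial complex $X$ on a finite vertex set $V$ is a collection of subsets of $V$ closed under taking subsets. A cell $\sigma\in X$ has dimension $|\sigma|-1$; a cell of dimension $j$ is a $j$-cell, and $X^j$ is the set of $j$-cells of $X$. The model $Y_d(n,\mathbf p)$ (multi-parameter lower model): the vertex set is $[n]=\{1,\dots,n\}$. Edges (1-cells) are included independently with probability $p_1$; inductively, for $2\le k\le d$, given the $(k-1)$-skeleton, each $(k+1)$-subset of $[n]$ all of whose proper subsets are already in the complex is included as a $k$-cell independently with probability $p_k$. Equivalently: let $\chi_\tau=\chi_\tau^{(n)}$, for $\tau\subseteq[n]$ with $2\le|\tau|\le d+1$, be independent Bernoulli random variables with parameter $p_{|\tau|-1}$; then $Y_d(n,\mathbf p)$ is the set of all $\sigma\subseteq[n]$ with $|\sigma|\le d+1$ such that $\chi_\tau=1$ for every $\tau\subseteq\sigma$ with $|\tau|\ge2$. Orientation: an orientation of a $j$-cell ($j\ge1$) is an ordering $[x_0,\dots,x_j]$ of its vertices, two orderings being identified if they differ by an even permutation; thus each $j$-cell has exactly two orientations, and $\bar\sigma$ (also written $-\sigma$) denotes $\sigma$ with the opposite orientation. The positive orientation is the one given by the increasing order of the vertices; $X_+^{j}$ is the set of positively oriented $j$-cells, which is in natural bijection with $X^j$. An oriented $j$-cell $[\sigma^0,\dots,\sigma^j]$ induces on the $(j-1)$-cell obtained by deleting $\sigma^i$ the orientation $(-1)^i[\sigma^0,\dots,\sigma^{i-1},\sigma^{i+1},\dots,\sigma^j]$; the oriented boundary consists of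 these oriented cells. For oriented $(d-1)$-cells $\sigma,\sigma'$ write $\sigma\overset{X}{\sim}\sigma'$ if there is an oriented $d$-cell $\tau$ of $X$ such that both $\sigma$ and $\overline{\sigma'}$ belong to the oriented boundary of $\tau$. Adjacency matrices: the unsigned adjacency matrix $A$ of $X$ is indexed by $X^{d-1}\times X^{d-1}$, with $A_{\sigma,\sigma'}=1$ if $\sigma\cup\sigma'\in X^d$ and $0$ otherwise. The signed adjacency matrix $A^+$ is indexed by $X_+^{d-1}\times X_+^{d-1}$, has zero diagonal, and for $\sigma\ne\sigma'$ has $A^+_{\sigma,\sigma'}=1$ if $\sigma\overset{X}{\sim}\sigma'$, $-1$ if $\sigma\overset{X}{\sim}\overline{\sigma'}$, and $0$ otherwise. For the random complex these matrices have random dimension $|Y^{d-1}|$. Spectral measures: for an $N\times N$ real symmetric matrix $M$ with eigenvalues $\lambda_1,\dots,\lambda_N$, $\mu_M=\frac1N\sum_{i=1}^N\delta_{\lambda_i}$ is its empirical spectral measure (if $N=0$, take $\mu_M=\delta_0$ by convention). $\mu_{sc}$ is the standard semicircle law, with density $\frac1{2\pi}\sqrt{4-s^2}\,\mathbf 1_{[-2,2]}(s)$. ''Converges weakly in probability'' means that the distance (in any metric metrizing weak convergence of probability measures on $\mathbb R$) tends to $0$ in probability. *)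

(* Defs.v *)
From HB Require Import structures.
From mathcomp Require Import all_boot all_order all_algebra all_fingroup.
From mathcomp Require Import all_classical all_reals all_analysis.
From mathcomp Require Import measurable_realfun.
From mathcomp Require Import ring lra.

Set Implicit Arguments.
Unset Strict Implicit.
Unset Printing Implicit Defensive.

Import Order.TTheory GRing.Theory Num.Theory.
Import numFieldNormedType.Exports.

Local Open Scope ring_scope.

Record simplicial_complex (n : nat) := SimplicialComplex {
  faces :> {set {set 'I_n}};
  faces_closed : forall s t : {set 'I_n}, s \in faces -> t \subset s ->
    t \in faces }.

Definition cells n (X : simplicial_complex n) (j : nat) : {set {set 'I_n}} :=
  [set s in (X : {set _}) | #|s| == j.+1].

(* The values of c on sets of at most one vertex are irrelevant: the complex
   contains the empty set and all vertices. *)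
Section LowerModel.
Variables (d n : nat) (c : {set 'I_n} -> bool).

Definition lower_faces : {set {set 'I_n}} :=
  [set s : {set 'I_n} | (#|s| <= d.+1)%N &&
    [forall t : {set 'I_n}, (t \subset s) && (2 <= #|t|)%N ==> c t]].

Lemma lower_faces_closed (s t : {set 'I_n}) :
  s \in lower_faces -> t \subset s -> t \in lower_faces.
Proof.
rewrite !inE => /andP[sd /forallP sc] ts; apply/andP; split.
  exact: leq_trans (subset_leq_card ts) sd.
apply/forallP => u; apply/implyP => /andP[ut u2].
by have /implyP := sc u; apply; rewrite u2 (fintype.subset_trans ut ts).
Qed.

Definition lower_model : simplicial_complex n :=
  SimplicialComplex lower_faces_closed.

End LowerModel.

(* An orientation of a cell with m vertices (a cell of dimension m-1) is the set
   of all orderings of its vertices in one class modulo even permutations. This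
   is meaningful for m >= 2 only: for m <= 1 there is no odd permutation and
   [opposite] is empty. *)
Section Orientation.
Variable n : nat.

Notation ordering m := {ffun 'I_m -> 'I_n}.
Notation oriented m := {set ordering m}.

Definition permute m (x : ordering m) (s : 'S_m) : ordering m :=
  [ffun i => x (s i)].

Definition orient m (x : ordering m) : oriented m :=
  [set permute x s | s : 'S_m & ~~ odd_perm s].

Definition opposite m (C : oriented m) : oriented m :=
  [set permute x s | x in C, s in [set s : 'S_m | odd_perm s]].

Definition vertices m (x : ordering m) : {set 'I_n} := [set x i | i : 'I_m].

Definition oriented_cells m (X : simplicial_complex n) : {set oriented m} :=
  [set orient x | x : ordering m & injectiveb x && (vertices x \in faces X)].

Definition increasing m (x : ordering m) : bool :=
  [forall i : 'I_m, forall j : 'I_m, (i < j)%N ==> (x i < x j)%N].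

Definition positive_cells m (X : simplicial_complex n) : {set oriented m} :=
  [set orient x | x : ordering m & increasing x && (vertices x \in faces X)].

Definition del_vertex m (x : ordering m.+1) (i : 'I_m.+1) : ordering m :=
  [ffun k => x (lift i k)].

Definition oriented_boundary m (C : oriented m.+1) : {set oriented m} :=
  [set (let D := orient (del_vertex x i) in if odd i then opposite D else D)
  | x in C, i in 'I_m.+1].

Definition upper_adjacent m (X : simplicial_complex n) (C D : oriented m) :
    bool :=
  [exists T in oriented_cells m.+1 X,
    (C \in oriented_boundary T) && (opposite D \in oriented_boundary T)].

End Orientation.

Section AdjacencyMatrices.
Variables (R : realType) (d n : nat) (X : simplicial_complex n).

Definition unsigned_adjacency : 'M[R]_#|cells X d.-1| :=
  \matrix_(a, b) (enum_val a :|: enum_val b \in cells X d)%:R.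

(* The (d-1)-cells are those with d vertices. *)
Definition signed_adjacency : 'M[R]_#|positive_cells d X| :=
  \matrix_(a, b) let s := enum_val a in let s' := enum_val b in
    if s == s' then 0
    else if upper_adjacent X s s' then 1
    else if upper_adjacent X s (opposite s') then -1
    else 0.

End AdjacencyMatrices.

Local Open Scope classical_set_scope.

Section EmpiricalMeasure.
Context {R : realType}.
Implicit Types s : seq R.
Local Open Scope ereal_scope.

Definition empirical s : set (measurableTypeR R) -> \bar R := fun B =>
  if s is [::] then \d_(0%R : measurableTypeR R) B
  else ((size s)%:R^-1)%R%:E * \sum_(a <- s) \d_(a : measurableTypeR R) B.

Let empiricalE a s : empirical (a :: s) =
  mscale ((size (a :: s))%:R^-1%:nng : {nonneg R})%R
    (msum (fun k => \d_(nth 0%R (a :: s) k : measurableTypeR R))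
      (size (a :: s))) :> (set _ -> \bar R).
Proof.
apply/funext => B; rewrite /empirical /mscale /msum/=.
by rewrite (big_nth 0%R) big_mkord.
Qed.

Let empirical0 s : empirical s set0 = 0.
Proof.
case: s => [|a s]; first exact: (@measure0 _ _ _ \d_(0%R : measurableTypeR R)).
by rewrite empiricalE measure0.
Qed.

Let empirical_ge0 s B : 0 <= empirical s B.
Proof.
case: s => [|a s].
  exact: (@measure_ge0 _ _ _ \d_(0%R : measurableTypeR R)).
by rewrite empiricalE measure_ge0.
Qed.

Let empirical_sigma_additive s : semi_sigma_additive (empirical s).
Proof.
case: s => [|a s].
  exact: (@measure_semi_sigma_additive _ _ _ \d_(0%R : measurableTypeR R)).
by rewrite empiricalE; exact: measure_semi_sigma_additive.
Qed.

HB.instance Definition _ s := isMeasure.Build _ _ _ (empirical s)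
  (empirical0 s) (empirical_ge0 s) (@empirical_sigma_additive s).

Let empirical_setT s : empirical s setT = 1.
Proof.
case: s => [|a s]; first exact: probability_setT.
rewrite /empirical; under eq_bigr do rewrite diracT.
rewrite sumEFin -EFinM; congr EFin.
by rewrite big_const_seq count_predT iter_addr_0 mulVf ?pnatr_eq0.
Qed.

HB.instance Definition _ s :=
  Measure_isProbability.Build _ _ _ (empirical s) (empirical_setT s).

End EmpiricalMeasure.

(* The list of eigenvalues with multiplicity, which is determined up to
   permutation. The default [::] is taken only if the characteristic polynomial
   does not split over R, which never happens for a symmetric matrix. *)
Definition eigenvalues (R : realType) N (M : 'M[R]_N) : seq R :=
  xget [::] [set s | char_poly M = \prod_(a <- s) ('X - a%:P)].

Definition spectral_measure (R : realType) N (M : 'M[R]_N) :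
    probability (measurableTypeR R) R :=
  empirical (eigenvalues M).

Section Semicircle.
Context {R : realType}.
Notation mu := (@lebesgue_measure R).

Definition semicircle_pdf (s : R) : R :=
  (2 * pi)^-1 * Num.sqrt (4 - s ^+ 2) * \1_`[-2, 2] s.

Lemma semicircle_pdf_ge0 s : 0 <= semicircle_pdf s.
Proof.
rewrite /semicircle_pdf !mulr_ge0 ?invr_ge0 ?mulr_ge0 ?sqrtr_ge0 ?pi_ge0//.
Qed.

Let sqrt_continuous4 : continuous (fun s : R => Num.sqrt (4 - s ^+ 2)).
Proof.
move=> s; apply: (@continuous_comp _ _ _ (fun s : R => 4 - s ^+ 2)).
  by apply: continuousB; [exact: cst_continuous|exact: exprn_continuous].
exact: sqrt_continuous.
Qed.

Lemma measurable_semicircle_pdf : measurable_fun setT semicircle_pdf.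
Proof.
apply: measurable_funM; last exact: measurable_indic.
apply: measurable_funM; first exact: measurable_cst.
exact: continuous_measurable_fun.
Qed.

Let D2sin : (fun t : R => 2 * sin t)^`() = (fun t => 2 * cos t).
Proof.
apply/funext => t; rewrite derive1E.
by have /@derive_val -> : is_derive t 1 (fun t : R => 2 * sin t) (2 * cos t)
  by apply: is_deriveZ.
Qed.

Let pihalf_lt : - (pi / 2) < pi / 2 :> R.
Proof. by rewrite gtrN// divr_gt0 ?pi_gt0. Qed.

Let continuous_2cos : continuous (fun t : R => 2 * cos t).
Proof.
by move=> t; apply: cvgM; [exact: cvg_cst|exact: continuous_cos].
Qed.

Let continuous_2sin : continuous (fun t : R => 2 * sin t).
Proof.
by move=> t; apply: cvgM; [exact: cvg_cst|exact: continuous_sin].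
Qed.

Let integral_sqrt :
  (\int[mu]_(s in `[(- 2)%R, 2%R]) (Num.sqrt (4 - s ^+ 2))%:E = (2 * pi)%:E)%E.
Proof.
have F2 : 2 * sin (pi / 2) = 2 :> R by rewrite sin_pihalf mulr1.
have FN2 : 2 * sin (- (pi / 2)) = - 2 :> R by rewrite sinN sin_pihalf mulrN1.
rewrite -[X in `[_, X]]F2 -[X in `[X, _]]FN2.
rewrite (@integration_by_substitution_increasing _ (fun t => 2 * sin t)).
- rewrite D2sin.
  transitivity (\int[mu]_(t in `[(- (pi / 2))%R, (pi / 2)%R])
      (4 * cos t ^+ 2)%:E)%E.
    apply: eq_integral => t; rewrite inE/= in_itv/= => tpi; congr EFin.
    change (Num.sqrt (4 - (2 * sin t) ^+ 2) * (2 * cos t) = 4 * cos t ^+ 2).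
    have -> : 4 - (2 * sin t) ^+ 2 = (2 * cos t) ^+ 2.
      by rewrite !exprMn cos2sin2 mulrBr mulr1 -natrX.
    by rewrite sqrtr_sqr ger0_norm ?mulr_ge0 ?cos_ge0_pihalf//; ring.
  have dF (t : R) : is_derive t 1 (fun t : R => 2 * t + 2 * (sin t * cos t))
      (4 * cos t ^+ 2).
    apply: is_derive_eq; rewrite /GRing.scale/=.
    by rewrite mulrN -!expr2 sin2cos2; ring.
  rewrite (@continuous_FTC2 _ (fun t => 4 * cos t ^+ 2)
    (fun t : R => 2 * t + 2 * (sin t * cos t)))//.
  + rewrite cosN cos_pihalf !mulr0 !addr0 -EFinB; congr EFin.
    by field.
  + apply: continuous_subspaceT => t; apply: cvgM; first exact: cvg_cst.
    by apply: cvgM; exact: continuous_cos.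
  + have cF t : {for t, continuous (fun t : R => 2 * t + 2 * (sin t * cos t))}.
      apply: differentiable_continuous; apply/derivable1_diffP.
      exact: ex_derive.
    split.
    * by move=> t _; exact: ex_derive.
    * by apply: cvg_at_right_filter; exact: cF.
    * by apply: cvg_at_left_filter; exact: cF.
  + by move=> t _; rewrite derive1E derive_val.
- exact: ltW.
- by move=> x y xI yI xy; rewrite ltr_pM2l// ltr_sin.
- by rewrite D2sin => t _; exact: continuous_2cos.
- rewrite D2sin; apply: cvgP; apply: cvg_at_right_filter.
  exact: continuous_2cos.
- rewrite D2sin; apply: cvgP; apply: cvg_at_left_filter.
  exact: continuous_2cos.
- split.
  + by move=> t _; exact: derivableM.
  + by apply: cvg_at_right_filter; exact: continuous_2sin.
  + by apply: cvg_at_left_filter; exact: continuous_2sin.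
- exact: continuous_subspaceT.
Qed.

Lemma integral_semicircle_pdf :
  (\int[mu]_(s in setT) (semicircle_pdf s)%:E = 1)%E.
Proof.
transitivity (\int[mu]_(s in setT)
    (((2 * pi)^-1)%:E * ((EFin \o (fun s => Num.sqrt (4 - s ^+ 2)))
      \_ `[(- 2)%R, 2%R]) s))%E.
  apply: eq_integral => s _; rewrite /semicircle_pdf patchE indicE.
  by case: ifPn => _; rewrite ?mulr1 ?mulr0 ?mule0 ?EFinM.
rewrite ge0_integralZl//.
- rewrite -integral_mkcond [X in (_ * X)%E]integral_sqrt -EFinM mulVf//.
  by rewrite mulf_neq0// gt_eqF// pi_gt0.
- apply/(measurable_restrictT _ _).1 => //; apply/measurable_EFinP.
  by apply: measurable_funTS; exact: continuous_measurable_fun sqrt_continuous4.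
- by move=> s _; rewrite patchE; case: ifPn => // _; rewrite lee_fin sqrtr_ge0.
- by rewrite lee_fin invr_ge0 mulr_ge0// pi_ge0.
Qed.

Definition semicircle (B : set (measurableTypeR R)) : \bar R :=
  (\int[mu]_(s in B) (semicircle_pdf s)%:E)%E.

Let integrable_semicircle_pdf : mu.-integrable setT (EFin \o semicircle_pdf).
Proof.
apply/integrableP; split.
  apply/measurable_EFinP; exact: measurable_semicircle_pdf.
under eq_integral => s _ do
  rewrite /= ger0_norm ?semicircle_pdf_ge0//.
by rewrite integral_semicircle_pdf ltry.
Qed.

Let semicircle0 : semicircle set0 = 0%E.
Proof. by rewrite /semicircle integral_set0. Qed.

Let semicircle_ge0 B : (0 <= semicircle B)%E.
Proof.
by apply: integral_ge0 => s _; rewrite lee_fin semicircle_pdf_ge0.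
Qed.

Let semicircle_sigma_additive : semi_sigma_additive semicircle.
Proof.
move=> /= A mA tA mUA; rewrite /semicircle/= integral_bigcup//=; last first.
  by apply: (integrableS _ _ (@subsetT _ _)) => //;
    exact: integrable_semicircle_pdf.
apply: is_cvg_ereal_nneg_natsum_cond => n _ _.
by apply: integral_ge0 => /= s _; rewrite lee_fin semicircle_pdf_ge0.
Qed.

HB.instance Definition _ := isMeasure.Build _ _ _
  semicircle semicircle0 semicircle_ge0 semicircle_sigma_additive.

Let semicircle_setT : semicircle setT = 1%E.
Proof. exact: integral_semicircle_pdf. Qed.

HB.instance Definition _ :=
  @Measure_isProbability.Build _ _ R semicircle semicircle_setT.

End Semicircle.

Section WeakConvergence.
Context {R : realType}.
Notation law := (probability (measurableTypeR R) R).

Definition weak_cvg (nu_ : nat -> law) (nu : law) : Prop :=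
  forall f : R -> R, continuous f -> bounded_fun f ->
    (\int[nu_ n]_x (f x)%:E)%E @[n --> \oo] --> (\int[nu]_x (f x)%:E)%E.

(* A measure is a function on all subsets that is only constrained on the
   measurable ones, so points at distance 0 are identified by their values on
   measurable sets, not by Leibniz equality. *)
Definition metrizes_weak_cvg (rho : law -> law -> R) : Prop :=
  [/\ forall nu nu', 0 <= rho nu nu',
      forall nu nu', rho nu nu' = 0 <->
        (forall B, measurable B -> nu B = nu' B),
      forall nu nu', rho nu nu' = rho nu' nu,
      forall nu1 nu2 nu3, rho nu1 nu3 <= rho nu1 nu2 + rho nu2 nu3 &
      forall (nu_ : nat -> law) nu,
        rho (nu_ n) nu @[n --> \oo] --> 0 <-> weak_cvg nu_ nu].

Definition weak_cvg_in_probability (disp : nat -> measure_display)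
    (T : forall n, measurableType (disp n)) (P : forall n, probability (T n) R)
    (nu_ : forall n, T n -> law) (nu : law) : Prop :=
  forall rho, metrizes_weak_cvg rho -> forall eps : R, 0 < eps ->
    P n [set w | eps <= rho (nu_ n w) nu] @[n --> \oo] --> 0%E.

End WeakConvergence.

Definition mutually_independent (R : realType) d d' (T : measurableType d)
    (T' : measurableType d') (P : probability T R) (I : finType) (D : {set I})
    (X : I -> {RV P >-> T'}) : Prop :=
  forall (S : {set I}) (B : I -> set T'), S \subset D ->
    (forall i, measurable (B i)) ->
    P (\bigcap_(i in [set` S]) X i @^-1` B i) =
      (\prod_(i in S) P (X i @^-1` B i))%E.

(* Main.v *)
(* The resolvent G of the rescaled adjacency matrix is studied at z = i eta with
   eta large. Both adjacency matrices are sums, over the potential d-cells t whose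
   skeleton is present, of the indicator of t times a block supported on the
   facets of t. Integrating by parts in these indicators gives, for every facet i,
   1 + z G_ii + (p_d / m) (sum over the neighbours j of i of G_jj) G_ii = o(1) in
   mean square. A second moment computation shows that almost all present facets
   have nearly the same number of neighbours in the skeleton, so for eta large
   this equation is a contraction around the root s of 1 + s z + s^2 = 0, the
   Stieltjes transform of the semicircle law, and the average of the G_ii over the
   present facets converges to s in probability. Countably many values of eta
   determine weak convergence: by partial fractions and Weierstrass approximation
   the kernels 1/(x^2 + eta^2) and x/(x^2 + eta^2) approximate every bounded
   continuous test function on compact sets. *)

Require Import Defs.
From HB Require Import structures.
From mathcomp Require Import all_boot all_order all_algebra all_fingroup.
From mathcomp Require Import all_reals complex zify ring lra.

Set Implicit Arguments.
Unset Strict Implicit.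
Unset Printing Implicit Defensive.

Import Order.TTheory GRing.Theory Num.Theory.

Local Open Scope ring_scope.

(** * Bernoulli expectations *)

(** The matrices have random size and uncentred entries. For the size, everything is indexed by all
    d-subsets of the vertices: absent facets give zero rows, and the resolvent of the adjacency
    matrix is a corner of that of the large matrix. Lack of centring leaves a first-order term q b
    sum_t (G B_t)_ii, with q = p_d and b = m^(-1/2). As B_t has zero diagonal, only off-diagonal
    entries of G occur in it; by the Ward identity their squares sum to at most 1 along a row, and
    Cauchy-Schwarz turns the trivial order q b n into q b sqrt(n), that is sqrt(q). The other errors
    in the equation are of order b and q. Only the squares of the entries and the symmetry of B_t
    are used, so one argument covers both matrices. If k bounds the skeleton probabilities from
    below, the contraction asks for |z| >= 8/k + 1; all values of eta are taken above this threshold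
    and accumulate at it, so that powers of a single kernel arise as limits. Since the metric in the
    conclusion is arbitrary, a contradiction argument reduces it to finitely many kernels. *)

Definition upd (I : finType) (c : {ffun I -> bool}) (i : I) (b : bool) :
    {ffun I -> bool} :=
  [ffun j => if j == i then b else c j].

Lemma updE (I : finType) (c : {ffun I -> bool}) i b j :
  upd c i b j = if j == i then b else c j.
Proof. by rewrite ffunE. Qed.

Lemma upd_upd (I : finType) (c : {ffun I -> bool}) i b b' :
  upd (upd c i b) i b' = upd c i b'.
Proof. by apply/ffunP => j; rewrite !updE; case: eqP. Qed.

Lemma upd_id (I : finType) (c : {ffun I -> bool}) i : upd c i (c i) = c.
Proof. by apply/ffunP => j; rewrite !updE; case: eqP => [->|]. Qed.

Section BernoulliExpectation.
Variables (I : finType) (K : comPzRingType) (p : I -> K).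
Implicit Types (c : {ffun I -> bool}) (f g : {ffun I -> bool} -> K).

(** The ring is general because the same sum is read over the reals, over [R[i]] for resolvent
    entries, and over polynomials with every parameter equal to ['X], where it produces Bernstein
    polynomials. [Ex_rmorph] passes between these readings. *)
Definition bern_wt c : K := \prod_i (if c i then p i else 1 - p i).

Definition Ex f : K := \sum_c bern_wt c * f c.

Lemma Ex_prod (S : {set I}) :
  Ex (fun c => \prod_(i in S) (c i)%:R) = \prod_(i in S) p i.
Proof.
transitivity (\sum_(c : {ffun I -> bool}) \prod_i
    ((if c i then p i else 1 - p i) * (if i \in S then (c i)%:R else 1))).
  apply: eq_bigr => c _; rewrite big_split/=; congr (_ * _).
  by rewrite big_mkcond.
rewrite -(bigA_distr_bigA (fun i (b : bool) =>
  (if b then p i else 1 - p i) * (if i \in S then b%:R else 1))).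
rewrite [RHS]big_mkcond; apply: eq_bigr => i _; rewrite big_bool/=.
by case: (i \in S); rewrite ?mulr1 ?mulr0 ?addr0 // addrCA subrr addr0.
Qed.

Lemma eq_Ex f g : f =1 g -> Ex f = Ex g.
Proof. by move=> fg; apply: eq_bigr => c _; rewrite fg. Qed.

Lemma Ex1 : Ex (fun=> 1) = 1.
Proof.
have := Ex_prod set0; rewrite big_set0 => E; rewrite -[RHS]E; apply: eq_Ex => c.
by rewrite big_set0.
Qed.

Lemma ExD f g : Ex (fun c => f c + g c) = Ex f + Ex g.
Proof. by rewrite -big_split/=; apply: eq_bigr => c _; rewrite mulrDr. Qed.

Lemma ExZ a f : Ex (fun c => a * f c) = a * Ex f.
Proof. by rewrite mulr_sumr; apply: eq_bigr => c _; rewrite mulrCA. Qed.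

Lemma ExN f : Ex (fun c => - f c) = - Ex f.
Proof. by rewrite -mulN1r -ExZ; apply: eq_Ex => c; rewrite mulN1r. Qed.

Lemma ExB f g : Ex (fun c => f c - g c) = Ex f - Ex g.
Proof. by rewrite ExD ExN. Qed.

Lemma Ex_cst a : Ex (fun=> a) = a.
Proof.
by rewrite -[RHS]mulr1 -Ex1 -ExZ; apply: eq_Ex => c; rewrite mulr1.
Qed.

Lemma Ex_sum J (r : seq J) (P : pred J) (F : J -> {ffun I -> bool} -> K) :
  Ex (fun c => \sum_(j <- r | P j) F j c) = \sum_(j <- r | P j) Ex (F j).
Proof.
rewrite exchange_big/=; apply: eq_bigr => c _.
by rewrite mulr_sumr.
Qed.

(** Integration by parts for a Bernoulli variable: [f] may depend on [c i], and the price for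
    pulling out the mean is that the coordinate is forced to be true inside [f]. *)
Lemma Ex_upd i f : Ex (fun c => (c i)%:R * f c) = p i * Ex (fun c => f (upd c i true)).
Proof.
pose r c := \prod_(j | j != i) (if c j then p j else 1 - p j).
have wtE c : bern_wt c = (if c i then p i else 1 - p i) * r c.
  by rewrite /bern_wt (bigD1 i).
have r_upd c b : r (upd c i b) = r c.
  by apply: eq_bigr => j ji; rewrite updE (negPf ji).
(* If [g] ignores coordinate i, flipping that coordinate pairs the configurations, and the two
   weights [p i] and [1 - p i] add up to 1. *)
have ExE g : (forall c b, g (upd c i b) = g c) ->
    Ex g = \sum_(c : {ffun I -> bool} | c i) r c * g c.
  move=> gi; rewrite /Ex (bigID (fun c : {ffun I -> bool} => c i))/=.
  have -> : \sum_(c : {ffun I -> bool} | ~~ c i) bern_wt c * g c =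
            \sum_(c : {ffun I -> bool} | c i) (1 - p i) * r c * g c.
    rewrite (reindex_onto (fun c => upd c i false) (fun c => upd c i true))/=.
      apply: eq_big => [c|c ci].
        rewrite upd_upd updE eqxx/=.
        by case: (boolP (c i)) => [ci|/negP ci]; [rewrite -{1}ci upd_id eqxx|
          
          apply/eqP => /ffunP /(_ i); rewrite updE eqxx => /esym].
      by rewrite wtE updE eqxx r_upd gi.
    by move=> c ci; rewrite upd_upd -(negPf ci) upd_id.
  rewrite -big_split/=; apply: eq_bigr => c ci; rewrite wtE ci; ring.
rewrite (ExE (fun c => f (upd c i true))); last first.
  by move=> c b; rewrite upd_upd.
rewrite /Ex mulr_sumr (bigID (fun c : {ffun I -> bool} => c i))/= [X in _ + X]big1 ?addr0.
  apply: eq_bigr => c ci.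
  have -> : upd c i true = c by rewrite -ci upd_id.
  by rewrite wtE ci mul1r mulrA.
by move=> c /negPf ->; rewrite mul0r mulr0.
Qed.

End BernoulliExpectation.

Section BernoulliExpectationReal.
Variables (I : finType) (R : realFieldType) (p : I -> R).
Hypothesis p01 : forall i, 0 <= p i <= 1.
Implicit Types (c : {ffun I -> bool}) (f g : {ffun I -> bool} -> R).

Lemma bern_wt_ge0 c : 0 <= bern_wt p c.
Proof.
apply: prodr_ge0 => i _; have /andP[p0 p1] := p01 i.
by case: ifP; rewrite ?subr_ge0.
Qed.

Lemma le_Ex f g : (forall c, f c <= g c) -> Ex p f <= Ex p g.
Proof. by move=> fg; apply: ler_sum => c _; rewrite ler_wpM2l ?bern_wt_ge0. Qed.

Lemma Ex_ge0 f : (forall c, 0 <= f c) -> 0 <= Ex p f.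
Proof. by move=> f0; rewrite -(Ex_cst p 0); apply: le_Ex. Qed.

End BernoulliExpectationReal.

Lemma Ex_rmorph (I : finType) (K L : comPzRingType) (phi : {rmorphism K -> L})
    (p : I -> K) (f : {ffun I -> bool} -> K) :
  phi (Ex p f) = Ex (phi \o p) (phi \o f).
Proof.
rewrite rmorph_sum; apply: eq_bigr => c _; rewrite rmorphM rmorph_prod/=.
congr (_ * _); apply: eq_bigr => i _.
by case: ifP; rewrite ?rmorphB ?rmorph1.
Qed.

(** The weight [u] is the indicator of a present facet in the degree estimate and the constant 1 in
    the Bernstein estimate. *)
Lemma Ex_sqr_sum_uncorrelated (I J : finType) (R : realFieldType) (p : I -> R)
    (A : {set J}) (u : {ffun I -> bool} -> R)
    (X : J -> {ffun I -> bool} -> R) (a : R) :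
  (forall j k, j \in A -> k \in A -> j != k ->
    Ex p (fun c => u c * (X j c * X k c)) = 0) ->
  (forall j, j \in A -> Ex p (fun c => u c * X j c ^+ 2) <= a) ->
  Ex p (fun c => u c * (\sum_(j in A) X j c) ^+ 2) <= #|A|%:R * a.
Proof.
move=> X0 X2.
have -> : Ex p (fun c => u c * (\sum_(j in A) X j c) ^+ 2) =
    \sum_(j in A) Ex p (fun c => u c * X j c ^+ 2).
  transitivity (Ex p (fun c =>
      \sum_(j in A) \sum_(k in A) u c * (X j c * X k c))).
    apply: eq_Ex => c; rewrite expr2 mulr_suml mulr_sumr; apply: eq_bigr => j _.
    by rewrite !mulr_sumr; apply: eq_bigr => k _; ring.
  rewrite Ex_sum; apply: eq_bigr => j jA; rewrite Ex_sum (bigD1 j)//= big1 ?addr0.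
    by apply: eq_Ex => c; rewrite expr2.
  by move=> k /andP[kA kj]; apply: X0 => //; rewrite eq_sym.
rewrite mulr_natl -sumr_const; exact: ler_sum.
Qed.


(** * Resolvents *)

Section ComplexModulus.
Local Open Scope complex_scope.
Variable R : rcfType.
Implicit Types x y : R[i].

(** The norm of [R[i]] has values in [R[i]]; this is the same modulus as an element of the ordered
    field [R]. *)
Definition cabs x : R := complex.Re `|x|.

Lemma cabsE x : (cabs x)%:C = `|x|.
Proof. by rewrite /cabs normc_def. Qed.

Lemma cabs_ge0 x : 0 <= cabs x.
Proof. by rewrite /cabs normc_def sqrtr_ge0. Qed.

Lemma cabs0 : cabs 0 = 0.
Proof. by rewrite /cabs normr0. Qed.

Lemma cabs1 : cabs 1 = 1.
Proof. by rewrite /cabs normr1. Qed.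

Lemma cabsM x y : cabs (x * y) = cabs x * cabs y.
Proof.
by apply: (fmorph_inj (real_complex R)); rewrite rmorphM/= !cabsE normrM.
Qed.

Lemma cabsN x : cabs (- x) = cabs x.
Proof. by rewrite /cabs normrN. Qed.

Lemma cabsJ x : cabs x^* = cabs x.
Proof. by rewrite /cabs normcJ. Qed.

Lemma cabsD x y : cabs (x + y) <= cabs x + cabs y.
Proof. by rewrite -lecR rmorphD/= !cabsE; exact: ler_normD. Qed.

Lemma cabsB x y : cabs (x - y) <= cabs x + cabs y.
Proof. by rewrite (le_trans (cabsD _ _))// cabsN. Qed.

Lemma cabs_real (a : R) : cabs a%:C = `|a|.
Proof. by rewrite /cabs normc_def/= expr0n addr0 sqrtr_sqr. Qed.

Lemma cabs_sqr x : cabs x ^+ 2 = complex.Re x ^+ 2 + complex.Im x ^+ 2.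
Proof. by rewrite /cabs normc_def/= sqr_sqrtr// addr_ge0 ?sqr_ge0. Qed.

Lemma cabs_sqrC x : (cabs x ^+ 2)%:C = x * x^*.
Proof. by rewrite rmorphXn/= cabsE sqr_normc. Qed.

Lemma Re_le_cabs x : `|complex.Re x| <= cabs x.
Proof.
rewrite -(ler_pXn2r (n := 2)) ?nnegrE ?cabs_ge0// cabs_sqr real_normK ?num_real//.
by rewrite lerDl sqr_ge0.
Qed.

Lemma Im_le_cabs x : `|complex.Im x| <= cabs x.
Proof.
rewrite -(ler_pXn2r (n := 2)) ?nnegrE ?cabs_ge0// cabs_sqr real_normK ?num_real//.
by rewrite lerDr sqr_ge0.
Qed.

Lemma cabs_sum I (r : seq I) (P : pred I) (F : I -> R[i]) :
  cabs (\sum_(i <- r | P i) F i) <= \sum_(i <- r | P i) cabs (F i).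
Proof.
apply: (big_ind2 (fun x (y : R) => cabs x <= y)) => //.
  by rewrite cabs0.
by move=> x1 x2 y1 y2 h1 h2; rewrite (le_trans (cabsD _ _))// lerD.
Qed.

End ComplexModulus.

Section Resolvent.
Local Open Scope complex_scope.
Variables (R : rcfType) (N : nat) (M : 'M[R]_N) (z : R[i]).
Hypothesis Msym : M^T = M.
Hypothesis Imz : 0 < complex.Im z.
Local Notation Mz := (map_mx (real_complex R) M - z%:M).

Definition resolvent : 'M[R[i]]_N := invmx Mz.

(** A real symmetric matrix has a real quadratic form, so only [- z%:M] contributes an imaginary
    part. Both invertibility and the Ward identity are instances. *)
Lemma Im_quadratic_form (u : 'rV[R[i]]_N) :
  complex.Im (\sum_j (u *m Mz) 0 j * (u 0 j)^*) =
  - (complex.Im z * \sum_j cabs (u 0 j) ^+ 2).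
Proof.
have -> : \sum_j (u *m Mz) 0 j * (u 0 j)^* =
    \sum_j \sum_k u 0 k * (M k j)%:C * (u 0 j)^* -
    z * (\sum_j cabs (u 0 j) ^+ 2)%:C.
  rewrite mulmxBr mul_mx_scalar rmorph_sum/= mulr_sumr -sumrB.
  apply: eq_bigr => j _; rewrite !mxE mulrBl cabs_sqrC mulr_suml mulrA.
  by congr (_ - _); apply: eq_bigr => k _; rewrite !mxE.
set q := \sum_j _; set t := \sum_j _.
have qreal : complex.Im q = 0.
  have : q^* = q.
    rewrite rmorph_sum/= /q [RHS]exchange_big/=; apply: eq_bigr => j _.
    rewrite rmorph_sum; apply: eq_bigr => k _.
    rewrite !rmorphM/= conjcK -{1}Msym mxE.
    have -> : M j k -i* 0 = (M j k)%:C by rewrite oppr0.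
    by rewrite -mulrA mulrC [_ * u 0 j]mulrC.
  case: q => a b /= [] /eqP; rewrite eq_sym -subr_eq0 opprK -mulr2n mulrn_eq0/=.
  by move/eqP.
case: q qreal => a b /= ->; case: z => x y/=; ring.
Qed.

Lemma resolvent_unit : Mz \in unitmx.
Proof.
rewrite -row_free_unit -kermx_eq0; apply/rowV0P => u /sub_kermxP uM.
have := Im_quadratic_form u; rewrite uM big1 => [|j _]; last first.
  by rewrite mxE mul0r.
move/esym/eqP; rewrite oppr_eq0 mulf_eq0 gt_eqF//= psumr_eq0 => [|j _].
  move=> /allP u0; apply/rowP => j; rewrite mxE.
  have := u0 j (mem_index_enum _); rewrite /= sqrf_eq0 => /eqP uj.
  by apply/normr0_eq0; rewrite -cabsE uj.
exact: sqr_ge0.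
Qed.

Lemma resolventVl : resolvent *m Mz = 1%:M.
Proof. exact: mulVmx resolvent_unit. Qed.

Lemma resolventVr : Mz *m resolvent = 1%:M.
Proof. exact: mulmxV resolvent_unit. Qed.

Lemma resolvent_unique (G : 'M[R[i]]_N) : Mz *m G = 1%:M -> G = resolvent.
Proof.
by move=> MG; rewrite -[G]mul1mx -resolventVl -mulmxA MG mulmx1.
Qed.

(** [Im_quadratic_form] at the i-th row of the resolvent, whose product with [Mz] is the i-th basis
    vector. *)
Lemma ward i :
  complex.Im z * \sum_j cabs (resolvent i j) ^+ 2 = complex.Im (resolvent i i).
Proof.
have := Im_quadratic_form (row i resolvent).
rewrite -row_mul resolventVl (bigD1 i)//= big1 => [|j ji]; last first.
  by rewrite !mxE eq_sym (negPf ji) mul0r.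
under [in RHS]eq_bigr do rewrite mxE.
rewrite !mxE eqxx mul1r addr0.
by case: (resolvent i i) => a b /= /oppr_inj.
Qed.

(** Let s be the sum of squares along row i and y = Im z. Ward gives y s <= |G_ii|, while |G_ii|^2
    <= s; hence |G_ii| <= 1/y, and feeding this back gives s <= 1/y^2. No eigenvalues are
    involved. *)
Lemma resolvent_le i j : cabs (resolvent i j) <= (complex.Im z)^-1.
Proof.
have := ward i; set s := \sum_j _ => si.
have le_s k : cabs (resolvent i k) ^+ 2 <= s.
  by rewrite /s (bigD1 k)//= lerDl sumr_ge0// => l _; exact: sqr_ge0.
have := le_trans (ler_norm _) (Im_le_cabs (resolvent i i)).
rewrite -si => h; have := le_s i; set a := cabs _ in h * => a2.
have {}h : complex.Im z * s <= (complex.Im z)^-1.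
  rewrite (le_trans h)//; have [->|a0] := eqVneq a 0.
    by rewrite invr_ge0 ltW.
  rewrite -[leRHS]mul1r ler_pdivlMr// -(ler_pM2r (x := a)) ?mul1r; last first.
    by rewrite lt_neqAle eq_sym a0 cabs_ge0.
  by rewrite mulrAC -expr2 mulrC (le_trans _ h)// ler_pM2l.
have : cabs (resolvent i j) ^+ 2 <= (complex.Im z)^-1 ^+ 2.
  rewrite (le_trans (le_s j))// -(ler_pM2l Imz) (le_trans h)//.
  by rewrite expr2 mulVKf// gt_eqF.
by rewrite ler_pXn2r ?nnegrE ?cabs_ge0// invr_ge0 ltW.
Qed.

Lemma resolvent_row_le i :
  \sum_j cabs (resolvent i j) ^+ 2 <= (complex.Im z)^-1 ^+ 2.
Proof.
rewrite -(ler_pM2l Imz) ward (le_trans (ler_norm _))// (le_trans (Im_le_cabs _))//.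
by rewrite expr2 mulVKf ?gt_eqF//; exact: resolvent_le.
Qed.

End Resolvent.

Lemma resolvent_sub (R : rcfType) N (M M' : 'M[R]_N) (z : R[i]) :
  M^T = M -> M'^T = M' -> 0 < complex.Im z ->
  resolvent M' z - resolvent M z =
  - (resolvent M' z *m map_mx (real_complex R) (M' - M) *m resolvent M z).
Proof.
move=> sM sM' z0.
have -> : map_mx (real_complex R) (M' - M) =
    (map_mx (real_complex R) M' - z%:M) - (map_mx (real_complex R) M - z%:M).
  by rewrite map_mxB opprB addrA addrNK.
rewrite mulmxBr mulmxBl resolventVl// -(mulmxA (resolvent M' z)) resolventVr//.
by rewrite mul1mx mulmx1 opprB.
Qed.

(** * Real symmetric matrices: eigenvalues and the trace of the resolvent *)

Section RealSymmetricSpectrum.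
Local Open Scope complex_scope.

Lemma char_poly_conj (F : fieldType) N (A P : 'M[F]_N) : P \in unitmx ->
  char_poly (invmx P *m A *m P) = char_poly A.
Proof.
move=> Pu; rewrite /char_poly.
have -> : char_poly_mx (invmx P *m A *m P) =
    map_mx polyC (invmx P) *m char_poly_mx A *m map_mx polyC P.
  rewrite /char_poly_mx !map_mxM mulmxBr mulmxBl; congr (_ - _).
  by rewrite scalar_mxC -mulmxA -map_mxM mulVmx// map_mx1 mulmx1.
rewrite !det_mulmx mulrC mulrA -det_mulmx -map_mxM mulmxV//.
by rewrite map_mx1 det1 mul1r.
Qed.

(** Diagonalization takes place over [R[i]]. The eigenvalues are real because the matrix is
    Hermitian, and the factorization of the characteristic polynomial descends to [R] by injectivity
    of [map_poly]; it is what links the list to [eigenvalues]. *)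
Lemma real_symmetric_spectrum (R : rcfType) N (M : 'M[R]_N) : M^T = M ->
  exists s : seq R, [/\ size s = N, char_poly M = \prod_(a <- s) ('X - a%:P) &
    forall z, 0 < complex.Im z ->
      \tr (resolvent M z) = \sum_(a <- s) (a%:C - z)^-1].
Proof.
move=> Msym; pose A := map_mx (real_complex R) M.
have Aherm : A \is hermsymmx.
  apply: realsym_hermsym.
    apply/is_hermitianmxP; rewrite expr0 scale1r.
    by apply/matrixP => i j; rewrite !mxE -{1}Msym mxE.
  by apply/mxOverP => i j; rewrite mxE complex_real.
have /orthomx_spectralP := hermitian_normalmx Aherm.
have /mxOverP dreal := hermitian_spectral_diag_real Aherm.
have := spectral_unit A.
set P := spectralmx A; set D := spectral_diag A in dreal * => Pu AE.
pose r j := complex.Re (D 0 j).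
have Dr j : D 0 j = (r j)%:C by rewrite RRe_real.
exists [seq r j | j <- enum 'I_N]; split.
- by rewrite size_map size_enum_ord.
- apply: (map_poly_inj (real_complex R)).
  rewrite map_char_poly -/A AE char_poly_conj// char_poly_trig; last first.
    exact: diag_mx_is_trig.
  rewrite rmorph_prod/= big_map big_enum/=; apply: eq_bigr => j _.
  by rewrite mxE eqxx mulr1n Dr rmorphB/= map_polyX map_polyC.
- move=> z z0; have Dz j : D 0 j - z != 0.
    apply/negP => /eqP /(congr1 (@complex.Im R)); rewrite Dr.
    by case: z z0 => x y /= y0 /eqP; rewrite sub0r oppr_eq0 gt_eqF.
  have <- : invmx P *m diag_mx (\row_j (D 0 j - z)^-1) *m P = resolvent M z.
    apply: resolvent_unique => //; rewrite -/A AE.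
    have -> : z%:M = invmx P *m z%:M *m P.
      by rewrite scalar_mxC -mulmxA mulVmx// mulmx1.
    rewrite -mulmxBl -mulmxBr -!mulmxA (mulmxA P) mulmxV// mul1mx.
    rewrite (mulmxA (_ - _)).
    have -> : diag_mx D - z%:M = diag_mx (\row_j (D 0 j - z)).
      by apply/matrixP => i j; rewrite !mxE; case: eqP => [->|]; rewrite ?subr0.
    have -> : diag_mx (\row_j (D 0 j - z)) *m diag_mx (\row_j (D 0 j - z)^-1) = 1%:M.
      apply/matrixP => i j; rewrite mul_diag_mx !mxE.
      by case: eqP => [->|]; rewrite ?mulr1n ?mulr0n ?mulr0 ?divff.
    by rewrite mul1mx mulVmx.
  rewrite mxtrace_mulC mulmxA mulmxV// mul1mx mxtrace_diag big_map big_enum/=.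
  by apply: eq_bigr => j _; rewrite mxE Dr.
Qed.

End RealSymmetricSpectrum.

(** * Random sums of blocks *)

Section BlockPerturbation.
Local Open Scope complex_scope.
Variables (R : rcfType) (N k : nat) (face : pred 'I_N) (b : R) (B : 'M[R]_N).
Hypothesis b0 : 0 <= b.
Hypothesis face_card : (#|face| <= k)%N.
Hypothesis Bsq : forall i j, B i j ^+ 2 = ([&& i != j, face i & face j])%:R.
Hypothesis Bsym : B^T = B.
Local Notation f i := ((face i)%:R : R).
Local Notation K := (k%:R : R).
Local Notation C := R[i].
Implicit Types (A G H L : 'M[C]_N).

(** [Bsq] fixes the entries of [B] only up to sign, which lets the signed and the unsigned matrix
    share all the estimates. *)
Definition block : 'M[C]_N := map_mx (real_complex R) (b *: B).

Lemma sum_face_le a : 0 <= a -> \sum_i f i * a <= K * a.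
Proof.
move=> a0; rewrite -mulr_suml -natr_sum ler_wpM2r// ler_nat.
rewrite (leq_trans _ face_card)// -sum1_card [leqRHS]big_mkcond.
by apply: leq_sum => i _; rewrite unfold_in; case: (face i).
Qed.

Lemma cabs_block i j : cabs (block i j) <= b * (f i * f j).
Proof.
rewrite !mxE cabs_real normrM ger0_norm// ler_wpM2l//.
have : `|B i j| ^+ 2 <= (f i * f j) ^+ 2.
  rewrite real_normK ?num_real// Bsq.
  by case: (i != j); case: (face i); case: (face j); rewrite /= ?mulr1 ?mulr0 ?expr0n ?expr1n.
by rewrite ler_pXn2r// nnegrE// mulr_ge0.
Qed.

Lemma cabs_mul_block A i j a : (forall l, cabs (A i l) <= a) ->
  cabs ((A *m block) i j) <= b * K * a * f j.
Proof.
move=> Aa; have a0 : 0 <= a by rewrite (le_trans (cabs_ge0 _) (Aa i)).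
rewrite mxE (le_trans (cabs_sum _ _ _))//.
apply: (@le_trans _ _ (\sum_l f l * (b * a * f j))).
  apply: ler_sum => l _; rewrite cabsM.
  have -> : f l * (b * a * f j) = a * (b * (f l * f j)) by ring.
  by apply: ler_pM => //; rewrite ?cabs_ge0 ?cabs_block.
apply: le_trans (sum_face_le _) _; first by rewrite !mulr_ge0.
by rewrite le_eqVlt; apply/orP; left; apply/eqP; ring.
Qed.

Lemma cabs_mul_face A G i j a : 0 <= a -> (forall l, cabs (A i l) <= a * f l) ->
  (forall l, cabs (G l j) <= 1) -> cabs ((A *m G) i j) <= K * a.
Proof.
move=> a0 Aa G1; rewrite mxE (le_trans (cabs_sum _ _ _))//.
apply: (@le_trans _ _ (\sum_l f l * a)); last exact: sum_face_le.
apply: ler_sum => l _; rewrite cabsM mulrC -[leRHS]mul1r.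
by apply: ler_pM; rewrite ?cabs_ge0// mulrC.
Qed.

(** One such sum may be of order 1. The gain comes from adding over all blocks through a facet:
    [sum_off_diag_row] gives order sqrt(n) where n is the trivial order. *)
Definition off_diag_row G i : R := \sum_(j | j != i) f j * cabs (G i j).

Lemma off_diag_row_ge0 G i : 0 <= off_diag_row G i.
Proof. by apply: sumr_ge0 => j _; rewrite mulr_ge0 ?cabs_ge0. Qed.

(** The diagonal of a block vanishes, so only off-diagonal entries of [G] enter; this is what makes
    the first-order term small. *)
Lemma cabs_mul_block_diag G i :
  cabs ((G *m block) i i) <= b * f i * off_diag_row G i.
Proof.
rewrite mxE (bigD1 i)//=.
have -> : block i i = 0.
  have := Bsq i i; rewrite eqxx/= => /eqP; rewrite sqrf_eq0 => /eqP Bii.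
  by rewrite !mxE Bii mulr0.
rewrite mulr0 add0r (le_trans (cabs_sum _ _ _))// mulr_sumr.
apply: ler_sum => j _; rewrite cabsM.
have -> : b * f i * (f j * cabs (G i j)) = cabs (G i j) * (b * (f j * f i)) by ring.
by rewrite ler_wpM2l ?cabs_ge0 ?cabs_block.
Qed.

(** Power counting for this and the next two bounds: each block contributes a factor [b], and each
    summation over the faces of the block a factor [K]. *)
Lemma cabs_GBG G H i j : (forall i j, cabs (G i j) <= 1) ->
  (forall i j, cabs (H i j) <= 1) -> cabs ((G *m block *m H) i j) <= b * K ^+ 2.
Proof.
move=> G1 H1.
apply: le_trans (@cabs_mul_face _ _ _ _ (b * K) _ _ _) _ => //.
- by rewrite mulr_ge0.
- by move=> l; rewrite -[b * K]mulr1; apply: cabs_mul_block.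
- by rewrite le_eqVlt; apply/orP; left; apply/eqP; ring.
Qed.

Lemma cabs_GBGB G H i j : (forall i j, cabs (G i j) <= 1) ->
  (forall i j, cabs (H i j) <= 1) ->
  cabs ((G *m block *m H *m block) i j) <= b ^+ 2 * K ^+ 3 * f j.
Proof.
move=> G1 H1; apply: le_trans (cabs_mul_block _ (fun l => cabs_GBG i l G1 H1)) _.
by rewrite le_eqVlt; apply/orP; left; apply/eqP; ring.
Qed.

Lemma cabs_GBGBGB G H L i j : (forall i j, cabs (G i j) <= 1) ->
  (forall i j, cabs (H i j) <= 1) -> (forall i j, cabs (L i j) <= 1) ->
  cabs ((G *m block *m H *m block *m L *m block) i j) <= b ^+ 3 * K ^+ 5 * f j.
Proof.
move=> G1 H1 L1; apply: (@le_trans _ _ (b * K * (K * (b ^+ 2 * K ^+ 3)) * f j)).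
  apply: cabs_mul_block => l; apply: cabs_mul_face => //.
    by rewrite mulr_ge0 ?exprn_ge0.
  by move=> r; apply: cabs_GBGB.
by rewrite le_eqVlt; apply/orP; left; apply/eqP; ring.
Qed.

(** In the sum of G_il B_lj G_jr B_ri over l, j, r, the paths with l = i and j = r give the
    subtracted main term, the source of the quadratic term in the self-consistent equation. Every
    other path contains an off-diagonal entry of [G]: either G_il with l != i, or G_jr with j !=
    r. *)
Lemma cabs_GBGB_diag G i : (forall i j, cabs (G i j) <= 1) ->
  cabs ((G *m block *m G *m block) i i -
    (b ^+ 2)%:C * \sum_j (B i j ^+ 2)%:C * (G i i * G j j)) <=
  b ^+ 2 * f i * (K ^+ 2 * off_diag_row G i +
    \sum_l f l * off_diag_row G l).
Proof.
move=> G1.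
have offB l : cabs ((G *m block) i l - G i i * block i l) <=
    b * f l * off_diag_row G i.
  rewrite mxE (bigD1 i)//= addrAC subrr add0r (le_trans (cabs_sum _ _ _))//.
  rewrite mulr_sumr; apply: ler_sum => j _; rewrite cabsM.
  have -> : b * f l * (f j * cabs (G i j)) = cabs (G i j) * (b * (f j * f l)) by ring.
  by rewrite ler_wpM2l ?cabs_ge0 ?cabs_block.
have -> : (G *m block *m G *m block) i i -
    (b ^+ 2)%:C * \sum_j (B i j ^+ 2)%:C * (G i i * G j j) =
    \sum_r (\sum_l ((G *m block) i l - G i i * block i l) * G l r +
             G i i * \sum_(l | l != r) block i l * G l r) * block r i.
  rewrite mxE mulr_sumr -sumrB; apply: eq_bigr => r _.
  have -> : (b ^+ 2)%:C * ((B i r ^+ 2)%:C * (G i i * G r r)) =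
      G i i * (block i r * G r r) * block r i.
    have Bri : B r i = B i r by rewrite -{1}Bsym mxE.
    by rewrite !mxE Bri !rmorphXn !rmorphM/=; ring.
  rewrite -mulrBl; congr (_ * _).
  rewrite mxE; apply/eqP; rewrite subr_eq; apply/eqP.
  rewrite -addrA -mulrDr [_ + block i r * _]addrC.
  have -> : block i r * G r r + \sum_(l | l != r) block i l * G l r =
     \sum_l block i l * G l r by rewrite [RHS](bigD1 r).
  by rewrite mulr_sumr -big_split/=; apply: eq_bigr => l _; ring.
rewrite (le_trans (cabs_sum _ _ _))//.
apply: (@le_trans _ _ (\sum_r (b * K * off_diag_row G i +
   \sum_(l | l != r) b * f l * cabs (G l r)) * (b * (f r * f i)))).
  apply: ler_sum => r _; rewrite cabsM ler_pM ?cabs_ge0 ?cabs_block//.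
  rewrite (le_trans (cabsD _ _))// lerD//.
    rewrite (le_trans (cabs_sum _ _ _))//.
    apply: (@le_trans _ _ (\sum_l f l * (b * off_diag_row G i))).
      apply: ler_sum => l _; rewrite cabsM -[leRHS]mulr1.
      apply: ler_pM; rewrite ?cabs_ge0//.
      by rewrite (le_trans (offB l))// le_eqVlt; apply/orP; left; apply/eqP; ring.
    apply: le_trans (sum_face_le _) _; first by rewrite mulr_ge0 ?off_diag_row_ge0.
    by rewrite le_eqVlt; apply/orP; left; apply/eqP; ring.
  rewrite cabsM -[leRHS]mul1r ler_pM ?cabs_ge0//.
  rewrite (le_trans (cabs_sum _ _ _))//; apply: ler_sum => l _.
  rewrite cabsM ler_wpM2r ?cabs_ge0// (le_trans (cabs_block _ _))//.
  rewrite ler_wpM2l//; case: (face i) => //=; first by rewrite mul1r.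
  by rewrite mul0r.
rewrite mulrDr.
have -> : b ^+ 2 * f i * \sum_l f l * off_diag_row G l =
   \sum_r (\sum_(l | l != r) b * f l * cabs (G l r)) * (b * (f r * f i)).
  rewrite mulr_sumr.
  under eq_bigr do rewrite /off_diag_row !mulr_sumr big_mkcond.
  under [in RHS]eq_bigr do rewrite mulr_suml big_mkcond.
  rewrite exchange_big; apply: eq_bigr => r _; apply: eq_bigr => l _.
  by rewrite eq_sym; case: ifP => // _; ring.
under eq_bigr do rewrite mulrDl.
rewrite big_split/= lerD2r.
apply: (@le_trans _ _ (\sum_r f r * (b ^+ 2 * K * f i * off_diag_row G i))).
  by rewrite le_eqVlt; apply/orP; left; apply/eqP; apply: eq_bigr => r _; ring.
apply: le_trans (sum_face_le _) _.
  by rewrite !mulr_ge0 ?exprn_ge0 ?off_diag_row_ge0.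
by rewrite le_eqVlt; apply/orP; left; apply/eqP; ring.
Qed.

End BlockPerturbation.

Local Ltac nonneg :=
  repeat first [done | apply: ler0n | apply: addr_ge0 | apply: mulr_ge0
    | apply: exprn_ge0 | apply: sqr_ge0 ].

(** * Integration by parts for random sums of blocks *)

Section RandomBlockMatrix.
Local Open Scope complex_scope.
Variables (R : rcfType) (I : finType) (N k n : nat).
Variables (p : I -> R) (q : R) (top : pred I).
Variables (pot : {ffun I -> bool} -> I -> bool).
Variables (face : I -> pred 'I_N) (B : I -> 'M[R]_N) (m K0 : R) (z : R[i]).
Hypothesis p01 : forall i, 0 <= p i <= 1.
Hypothesis q0 : 0 <= q.
Hypothesis ptop : forall t, top t -> p t = q.
Hypothesis pot_upd : forall c t b t', top t -> pot (upd c t b) t' = pot c t'.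
Hypothesis k0 : (0 < k)%N.
Hypothesis face_card : forall t, top t -> (#|face t| <= k)%N.
Hypothesis Bsq : forall t, top t -> forall i j,
  B t i j ^+ 2 = ([&& i != j, face t i & face t j])%:R.
Hypothesis Bsym : forall t, (B t)^T = B t.
Hypothesis face_deg : forall i, (#|[pred t | top t && face t i]| <= n)%N.
Hypothesis face_uniq : forall i j t t', i != j -> top t -> top t' ->
  face t i -> face t j -> face t' i -> face t' j -> t = t'.
Hypothesis m0 : 0 < m.
Hypothesis m_le : m <= n%:R * k%:R.
Hypothesis qm : q * (n%:R * k%:R) <= K0 * m.
Hypothesis Imz : 1 <= complex.Im z.

Local Notation cfg := {ffun I -> bool}.
Local Notation f t i := ((face t i)%:R : R).
Local Notation K := (k%:R : R).

Definition scal : R := (Num.sqrt m)^-1.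
Local Notation b := scal.

(** Abstract adjacency matrix: [top t] says that t is a potential top cell, [pot c t] that its
    skeleton is present. By [pot_upd] the skeleton is blind to the top coordinates, so switching one
    of them affects at most one summand. *)
Definition block_sum (c : cfg) : 'M[R]_N :=
  \sum_(t | [&& top t, pot c t & c t]) B t.

Definition green (c : cfg) : 'M[R[i]]_N := resolvent (b *: block_sum c) z.
Local Notation G := green.

(** By [Bsq] this counts the top cells with present skeleton that join i to a distinct j, before the
    top indicators are taken into account. *)
Definition weight (c : cfg) i j : R := \sum_(t | top t && pot c t) B t i j ^+ 2.

(* Bernoulli integration by parts in each c t turns 1 + z G_ii = (M G)_ii, where
   M is the scaled block sum, into this self-consistent equation up to an error
   small in mean square. The indicators need not be centered, because q tends
   to 0. *)
Definition defect (c : cfg) i : R[i] :=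
  1 + G c i i * (z + (q * b ^+ 2)%:C * \sum_j (weight c i j)%:C * G c j j).
Local Notation F := defect.

Let Z : R := cabs z.

Lemma scal_ge0 : 0 <= b. Proof. by rewrite invr_ge0 sqrtr_ge0. Qed.

Lemma scal_sqr : b ^+ 2 = m^-1.
Proof. by rewrite exprVn sqr_sqrtr// ltW. Qed.

Let nk0 : 0 < n%:R * K. Proof. exact: lt_le_trans m_le. Qed.

Let K1 : 1 <= K. Proof. by rewrite ler1n. Qed.

Let K00 : 0 <= K0.
Proof.
have : 0 <= K0 * m by rewrite (le_trans _ qm)// mulr_ge0// ltW.
by rewrite pmulr_lge0.
Qed.

Let qb : q * b ^+ 2 * (n%:R * K) <= K0.
Proof. by rewrite scal_sqr mulrAC ler_pdivrMr. Qed.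

Let Imz0 : 0 < complex.Im z. Proof. exact: lt_le_trans Imz. Qed.

Lemma block_sum_sym c : (b *: block_sum c)^T = b *: block_sum c.
Proof.
rewrite linearZ/= /block_sum linear_sum/=; congr (_ *: _).
by apply: eq_bigr => t _; rewrite Bsym.
Qed.

Lemma green_le1 c i j : cabs (G c i j) <= 1.
Proof.
rewrite (le_trans (resolvent_le (block_sum_sym c) Imz0 i j))//.
by rewrite invf_le1.
Qed.

Lemma green_row_le1 c i : \sum_j cabs (G c i j) ^+ 2 <= 1.
Proof.
rewrite (le_trans (resolvent_row_le (block_sum_sym c) Imz0 i))//.
by rewrite exprn_ile1 ?invr_ge0 ?invf_le1// ltW.
Qed.

Lemma face_pair_le1 i j : i != j ->
  \sum_(t | top t) f t i * f t j <= 1.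
Proof.
move=> ij.
case: (pickP [pred t | [&& top t, face t i & face t j]]) => [t /= /and3P[tt ti tj]|no].
  rewrite (bigD1 t)//= big1 ?addr0 ?ti ?tj ?mulr1// => s /andP[ts st].
  case: (boolP (face s i)) => si; last by rewrite mul0r.
  case: (boolP (face s j)) => sj; last by rewrite mulr0.
  by move: st; rewrite (face_uniq ij ts tt si sj ti tj) eqxx.
rewrite big1// => t tt; have := no t; rewrite /= tt/=.
by case: (face t i); case: (face t j); rewrite //= ?mulr0 ?mul0r.
Qed.

Lemma sum_top_face i a : 0 <= a -> \sum_(t | top t) f t i * a <= n%:R * a.
Proof.
move=> a0; rewrite -mulr_suml -natr_sum ler_wpM2r// ler_nat.
rewrite (leq_trans _ (face_deg i))// -sum1_card big_mkcond [leqRHS]big_mkcond.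
by apply: leq_sum => t _; rewrite inE; case: (top t) => //=; case: (face t i).
Qed.

Lemma sum_face_pair i : \sum_j \sum_(t | top t) f t i * f t j <= n%:R * K.
Proof.
rewrite exchange_big/=; apply: le_trans (@sum_top_face i K _) => //.
apply: ler_sum => t tt; rewrite -mulr_sumr ler_wpM2l//.
have := @sum_face_le R N k (face t) (face_card tt) 1 ler01; rewrite mulr1.
by apply: le_trans; apply: ler_sum => j _; rewrite mulr1.
Qed.

(** Distinct i and j share at most one top cell and there are at most n K pairs to count, while the
    squares of the G_ij sum to at most 1 by the Ward identity. Cauchy-Schwarz then gives the square
    root of the trivial bound n K. *)
Lemma sum_off_diag_row c i :
  \sum_(t | top t) f t i * off_diag_row (face t) (G c) i <= Num.sqrt (n%:R * K).
Proof.
set s := Num.sqrt _.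
have s0 : 0 < s by rewrite sqrtr_gt0.
have s2 : s ^+ 2 = n%:R * K by rewrite sqr_sqrtr// ltW.
pose a j := \sum_(t | top t) f t i * f t j.
have a0 j : 0 <= a j by apply: sumr_ge0 => t _; rewrite mulr_ge0.
have -> : \sum_(t | top t) f t i * off_diag_row (face t) (G c) i =
    \sum_(j | j != i) a j * cabs (G c i j).
  rewrite /off_diag_row; under eq_bigr do rewrite mulr_sumr.
  rewrite exchange_big/=; apply: eq_bigr => j _; rewrite mulr_suml.
  by apply: eq_bigr => t _; rewrite mulrA.
(* AM-GM: a g <= (a^2 / s + s g^2) / 2 *)
apply: (@le_trans _ _ (2^-1 * (s^-1 * \sum_j a j + s * \sum_j cabs (G c i j) ^+ 2))).
  rewrite !mulr_sumr -big_split/= mulr_sumr [leRHS](bigID (fun j => j != i))/=.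
  rewrite -[leLHS]addr0 lerD//; last first.
    apply: sumr_ge0 => j _; apply: mulr_ge0; first by rewrite invr_ge0.
    apply: addr_ge0; apply: mulr_ge0; rewrite ?invr_ge0 ?(ltW s0)//.
    exact: sqr_ge0.
  apply: ler_sum => j ji; set g := cabs _; rewrite ler_pdivlMl//.
  have a1 : a j <= 1 by apply: face_pair_le1; rewrite eq_sym.
  have aa : a j ^+ 2 <= a j by rewrite expr2 -[leRHS]mulr1 ler_wpM2l.
  rewrite -(ler_pM2l s0) mulrDr mulVKf ?gt_eqF//.
  have := sqr_ge0 (a j - s * g); nra.
have : s^-1 * \sum_j a j <= s.
  by rewrite ler_pdivrMl// -expr2 s2 sum_face_pair.
have : s * \sum_j cabs (G c i j) ^+ 2 <= s.
  by rewrite -[leRHS]mulr1 ler_pM2l// green_row_le1.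
lra.
Qed.

Lemma weight_ge0 c i j : 0 <= weight c i j.
Proof. by apply: sumr_ge0 => t _; exact: sqr_ge0. Qed.

Lemma sum_weight c i : \sum_j weight c i j <= n%:R * K.
Proof.
apply: le_trans (sum_face_pair i); apply: ler_sum => j _.
rewrite /weight big_mkcondr/=; apply: ler_sum => t tt.
case: (pot c t); last by rewrite mulr_ge0.
by rewrite Bsq// -natrM ler_nat; case: (i != j); case: (face t i); case: (face t j).
Qed.

Lemma sum_weight_le c i a : (forall j, cabs (a j) <= 1) ->
  cabs ((q * b ^+ 2)%:C * \sum_j (weight c i j)%:C * a j) <= K0.
Proof.
move=> a1; rewrite cabsM cabs_real ger0_norm ?mulr_ge0 ?exprn_ge0 ?scal_ge0//.
apply: le_trans qb; rewrite ler_wpM2l ?mulr_ge0 ?exprn_ge0 ?scal_ge0//.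
apply: le_trans (cabs_sum _ _ _) _; apply: le_trans (sum_weight c i).
apply: ler_sum => j _; rewrite cabsM cabs_real ger0_norm ?weight_ge0//.
by rewrite -[leRHS]mulr1 ler_wpM2l ?weight_ge0.
Qed.

Lemma defect_le c i : cabs (F c i) <= 1 + Z + K0.
Proof.
rewrite -addrA (le_trans (cabsD _ _))// cabs1 lerD2l// cabsM -[leRHS]mul1r.
rewrite ler_pM ?cabs_ge0 ?green_le1// (le_trans (cabsD _ _))// lerD2l.
by apply: sum_weight_le => j; exact: green_le1.
Qed.

Section OneBlock.
Variables (c : cfg) (t : I).
Hypothesis tt : top t.
Hypothesis ct : pot c t.
Let c1 := upd c t true.
Let Bt := block b (B t).
(** Switching t on adds its block only if it was absent; carrying this indicator through the
    expansions replaces a case distinction on [c t]. *)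
Let del : R[i] := (~~ c t)%:R.

Lemma block_sum_upd :
  map_mx (real_complex R) (b *: block_sum c1 - b *: block_sum c) = del *: Bt.
Proof.
have -> : b *: block_sum c1 - b *: block_sum c = (~~ c t)%:R *: (b *: B t).
  rewrite -scalerBr scalerA mulrC -scalerA; congr (_ *: _).
  rewrite /block_sum (bigD1 t)/=; last by rewrite tt pot_upd// ct/= updE eqxx.
  have -> : \sum_(s | [&& top s, pot c1 s & c1 s] && (s != t)) B s =
            \sum_(s | [&& top s, pot c s & c s] && (s != t)) B s.
    apply: eq_bigl => s; rewrite pot_upd// updE.
    by case: eqP; rewrite ?andbF.
  case: (boolP (c t)) => tc.
    rewrite [X in _ - X](bigD1 t)/=; last by rewrite tt ct tc.
    by rewrite subrr scale0r.
  rewrite [X in _ - X](bigID (pred1 t))/= [X in _ - (X + _)]big1 ?add0r.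
    by rewrite addrK scale1r.
  by move=> s /andP[/and3P[_ _ sc] /eqP st]; rewrite -st sc in tc.
rewrite map_mxZ; congr (_ *: _); rewrite /del; case: (c t) => //=.
Qed.

Lemma green_updl : G c1 - G c = - (del *: (G c1 *m Bt *m G c)).
Proof.
rewrite /green resolvent_sub ?block_sum_sym// block_sum_upd.
by rewrite -scalemxAr -scalemxAl.
Qed.

Lemma green_updr : G c1 - G c = - (del *: (G c *m Bt *m G c1)).
Proof.
rewrite -opprB /green resolvent_sub ?block_sum_sym//.
rewrite -(opprB (b *: block_sum c1)) map_mxN block_sum_upd mulmxN mulNmx.
by rewrite opprK -scalemxAr -scalemxAl.
Qed.

Let del_le1 : cabs del <= 1.
Proof. by rewrite /del; case: (c t); rewrite /= ?cabs0 ?cabs1. Qed.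

Lemma green_upd_le i j : cabs (G c1 i j - G c i j) <= b * K ^+ 2.
Proof.
have -> : G c1 i j - G c i j = - (del * (G c1 *m Bt *m G c) i j).
  by have /matrixP/(_ i j) := green_updl; rewrite !mxE.
rewrite cabsN cabsM -[leRHS]mul1r ler_pM ?cabs_ge0//.
exact: (cabs_GBG scal_ge0 (face_card tt) (Bsq tt) _ _ (@green_le1 c1) (@green_le1 c)).
Qed.

Lemma defect_upd_le i : cabs (F c1 i - F c i) <= b * (K ^+ 2 * (Z + 2 * K0)).
Proof.
have wE j : weight c1 i j = weight c i j.
  by apply: eq_bigl => s; rewrite pot_upd.
pose x := (q * b ^+ 2)%:C * \sum_j (weight c i j)%:C * G c1 j j.
pose y := (q * b ^+ 2)%:C * \sum_j (weight c i j)%:C * G c j j.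
have F1E : F c1 i = 1 + G c1 i i * (z + x).
  by rewrite /F /x; under eq_bigr do rewrite wE.
have xy : cabs (x - y) <= b * K ^+ 2 * K0.
  have bK0 : 0 < b * K ^+ 2.
    by rewrite mulr_gt0 ?invr_gt0 ?sqrtr_gt0// exprn_gt0// (lt_le_trans ltr01).
  (* The differences are divided by their bound [b * K ^+ 2], since [sum_weight_le] asks for entries
     of modulus at most 1. *)
  have -> : x - y = (b * K ^+ 2)%:C * ((q * b ^+ 2)%:C *
      \sum_j (weight c i j)%:C * ((b * K ^+ 2)^-1%:C * (G c1 j j - G c j j))).
    rewrite /x /y -mulrBr -sumrB [RHS]mulrCA; congr (_ * _).
    rewrite mulr_sumr; apply: eq_bigr => j _.
    rewrite -mulrBr mulrCA; congr (_ * _); rewrite mulrA -rmorphM divff ?mul1r//.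
    by rewrite gt_eqF.
  rewrite cabsM cabs_real ger0_norm ?(ltW bK0)// ler_pM2l//.
  apply: sum_weight_le => j; rewrite cabsM cabs_real ger0_norm ?invr_ge0 ?(ltW bK0)//.
  by rewrite mulrC ler_pdivrMr// mul1r green_upd_le.
have -> : F c1 i - F c i = (G c1 i i - G c i i) * (z + x) + G c i i * (x - y).
  by rewrite F1E /F -/y; ring.
rewrite (le_trans (cabsD _ _))//.
have -> : b * (K ^+ 2 * (Z + 2 * K0)) = b * K ^+ 2 * (Z + K0) + 1 * (b * K ^+ 2 * K0).
  by ring.
rewrite lerD// cabsM ler_pM ?cabs_ge0 ?green_upd_le ?green_le1//.
rewrite (le_trans (cabsD _ _))// lerD2l; apply: sum_weight_le => j.
exact: green_le1.
Qed.

Let X i := (G c *m Bt *m G c *m Bt) i i.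
Let Y i := (G c *m Bt *m G c1 *m Bt *m G c *m Bt) i i.

(** The resolvent identity, used once from each side and with del^2 = del, stopped at third order.
    The remainder keeps the new resolvent in the middle, where the bound by 1 suffices: it has size
    b^3, and q b^3 n is of order b after summation over the blocks through i. *)
Lemma green_upd_block i :
  (G c1 *m Bt) i i = (G c *m Bt) i i - del * X i + del * Y i.
Proof.
have dd : del * del = del by rewrite /del; case: (c t); rewrite ?mulr0 ?mulr1.
have -> : G c1 *m Bt = G c *m Bt - del *: (G c *m Bt *m G c *m Bt) +
   del *: (G c *m Bt *m G c1 *m Bt *m G c *m Bt).
  have -> : G c1 *m Bt = G c *m Bt + (G c1 - G c) *m Bt.
    by rewrite -mulmxDl addrC subrK.
  rewrite green_updr mulNmx -scalemxAl -addrA; congr (_ + _).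
  have {1}-> : G c1 = G c + (G c1 - G c) by rewrite addrC subrK.
  rewrite green_updl mulmxDr mulmxDl scalerDr opprD; congr (_ + _).
  rewrite mulmxN mulNmx scalerN opprK -scalemxAr -scalemxAl scalerA dd.
  by rewrite !mulmxA.
rewrite /X /Y; move: (_ *m Bt *m G c1 *m Bt *m G c *m Bt) => V.
move: (G c *m Bt *m G c *m Bt) => U; move: (G c *m Bt) => W.
by rewrite !mxE.
Qed.

(** The second-order term of the expansion cancels against the self-consistent term up to
    off-diagonal entries. If t was already switched on, nothing is there to cancel; this costs b^2
    without an off-diagonal gain, but carries the factor [c t], which becomes another q in
    expectation. *)
Lemma one_block_bound i :
  cabs ((G c1 *m Bt) i i * (F c1 i)^* +
    (b ^+ 2)%:C * (\sum_j (B t i j ^+ 2)%:C * (G c i i * G c j j)) * (F c i)^*) <=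
  f t i * (
    (b * (1 + Z + K0) + b ^+ 2 * (K ^+ 2 * (Z + 2 * K0)) +
     b ^+ 2 * K ^+ 2 * (1 + Z + K0)) * off_diag_row (face t) (G c) i +
    b ^+ 2 * (1 + Z + K0) * (\sum_l f t l * off_diag_row (face t) (G c) l) +
    b ^+ 3 * (K ^+ 5 * (1 + Z + K0) + K ^+ 3 * (K ^+ 2 * (Z + 2 * K0)))) +
  (c t)%:R * (f t i * (b ^+ 2 * K ^+ 3 * (1 + Z + K0))).
Proof.
set CF := 1 + Z + K0; set L := K ^+ 2 * (Z + 2 * K0).
pose dl := (c t)%:R : R[i].
have delE : del = 1 - dl.
  by rewrite /del /dl; case: (c t); rewrite ?subrr ?subr0.
set Phi := (F c i)^*; set Phi1 := (F c1 i)^*.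
have PhiB : cabs Phi <= CF by rewrite cabsJ defect_le.
have Phi1B : cabs Phi1 <= CF by rewrite cabsJ defect_le.
have PhiD : cabs (Phi1 - Phi) <= b * L by rewrite -rmorphB cabsJ defect_upd_le.
set T := (b ^+ 2)%:C * _.
have -> : (G c1 *m Bt) i i * Phi1 + T * Phi =
    (G c *m Bt) i i * Phi + (G c *m Bt) i i * (Phi1 - Phi) + del * Y i * Phi1
    - (X i - T) * Phi - X i * (Phi1 - Phi) + dl * (X i * Phi1).
  by rewrite green_upd_block delE; ring.
have b0 := scal_ge0.
have g1 := @green_le1 c.
have g11 := @green_le1 c1.
set o := off_diag_row _ _ _; set s := \sum_l _.
have GB : cabs ((G c *m Bt) i i) <= b * f t i * o.
  exact: (cabs_mul_block_diag b0 (Bsq tt)).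
have XB : cabs (X i) <= b ^+ 2 * K ^+ 3 * f t i.
  exact: (cabs_GBGB b0 (face_card tt) (Bsq tt)).
have YB : cabs (Y i) <= b ^+ 3 * K ^+ 5 * f t i.
  exact: (cabs_GBGBGB b0 (face_card tt) (Bsq tt)).
have XT : cabs (X i - T) <= b ^+ 2 * f t i * (K ^+ 2 * o + s).
  exact: (cabs_GBGB_diag b0 (face_card tt) (Bsq tt) (Bsym t)).
have -> : f t i * ((b * CF + b ^+ 2 * L + b ^+ 2 * K ^+ 2 * CF) * o + b ^+ 2 * CF * s +
     b ^+ 3 * (K ^+ 5 * CF + K ^+ 3 * L)) + (c t)%:R * (f t i * (b ^+ 2 * K ^+ 3 * CF)) =
   b * f t i * o * CF + b * f t i * o * (b * L) + b ^+ 3 * K ^+ 5 * f t i * CF +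
   b ^+ 2 * f t i * (K ^+ 2 * o + s) * CF + b ^+ 2 * K ^+ 3 * f t i * (b * L) +
   (c t)%:R * (b ^+ 2 * K ^+ 3 * f t i * CF) by ring.
have mulB (x y : R[i]) (u v : R) : cabs x <= u -> cabs y <= v -> cabs (x * y) <= u * v.
  by move=> xu yv; rewrite cabsM ler_pM ?cabs_ge0.
have dl1 : cabs dl <= (c t)%:R.
  by rewrite /dl; case: (c t); rewrite ?cabs0 ?cabs1.
have delY : cabs (del * Y i) <= b ^+ 3 * K ^+ 5 * f t i.
  by rewrite -[leRHS]mul1r; apply: mulB.
apply: le_trans (cabsD _ _) _; apply: lerD; last exact: (@mulB _ _ _ _ dl1 (@mulB _ _ _ _ XB Phi1B)).
apply: le_trans (cabsB _ _) _; apply: lerD; last exact: (@mulB _ _ _ _ XB PhiD).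
apply: le_trans (cabsB _ _) _; apply: lerD; last exact: (@mulB _ _ _ _ XT PhiB).
apply: le_trans (cabsD _ _) _; apply: lerD; last exact: (@mulB _ _ _ _ delY Phi1B).
exact: le_trans (cabsD _ _) (lerD (@mulB _ _ _ _ GB PhiB) (@mulB _ _ _ _ GB PhiD)).
Qed.

End OneBlock.


Local Notation CF := (1 + Z + K0).
Local Notation L := (K ^+ 2 * (Z + 2 * K0)).
Local Notation pC := (real_complex R \o p).

(** What the block of t contributes to |F_i|^2 once [c t] has been integrated out and the common
    factor q removed: its part of (G M)_ii, and its share of the quadratic term. *)
Definition fresh (c : cfg) t i : R[i] :=
  (G (upd c t true) *m block b (B t)) i i * (F (upd c t true) i)^* +
  (b ^+ 2)%:C * (\sum_j (B t i j ^+ 2)%:C * (G c i i * G c j j)) * (F c i)^*.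

(** Here 1 + z G_ii is replaced by (G M)_ii and the weights are opened up, so that the random part
    and the mean part of the same t stand together and [Ex_upd] can act on each t separately. *)
Lemma defectE c i : F c i =
  \sum_(t | top t) ((c t)%:R * ((pot c t)%:R * (G c *m block b (B t)) i i) +
    q%:C * ((pot c t)%:R * ((b ^+ 2)%:C *
      \sum_j (B t i j ^+ 2)%:C * (G c i i * G c j j)))).
Proof.
rewrite big_split/=; have -> : F c i = (1 + z * G c i i) +
  (q * b ^+ 2)%:C * (\sum_j (weight c i j)%:C * (G c i i * G c j j)).
  rewrite /F mulrDr addrA [z * _]mulrC; congr (_ + _).
  rewrite mulrCA; congr (_ * _); rewrite mulr_sumr.
  by apply: eq_bigr => j _; rewrite mulrCA.
congr (_ + _).
  have -> : 1 + z * G c i i =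
      (G c *m map_mx (real_complex R) (b *: block_sum c)) i i.
    have := resolventVl (block_sum_sym c) Imz0; rewrite -/(green c) mulmxBr.
    move=> /(congr1 (fun A : 'M[R[i]]_N => A + G c *m z%:M)); rewrite addrNK => ->.
    by rewrite mul_mx_scalar !mxE eqxx.
  rewrite /block_sum scaler_sumr map_mx_sum mulmx_sumr summxE.
  rewrite [RHS](eq_bigr (fun t => if pot c t && c t then
    (G c *m block b (B t)) i i else 0)) -?big_mkcondr// => t _.
  by case: (pot c t); case: (c t); rewrite ?mul1r ?mul0r.
rewrite -mulr_sumr rmorphM -mulrA; congr (_ * _).
rewrite [RHS](eq_bigr (fun t => if pot c t then
   (b ^+ 2)%:C * \sum_j (B t i j ^+ 2)%:C * (G c i i * G c j j) else 0)).
  rewrite -big_mkcondr -mulr_sumr exchange_big/=; congr (_ * _).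
  apply: eq_bigr => j _; rewrite /weight rmorph_sum mulr_suml.
  by apply: eq_bigr.
by move=> t _; case: (pot c t); rewrite ?mul1r ?mul0r.
Qed.

(** Only one of the two factors is expanded into blocks; the conjugate factor is kept as a test
    function, which changes by order b when a block is switched on. *)
Lemma Ex_defect_sqr i :
  Ex pC (fun c => F c i * (F c i)^*) =
  q%:C * \sum_(t | top t) Ex pC (fun c => (pot c t)%:R * fresh c t i).
Proof.
rewrite mulr_sumr.
under eq_Ex => c do rewrite {1}defectE mulr_suml.
rewrite Ex_sum; apply: eq_bigr => t tt.
under eq_Ex => c do rewrite mulrDl -!mulrA.
rewrite ExD ExZ Ex_upd -[pC t]/((p t)%:C) ptop// -mulrDr -ExD; congr (_ * _).
apply: eq_Ex => c; rewrite pot_upd//.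
by rewrite -mulrDr /fresh -!mulrA.
Qed.

Lemma cabs_Ex_le (f : cfg -> R[i]) (g : cfg -> R) :
  (forall c, cabs (f c) <= g c) -> cabs (Ex pC f) <= Ex p g.
Proof.
move=> fg; apply: le_trans (cabs_sum _ _ _) _; apply: ler_sum => c _.
have -> : bern_wt pC c = (bern_wt p c)%:C.
  rewrite /bern_wt rmorph_prod; apply: eq_bigr => j _.
  by case: ifP => // _; rewrite rmorphB rmorph1.
rewrite cabsM cabs_real ger0_norm ?bern_wt_ge0//.
by rewrite ler_wpM2l ?bern_wt_ge0.
Qed.

(** [CF] bounds the defect and [b * L] its change under one switch. The sqrt(q) term is the
    uncentred first order, the [b] term collects the off-diagonal and third-order errors, and the
    last term comes from blocks that were already on. *)
Lemma Ex_defect_le :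
  \sum_i Ex p (fun c => cabs (F c i) ^+ 2) <=
  N%:R * (CF * Num.sqrt (K0 * q) +
    K0 * ((K ^+ 5 + K ^+ 2 + K) * CF + (K ^+ 3 + 1) * L) * b +
    K0 * K ^+ 3 * CF * q).
Proof.
have Z0 : 0 <= Z := cabs_ge0 z.
have b0 := scal_ge0.
have CF0 : 0 <= CF by nonneg.
have L0 : 0 <= L by nonneg.
pose a1 := b * CF + b ^+ 2 * L + b ^+ 2 * K ^+ 2 * CF.
pose a2 := b ^+ 2 * CF.
pose a3 := b ^+ 3 * (K ^+ 5 * CF + K ^+ 3 * L).
pose a4 := b ^+ 2 * K ^+ 3 * CF.
have a10 : 0 <= a1 by rewrite /a1; nonneg.
have a20 : 0 <= a2 by rewrite /a2; nonneg.
have a30 : 0 <= a3 by rewrite /a3; nonneg.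
have a40 : 0 <= a4 by rewrite /a4; nonneg.
pose o t c i := off_diag_row (face t) (G c) i.
have o0 t c i : 0 <= o t c i by exact: off_diag_row_ge0.
pose bd t i c := f t i * (a1 * o t c i + a2 * (\sum_l f t l * o t c l) + a3) +
  (c t)%:R * (f t i * a4).
have Ncst (a : R) : N%:R * a = \sum_(i < N) a by rewrite sumr_const card_ord mulr_natl.
pose S := Num.sqrt (n%:R * K).
have S0 : 0 < S by rewrite sqrtr_gt0.
have step i : Ex p (fun c => cabs (F c i) ^+ 2) <=
    q * \sum_(t | top t) Ex p (bd t i).
  have -> : Ex p (fun c => cabs (F c i) ^+ 2) =
      cabs (Ex pC (fun c => F c i * (F c i)^*)).
    transitivity (cabs (Ex p (fun c => cabs (F c i) ^+ 2))%:C).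
      rewrite cabs_real ger0_norm// Ex_ge0// => c; exact: sqr_ge0.
    congr cabs; rewrite Ex_rmorph; apply: eq_Ex => c /=; exact: cabs_sqrC.
  rewrite Ex_defect_sqr cabsM cabs_real ger0_norm// ler_wpM2l//.
  apply: le_trans (cabs_sum _ _ _) _; apply: ler_sum => t tt.
  apply: cabs_Ex_le => c; case: (boolP (pot c t)) => ct.
    rewrite mul1r; apply: le_trans (one_block_bound tt ct i) _.
    by rewrite /bd /a1 /a2 /a3 /a4 /o.
  have so0 : 0 <= \sum_l f t l * o t c l.
    by apply: sumr_ge0 => l _; rewrite mulr_ge0.
  by rewrite mul0r cabs0 /bd; nonneg.
have step2 : \sum_i \sum_(t | top t) Ex p (bd t i) <=
    N%:R * (a1 * S + a2 * (K * S) + n%:R * a3 + q * (n%:R * a4)).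
  have -> : \sum_i \sum_(t | top t) Ex p (bd t i) =
    Ex p (fun c => \sum_i \sum_(t | top t)
      f t i * (a1 * o t c i + a2 * (\sum_l f t l * o t c l) + a3)) +
    q * \sum_(i < N) \sum_(t | top t) f t i * a4.
    rewrite Ex_sum mulr_sumr -big_split/=; apply: eq_bigr => j _.
    rewrite Ex_sum mulr_sumr -big_split/=; apply: eq_bigr => t tt.
    by rewrite ExD Ex_upd Ex_cst ptop.
  rewrite mulrDr lerD//; last first.
    rewrite mulrCA ler_wpM2l// Ncst.
    by apply: ler_sum => i _; exact: sum_top_face.
  rewrite -[leRHS](Ex_cst p); apply: le_Ex => // c.
  have -> : \sum_i \sum_(t | top t)
      f t i * (a1 * o t c i + a2 * (\sum_l f t l * o t c l) + a3) =
    a1 * (\sum_i \sum_(t | top t) f t i * o t c i) +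
    a2 * (\sum_(t | top t) (\sum_i f t i * (\sum_l f t l * o t c l))) +
    \sum_i \sum_(t | top t) f t i * a3.
    rewrite [X in a2 * X]exchange_big/= !mulr_sumr -!big_split/=.
    apply: eq_bigr => i _; rewrite !mulr_sumr -!big_split/=.
    by apply: eq_bigr => t _; rewrite !mulrDr !(mulrCA (f t i)).
  have so : \sum_i \sum_(t | top t) f t i * o t c i <= N%:R * S.
    rewrite Ncst.
    by apply: ler_sum => i _; exact: sum_off_diag_row.
  rewrite !mulrDr; apply: lerD; first apply: lerD.
  - by rewrite mulrCA ler_wpM2l.
  - rewrite mulrCA ler_wpM2l// mulrCA.
    apply: (@le_trans _ _ (\sum_(t | top t) K * (\sum_l f t l * o t c l))).
      apply: ler_sum => t tt; apply: sum_face_le; first exact: face_card.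
      by apply: sumr_ge0 => l _; rewrite mulr_ge0.
    by rewrite -mulr_sumr ler_wpM2l// exchange_big.
  - rewrite Ncst.
    by apply: ler_sum => i _; exact: sum_top_face.
apply: (@le_trans _ _ (q * (N%:R * (a1 * S + a2 * (K * S) + n%:R * a3 + q * (n%:R * a4))))).
  apply: le_trans (ler_wpM2l q0 step2); rewrite mulr_sumr.
  by apply: ler_sum => i _; exact: step.
rewrite mulrCA ler_wpM2l//.
(* This is [m_le]. It allows one spare factor b S to be inserted in [h2], turning S into S^2 = n K,
   which [qb] controls. *)
have bS : 1 <= b * S.
  rewrite /scal /S -sqrtrV ?(ltW m0)// -sqrtrM ?invr_ge0 ?(ltW m0)//.
  by rewrite -[leLHS]sqrtr1 ler_wsqrtr// ler_pdivlMl ?mulr1.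
have S2 : S ^+ 2 = n%:R * K by rewrite sqr_sqrtr// ltW.
have h1 : q * (b * S) <= Num.sqrt (K0 * q).
  rewrite -[leLHS]ger0_norm ?mulr_ge0 ?(ltW S0)// -sqrtr_sqr ler_wsqrtr//.
  rewrite !exprMn S2.
  have := ler_wpM2l q0 qb; rewrite (mulrC q K0); apply: le_trans.
  by rewrite le_eqVlt; apply/orP; left; apply/eqP; ring.
have h2 : q * b ^+ 2 * S <= K0 * b.
  have : q * b ^+ 2 * S * 1 <= q * b ^+ 2 * S * (b * S).
    by rewrite ler_wpM2l// !mulr_ge0 ?exprn_ge0 ?(ltW S0).
  have : q * b ^+ 2 * (n%:R * K) * b <= K0 * b by rewrite ler_wpM2r.
  rewrite -S2; nra.
have h3 : q * b ^+ 2 * n%:R <= K0.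
  apply: le_trans qb; rewrite ler_wpM2l ?mulr_ge0 ?exprn_ge0//.
  by rewrite -[leLHS]mulr1 ler_wpM2l.
have -> : q * (a1 * S + a2 * (K * S) + n%:R * a3 + q * (n%:R * a4)) =
   CF * (q * (b * S)) + (L + K ^+ 2 * CF + K * CF) * (q * b ^+ 2 * S) +
   (K ^+ 5 * CF + K ^+ 3 * L) * b * (q * b ^+ 2 * n%:R) +
   K ^+ 3 * CF * q * (q * b ^+ 2 * n%:R).
  by rewrite /a1 /a2 /a3 /a4; ring.
have -> : K0 * ((K ^+ 5 + K ^+ 2 + K) * CF + (K ^+ 3 + 1) * L) * b =
  (L + K ^+ 2 * CF + K * CF) * (K0 * b) + (K ^+ 5 * CF + K ^+ 3 * L) * b * K0 by ring.
have -> : K0 * K ^+ 3 * CF * q = K ^+ 3 * CF * q * K0 by ring.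
rewrite addrA !lerD// ler_wpM2l//.
- by nonneg.
- by nonneg.
- by nonneg.
Qed.


Lemma weight_sym c i j : weight c i j = weight c j i.
Proof. by apply: eq_bigr => t _; rewrite -{1}(Bsym t) mxE. Qed.

Definition scaled_degree c i : R := q * b ^+ 2 * \sum_j weight c i j.

(* Subtracting 1 + s z + s^2 = 0 from the definition of the defect gives
   (G_ii - s) (z + x) = F_i + s^2 (1 - kappa_i) - s (x - s kappa_i), where x is
   the weighted average of the G_jj; for large |z| this is a contraction. *)
Lemma green_stability c (V : pred 'I_N) (s : R[i]) :
  (forall i j, V i -> weight c i j != 0 -> V j) ->
  1 + s * z + s ^+ 2 = 0 -> cabs s <= 1 -> 2 * K0 + 1 <= Z ->
  \sum_(i | V i) cabs (G c i i - s) <=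
  \sum_i cabs (F c i) + \sum_(i | V i) `|scaled_degree c i - 1|.
Proof.
move=> Vw sE s1 ZK.
pose e i := cabs (G c i i - s).
have pt i : V i -> e i * (Z - K0) <= cabs (F c i) + `|scaled_degree c i - 1| +
    q * b ^+ 2 * \sum_(j | V j) weight c i j * e j.
  move=> Vi.
  set x := (q * b ^+ 2)%:C * \sum_j (weight c i j)%:C * G c j j.
  have xK : cabs x <= K0 by apply: sum_weight_le => j; exact: green_le1.
  have zx : Z - K0 <= cabs (z + x).
    have : cabs z <= cabs (z + x) + cabs x.
      by rewrite -{1}[z](addrK x); exact: cabsB.
    rewrite -/Z; lra.
  apply: (@le_trans _ _ (cabs ((G c i i - s) * (z + x)))).
    by rewrite cabsM ler_wpM2l ?cabs_ge0.
  pose y := (q * b ^+ 2)%:C * \sum_j (weight c i j)%:C * (G c j j - s).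
  have xy : x = s * (scaled_degree c i)%:C + y.
    rewrite /x /y /scaled_degree (rmorphM (real_complex R) (q * b ^+ 2))/= [s * _]mulrCA.
    rewrite -mulrDr rmorph_sum/=; congr (_ * _).
    rewrite mulr_sumr -big_split/=; apply: eq_bigr => j _; ring.
  have -> : (G c i i - s) * (z + x) =
      F c i - s ^+ 2 * (scaled_degree c i - 1)%:C - s * y.
    have -> : F c i = 1 + G c i i * (z + x) by [].
    have -> : 1 = - (s * z + s ^+ 2) :> R[i].
      by apply/eqP; rewrite -addr_eq0 addrA sE.
    by rewrite xy rmorphB rmorph1; ring.
  apply: le_trans (cabsB _ _) _; apply: lerD.
    apply: le_trans (cabsB _ _) _; apply: lerD => //.
    rewrite cabsM cabs_real -[leRHS]mul1r ler_wpM2r// expr2 cabsM.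
    by rewrite -[leRHS]mul1r ler_pM ?cabs_ge0.
  rewrite cabsM -[leRHS]mul1r ler_pM ?cabs_ge0//.
  rewrite cabsM cabs_real ger0_norm; last by rewrite mulr_ge0// exprn_ge0// scal_ge0.
  rewrite ler_wpM2l//; first by rewrite mulr_ge0// exprn_ge0// scal_ge0.
  apply: le_trans (cabs_sum _ _ _) _; rewrite [leLHS](bigID V)/=.
  rewrite [X in _ + X]big1 ?addr0.
    by apply: ler_sum => j _; rewrite cabsM cabs_real ger0_norm ?weight_ge0.
  move=> j Vj; have -> : weight c i j = 0.
    by apply/eqP; apply: contraNT Vj; exact: Vw.
  by rewrite mul0r cabs0.
have e0 i : 0 <= e i by exact: cabs_ge0.
(* The contraction is carried out in the sum over i, since defects and degrees are controlled only
   on average. Exchanging the sums and using [weight_sym], the coupling costs K0 times the total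
   error, and Z - 2 K0 >= 1 absorbs it. *)
have sum_pt : (\sum_(i | V i) e i) * (Z - K0) <=
    \sum_(i | V i) (cabs (F c i) + `|scaled_degree c i - 1|) +
    K0 * \sum_(i | V i) e i.
  rewrite mulr_suml; apply: le_trans (ler_sum _ pt) _.
  rewrite big_split/= lerD2l -mulr_sumr exchange_big/= !mulr_sumr.
  apply: ler_sum => j _; rewrite -mulr_suml mulrA ler_wpM2r//.
  apply: le_trans qb; rewrite ler_wpM2l ?mulr_ge0 ?exprn_ge0 ?scal_ge0//.
  apply: le_trans (sum_weight c j); rewrite [leRHS](bigID V)/= -[leLHS]addr0 lerD//.
    by apply: ler_sum => i _; rewrite weight_sym.
  by apply: sumr_ge0 => i _; exact: weight_ge0.
have E0 : 0 <= \sum_(i | V i) e i by exact: sumr_ge0.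
rewrite big_split/= in sum_pt.
have FV : \sum_(i | V i) cabs (F c i) <= \sum_i cabs (F c i).
  rewrite [leRHS](bigID V)/= lerDl; apply: sumr_ge0 => i _; exact: cabs_ge0.
move: sum_pt FV E0.
set S := \sum_(i | V i) e i; set A := \sum_(i | V i) cabs (F c i).
set A' := \sum_i cabs (F c i); set D := \sum_(i | V i) `|_|.
rewrite -/S.
nra.
Qed.

End RandomBlockMatrix.

(** * Facets of the lower model *)

Section Model.
Variables (R : realType) (n d : nat).
Notation cell_index := 'I_#|[set s : {set 'I_n} | #|s| == d]|.
Notation cfg := {ffun {set 'I_n} -> bool}.
Implicit Types (c : cfg) (i j : cell_index) (s t : {set 'I_n}).

(** The index runs over all d-subsets, present or not, so that the size of the matrices does not
    depend on the configuration. *)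
Definition facet i : {set 'I_n} := enum_val i.

Lemma card_facet i : #|facet i| = d.
Proof. by have := enum_valP i; rewrite inE => /eqP. Qed.

Lemma facet_inj : injective facet.
Proof. exact: enum_val_inj. Qed.

Lemma facetP s : #|s| = d -> exists i, facet i = s.
Proof.
move=> sd; have sV : s \in [set s : {set 'I_n} | #|s| == d] by rewrite inE sd.
by exists (enum_rank_in sV s); rewrite /facet enum_rankK_in.
Qed.

Definition top t : bool := #|t| == d.+1.

Definition is_face t i : bool := facet i \subset t.

(** The bound [#|u| <= d] leaves out every top coordinate, including that of t itself; this is
    [skel_upd], the independence behind the integration by parts. *)
Definition skel c t : bool :=
  [forall u : {set 'I_n}, (u \subset t) && (2 <= #|u| <= d)%N ==> c u].

Lemma skel_upd c t b u : top t -> skel (upd c t b) u = skel c u.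
Proof.
move=> /eqP td; apply: eq_forallb => v; rewrite updE.
by have [->|//] := eqVneq v t; rewrite td ltnn !andbF.
Qed.

Lemma card_is_face t : top t -> #|is_face t| = d.+1.
Proof.
move=> /eqP td; rewrite -[RHS](binSn d) -td -cards_draws.
rewrite -(card_image facet_inj); apply: eq_card => s.
rewrite !inE; apply/imageP/andP => [[i it ->]|[st /eqP sd]].
  by rewrite card_facet eqxx.
by have [i si] := facetP sd; exists i => //; rewrite unfold_in /is_face si.
Qed.

Lemma is_face_degree i : (#|[pred t | top t && is_face t i]| <= n)%N.
Proof.
rewrite -[leqRHS]card_ord -cardsT.
apply: leq_trans (leq_imset_card (fun v => v |: facet i) _).
apply/subset_leq_card/subsetP => t; rewrite inE => /andP[/eqP td it].
have : #|t :\: facet i| = 1%N.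
  by rewrite cardsD (setIidPr it) td card_facet subSnn.
move/eqP/cards1P => [v tv]; apply/imsetP; exists v => //.
by rewrite -[LHS](setID t (facet i)) (setIidPr it) tv setUC.
Qed.

Lemma is_face_union i j t : i != j -> top t -> is_face t i -> is_face t j ->
  t = facet i :|: facet j.
Proof.
rewrite /is_face => ij /eqP td it jt; apply/esym/eqP; rewrite eqEcard subUset it jt td/=.
rewrite ltnNge; apply: contra ij => le_d; apply/eqP/facet_inj/eqP.
have /eqP ui : facet i == facet i :|: facet j.
  by rewrite eqEcard subsetUl card_facet le_d.
by rewrite eq_sym eqEcard !card_facet leqnn ui subsetUr.
Qed.

Lemma is_face_uniq i j t t' : i != j -> top t -> top t' ->
  is_face t i -> is_face t j -> is_face t' i -> is_face t' j -> t = t'.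
Proof.
move=> ij tt tt' ti tj ti' tj'.
by rewrite (is_face_union ij tt ti tj) -(is_face_union ij tt' ti' tj').
Qed.

Lemma face_topE c t : (0 < d)%N -> top t ->
  (t \in lower_faces d c) = skel c t && c t.
Proof.
move=> d0 /eqP td; rewrite inE td leqnn/=; apply/forallP/andP => [H|[sk ct] u].
  split; last by have := H t; rewrite subxx td ltnS d0.
  apply/forallP => u; apply/implyP => /and3P[ut u2 _].
  by have := H u; rewrite ut u2.
apply/implyP => /andP[ut u2].
have [->//|ne] := eqVneq u t.
have : u \proper t by rewrite properEneq ne ut.
move=> /proper_card; rewrite td ltnS => ud.
by have /forallP/(_ u)/implyP := sk; apply; rewrite ut u2 ud.
Qed.

Variable sg : cell_index -> cell_index -> R.
Hypothesis sg_sym : forall i j, sg i j = sg j i.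
Hypothesis sg_sqr : forall i j, sg i j ^+ 2 = 1.

Definition top_block t : 'M[R]_#|[set s : {set 'I_n} | #|s| == d]| :=
  \matrix_(i, j) (sg i j * ([&& i != j, is_face t i & is_face t j])%:R).

Lemma top_block_sqr t i j :
  top_block t i j ^+ 2 = ([&& i != j, is_face t i & is_face t j])%:R.
Proof.
rewrite mxE exprMn sg_sqr mul1r.
by case: [&& _, _ & _]; rewrite ?expr1n ?expr0n.
Qed.

Lemma top_block_sym t : (top_block t)^T = top_block t.
Proof.
apply/matrixP => i j; rewrite !mxE sg_sym eq_sym.
by congr (_ * (nat_of_bool _)%:R); congr (_ && _); rewrite andbC.
Qed.

Lemma block_sumE c i j : (0 < d)%N -> block_sum top skel top_block c i j =
  sg i j * ((i != j) && (facet i :|: facet j \in cells (lower_model d c) d))%:R.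
Proof.
move=> d0; rewrite /block_sum summxE; set u := facet i :|: facet j.
have iu : is_face u i by exact: subsetUl.
have ju : is_face u j by exact: subsetUr.
have ucells : u \in cells (lower_model d c) d = [&& top u, skel c u & c u].
  rewrite inE andbC; case: (boolP (#|u| == d.+1)) => [tu|/negPf ntu].
    by rewrite /= face_topE// /top tu.
  by rewrite /top ntu.
rewrite ucells; case: eqVneq => [->|ij]/=.
  by rewrite mulr0 big1// => t _; rewrite mxE eqxx mulr0.
case: (boolP [&& top u, skel c u & c u]) => [uc|nuc].
  rewrite (bigD1 u)//= mxE ij iu ju big1 ?addr0// => t /andP[/and3P[tt _ _] tu].
  rewrite mxE; case: (boolP [&& _, _ & _]) => [/and3P[_ it jt]|]; last by rewrite mulr0.
  by move: tu; rewrite (is_face_union ij tt it jt) eqxx.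
rewrite mulr0 big1// => t /and3P[tt sk ct].
rewrite mxE; case: (boolP [&& _, _ & _]) => [/and3P[_ it jt]|]; last by rewrite mulr0.
by move: nuc; rewrite /u -(is_face_union ij tt it jt) tt sk ct.
Qed.

Definition present c i : bool :=
  [forall u : {set 'I_n}, (u \subset facet i) && (2 <= #|u|)%N ==> c u].

Lemma presentE c i : present c i = (facet i \in lower_model d c).
Proof. by rewrite inE card_facet leqnSn. Qed.

Lemma skel_present c t i : skel c t -> is_face t i -> present c i.
Proof.
move=> /forallP sk it; apply/forallP => u; apply/implyP => /andP[ui u2].
have /implyP := sk u; apply; rewrite (fintype.subset_trans ui it) u2/=.
by rewrite -(card_facet i) subset_leq_card.
Qed.

Definition up_degree c i : nat :=
  #|[pred t | [&& top t, skel c t & is_face t i]]|.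

Lemma sum_weightE c i :
  \sum_j weight top skel top_block c i j = d%:R * (up_degree c i)%:R.
Proof.
rewrite /weight exchange_big/=.
transitivity (\sum_(t | top t && skel c t) (d%:R * (is_face t i)%:R : R)).
  apply: eq_bigr => t /andP[tt _]; under eq_bigr do rewrite top_block_sqr.
  rewrite -natr_sum; case: (boolP (is_face t i)) => it; last first.
    by rewrite mulr0 big1// => j _; rewrite andbF.
  rewrite mulr1; congr _%:R.
  (* Counting i itself as well turns the d neighbours inside t into all d + 1 faces of t. *)
  apply: succn_inj; rewrite -[RHS](card_is_face tt) -[RHS]sum1_card.
  rewrite [RHS](bigD1 i)//= add1n; congr _.+1; rewrite [RHS]big_mkcond.
  apply: eq_bigr => j _; rewrite unfold_in eq_sym andbC.
  by rewrite -/(is_face t j); case: (is_face t j); case: (j == i).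
rewrite -mulr_sumr; congr (_ * _); rewrite -natr_sum; congr _%:R.
rewrite /up_degree -sum1_card [LHS]big_mkcond [RHS]big_mkcond.
apply: eq_bigr => t _; rewrite inE.
by case: (top t); case: (skel c t); case: (is_face t i).
Qed.

Lemma weight_present c i j :
  weight top skel top_block c i j != 0 -> present c j.
Proof.
apply: contraNT => nj; rewrite /weight big1// => t /andP[tt sk].
rewrite top_block_sqr; case: (boolP (is_face t j)) => jt; last by rewrite !andbF.
by rewrite (skel_present sk jt) in nj.
Qed.

End Model.

(** * Orientations and signs *)

Section Orientations.
Variable n : nat.
Notation ordering m := {ffun 'I_m -> 'I_n}.

Lemma permute_permute m (x : ordering m) (s t : 'S_m) :
  permute (permute x s) t = permute x (t * s)%g.
Proof. by apply/ffunP => i; rewrite !ffunE permM. Qed.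

Lemma permute1 m (x : ordering m) : permute x 1%g = x.
Proof. by apply/ffunP => i; rewrite !ffunE perm1. Qed.

Lemma vertices_permute m (x : ordering m) (s : 'S_m) :
  vertices (permute x s) = vertices x.
Proof.
apply/setP => v; apply/imsetP/imsetP => -[i _ ->].
  by exists (s i); rewrite // ffunE.
by exists ((s^-1)%g i) => //; rewrite ffunE permKV.
Qed.

Lemma permute_inj m (x : ordering m) (s : 'S_m) :
  injective x -> injective (permute x s).
Proof. by move=> xi i j; rewrite !ffunE => /xi/perm_inj. Qed.

Lemma mem_orient m (x : ordering m) (s : 'S_m) :
  ~~ odd_perm s -> permute x s \in orient x.
Proof. by move=> so; apply/imsetP; exists s; rewrite ?inE. Qed.

Lemma orient_refl m (x : ordering m) : x \in orient x.
Proof. by rewrite -{1}(permute1 x) mem_orient// odd_perm1. Qed.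

Lemma orient_permute_even m (x : ordering m) (s : 'S_m) : ~~ odd_perm s ->
  orient (permute x s) = orient x.
Proof.
move=> so; apply/setP => y; apply/imsetP/imsetP => -[t].
  rewrite inE => te ->; exists (t * s)%g; last by rewrite permute_permute.
  by rewrite inE odd_permM (negPf so) (negPf te).
rewrite inE => te ->; exists (t * s^-1)%g.
  by rewrite inE odd_permM odd_permV (negPf so) (negPf te).
by rewrite permute_permute -mulgA mulVg mulg1.
Qed.

Lemma orient_permute_odd m (x : ordering m) (s : 'S_m) : odd_perm s ->
  orient (permute x s) = opposite (orient x).
Proof.
move=> so; apply/setP => y; apply/imsetP/imset2P => [[t]|[z t]].
  rewrite inE => te ->; exists x (t * s)%g; first exact: orient_refl.
    by rewrite inE odd_permM so (negPf te).
  by rewrite permute_permute.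
case/imsetP => u; rewrite !inE => ue -> tO ->.
exists (t * u * s^-1)%g; first by rewrite inE !odd_permM odd_permV so tO (negPf ue).
by rewrite !permute_permute -!mulgA mulVg mulg1.
Qed.

Section AtLeastTwo.
Variable m : nat.
Hypothesis m2 : (2 <= m)%N.

Lemma exists_odd_perm : exists s : 'S_m, odd_perm s.
Proof.
have m0 : (0 < m)%N by exact: ltnW.
by exists (tperm (Ordinal m0) (Ordinal m2)); rewrite odd_tperm.
Qed.

Lemma opposite_orient (x : ordering m) :
  exists2 s : 'S_m, odd_perm s & opposite (orient x) = orient (permute x s).
Proof. by have [s so] := exists_odd_perm; exists s; rewrite ?orient_permute_odd. Qed.

Lemma oppositeK (x : ordering m) : opposite (opposite (orient x)) = orient x.
Proof.
have [s so ->] := opposite_orient x.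
rewrite -(orient_permute_odd _ so) permute_permute orient_permute_even//.
by rewrite odd_permM so.
Qed.

(** Swapping two vertices other than the deleted one reverses both the cell and the facet, and
    leaves the position i, hence the sign (-1)^i, untouched. Two remaining vertices exist because m
    >= 2. *)
Lemma opposite_boundary (x : ordering m.+1) (D : {set ordering m}) :
  D \in oriented_boundary (orient x) ->
  opposite D \in oriented_boundary (opposite (orient x)).
Proof.
move=> /imset2P[y i yx _ ->].
have m0 : (0 < m)%N by exact: ltnW.
pose a := Ordinal m0; pose b := Ordinal m2.
pose y' := permute y (tperm (lift i a) (lift i b)).
have ab : a != b by [].
have y'x : y' \in opposite (orient x).
  apply/imset2P; exists y (tperm (lift i a) (lift i b)) => //.
  by rewrite inE odd_tperm (inj_eq lift_inj).
have dy' : orient (del_vertex y' i) = opposite (orient (del_vertex y i)).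
  have -> : del_vertex y' i = permute (del_vertex y i) (tperm a b).
    apply/ffunP => k; rewrite !ffunE; congr (y _).
    have [->|ka] := eqVneq k a; first by rewrite !tpermL.
    have [->|kb] := eqVneq k b; first by rewrite !tpermR.
    rewrite eq_sym in ka; rewrite eq_sym in kb.
    by rewrite !tpermD ?(inj_eq lift_inj).
  by rewrite orient_permute_odd// odd_tperm.
apply/imset2P; exists y' i => //=; rewrite dy'.
by case: (odd i).
Qed.

Lemma boundary_vertices (x : ordering m.+1) (D : {set ordering m}) z :
  D \in oriented_boundary (orient x) -> z \in D -> vertices z \subset vertices x.
Proof.
move=> /imset2P[y i /imsetP[s _ ->] _ ->].
have del : vertices (del_vertex (permute x s) i) \subset vertices x.
  rewrite -(vertices_permute x s); apply/subsetP => v /imsetP[k _ ->].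
  by apply/imsetP; exists (lift i k); rewrite // !ffunE.
have [t _ E] := opposite_orient (del_vertex (permute x s) i).
by case: (odd i); rewrite /= ?E => /imsetP[u _ ->]; rewrite !vertices_permute.
Qed.

End AtLeastTwo.

Lemma same_vertices_permute m (x y : ordering m) : injective x -> injective y ->
  vertices x = vertices y -> exists s : 'S_m, y = permute x s.
Proof.
move=> xi yi xy.
have ex k : exists l, x l == y k.
  have : y k \in vertices x by rewrite xy; apply/imsetP; exists k.
  by move=> /imsetP[l _ ->]; exists l.
pose f k := xchoose (ex k).
have fE k : x (f k) = y k by apply/eqP; exact: (xchooseP (ex k)).
have fi : injective f by move=> k l kl; apply: yi; rewrite -!fE kl.
by exists (perm fi); apply/ffunP => k; rewrite ffunE permE fE.
Qed.

Lemma card_vertices m (x : ordering m) : injective x -> #|vertices x| = m.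
Proof. by move=> xi; rewrite card_imset// card_ord. Qed.

Definition incr_ordering m (s : {set 'I_n}) (sm : #|s| = m) : ordering m :=
  [ffun k => enum_val (cast_ord (esym sm) k)].

Lemma vertices_incr_ordering m (s : {set 'I_n}) (sm : #|s| = m) :
  vertices (incr_ordering sm) = s.
Proof.
apply/setP => v; apply/imsetP/idP => [[k _ ->]|vs].
  by rewrite ffunE enum_valP.
exists (cast_ord sm (enum_rank_in vs v)) => //.
by rewrite ffunE cast_ordK enum_rankK_in.
Qed.

Lemma increasing_incr_ordering m (s : {set 'I_n}) (sm : #|s| = m) :
  increasing (incr_ordering sm).
Proof.
apply/forallP => i; apply/forallP => j; apply/implyP => ij; rewrite !ffunE.
set i' := cast_ord _ i; set j' := cast_ord _ j.
rewrite (enum_val_nth (enum_val i') i') (enum_val_nth (enum_val i') j').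
pose lt := fun a b : 'I_n => (a < b)%N.
have lt_trans : transitive lt by move=> b a c; exact: ltn_trans.
have srt : sorted lt (enum s).
  rewrite /enum_mem; apply: sorted_filter => //; rewrite -enumT.
  have : sorted ltn [seq val i | i <- enum 'I_n] by rewrite val_enum_ord iota_ltn_sorted.
  by rewrite sorted_map.
by apply: (sorted_ltn_nth lt_trans) => //; rewrite inE -cardE.
Qed.

Lemma increasing_inj m (x : ordering m) : increasing x -> injective x.
Proof.
move=> /forallP xi i j ij; apply/val_inj.
have lt (a b : 'I_m) : (a < b)%N -> (x a < x b)%N.
  by move=> ab; have /forallP/(_ b)/implyP := xi a; apply.
case: (ltngtP i j) => // /lt; by rewrite ij ltnn.
Qed.

Lemma increasing_unique m (x y : ordering m) : increasing x -> increasing y ->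
  vertices x = vertices y -> x = y.
Proof.
move=> xi yi xy.
have srt (z : ordering m) : increasing z -> sorted ltn [seq val (z k) | k <- enum 'I_m].
  move=> /forallP zi; rewrite sorted_pairwise; last exact: ltn_trans.
  rewrite pairwise_map; apply: sub_pairwise (_ : pairwise (relpre val ltn) (enum 'I_m)).
    by move=> a b ab; have /forallP/(_ b)/implyP := zi a; apply.
  by rewrite -pairwise_map val_enum_ord -sorted_pairwise ?iota_ltn_sorted//; exact: ltn_trans.
have : [seq val (x k) | k <- enum 'I_m] = [seq val (y k) | k <- enum 'I_m].
  apply: (irr_sorted_eq ltn_trans ltnn); [exact: srt|exact: srt|].
  have mem (z : ordering m) v : (v \in [seq val (z k) | k <- enum 'I_m]) =
      [exists w in vertices z, val w == v].
    apply/mapP/exists_inP => [[k _ ->]|[w /imsetP[k _ ->] /eqP <-]].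
      by exists (z k) => //; apply/imsetP; exists k.
    by exists k; rewrite ?mem_enum.
  by move=> v; rewrite !mem xy.
move=> /eq_in_map E; apply/ffunP => k; apply/val_inj/E.
by rewrite mem_enum.
Qed.

End Orientations.

(** * Both adjacency matrices as corners of block sums *)

Section SignedCells.
Variables (R : realType) (n d : nat).
Hypothesis d2 : (2 <= d)%N.
Notation cell_index := 'I_#|[set s : {set 'I_n} | #|s| == d]|.
Notation cfg := {ffun {set 'I_n} -> bool}.
Implicit Types (c : cfg) (i j : cell_index) (X : simplicial_complex n).

Definition positive_cell i : {set {ffun 'I_d -> 'I_n}} :=
  orient (incr_ordering (card_facet i)).

Definition spans (C : {set {ffun 'I_d -> 'I_n}}) i : Prop :=
  exists2 z, z \in C & vertices z = facet i.

Lemma positive_cell_spans i : spans (positive_cell i) i.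
Proof.
by exists (incr_ordering (card_facet i)); rewrite ?orient_refl ?vertices_incr_ordering.
Qed.

Lemma opposite_cell_spans i : spans (opposite (positive_cell i)) i.
Proof.
have [s _ E] := opposite_orient d2 (incr_ordering (card_facet i)).
rewrite /positive_cell E; exists (permute (incr_ordering (card_facet i)) s).
  exact: orient_refl.
by rewrite vertices_permute vertices_incr_ordering.
Qed.

Lemma positive_cell_inj : injective positive_cell.
Proof.
move=> i j ij; apply: facet_inj.
have : incr_ordering (card_facet i) \in positive_cell j by rewrite -ij orient_refl.
case/imsetP => s _ E.
by rewrite -(vertices_incr_ordering (card_facet i)) E vertices_permute vertices_incr_ordering.
Qed.

Lemma full_complex_closed (s t : {set 'I_n}) :
  s \in [set: {set 'I_n}] -> t \subset s -> t \in [set: {set 'I_n}].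
Proof. by move=> _ _; rewrite inE. Qed.

Definition full_complex := SimplicialComplex full_complex_closed.

(* The sign relation between two facets does not depend on the complex: the
   complex only decides whether their union is a cell. *)
Lemma upper_adjacent_full X i j C D : i != j -> spans C i -> spans (opposite D) j ->
  upper_adjacent X C D =
  (facet i :|: facet j \in cells X d) && upper_adjacent full_complex C D.
Proof.
move=> ij [z zC zi] [w wD wj]; set U := facet i :|: facet j.
have key (x : {ffun 'I_d.+1 -> 'I_n}) : injective x ->
    C \in oriented_boundary (orient x) -> opposite D \in oriented_boundary (orient x) ->
    vertices x = U.
  move=> xi Cx Dx; have cx := card_vertices xi.
  apply: is_face_union => //; first by rewrite /top cx.
    by rewrite /is_face -zi; exact: boundary_vertices Cx zC.
  by rewrite /is_face -wj; exact: boundary_vertices Dx wD.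
apply/exists_inP/andP => [[T]|[]].
  case/imsetP => x; rewrite inE => /andP[/injectiveP xi xX] -> /andP[Cx Dx].
  have xU := key x xi Cx Dx; split.
    by rewrite inE -xU xX card_vertices ?eqxx.
  apply/exists_inP; exists (orient x); last by rewrite Cx Dx.
  by apply/imsetP; exists x; rewrite // !inE andbT; apply/injectiveP.
rewrite inE => /andP[UX _] /exists_inP[T /imsetP[x]].
rewrite inE => /andP[/injectiveP xi _] -> /andP[Cx Dx].
exists (orient x); last by rewrite Cx Dx.
apply/imsetP; exists x => //; rewrite inE (key x xi Cx Dx) UX andbT.
exact/injectiveP.
Qed.

Lemma upper_adjacent_op X (C D : {set {ffun 'I_d -> 'I_n}}) :
  opposite (opposite C) = C ->
  upper_adjacent X C D -> upper_adjacent X (opposite D) (opposite C).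
Proof.
move=> CK /exists_inP[T TX /andP[CT DT]]; apply/exists_inP; exists T => //.
by rewrite DT CK CT.
Qed.

Lemma upper_adjacent_opposite X (C D : {set {ffun 'I_d -> 'I_n}}) :
  upper_adjacent X C D -> upper_adjacent X (opposite C) (opposite D).
Proof.
move=> /exists_inP[T /imsetP[x]]; rewrite inE => /andP[/injectiveP xi xX] ->.
move=> /andP[CT DT]; apply/exists_inP; exists (opposite (orient x)).
  have [s _ ->] := opposite_orient (leqW d2) x.
  apply/imsetP; exists (permute x s) => //; rewrite inE vertices_permute xX andbT.
  by apply/injectiveP; exact: permute_inj.
by rewrite !opposite_boundary.
Qed.

Lemma positive_cellK i : opposite (opposite (positive_cell i)) = positive_cell i.
Proof. exact: oppositeK. Qed.

(** Exchanging the roles of the two facets turns a relation between C and D into one between -D and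
    -C; reversing the d-cell then removes both signs. *)
Lemma upper_adjacent_sym X i j :
  upper_adjacent X (positive_cell i) (positive_cell j) =
  upper_adjacent X (positive_cell j) (positive_cell i).
Proof.
have imp k l : upper_adjacent X (positive_cell k) (positive_cell l) ->
    upper_adjacent X (positive_cell l) (positive_cell k).
  move=> /(upper_adjacent_op (positive_cellK k))/upper_adjacent_opposite.
  by rewrite !positive_cellK.
by apply/idP/idP; exact: imp.
Qed.

Lemma boundary_positive_cell (x : {ffun 'I_d.+1 -> 'I_n}) i : injective x ->
  facet i \subset vertices x ->
  exists2 D, D \in oriented_boundary (orient x) &
    D = positive_cell i \/ D = opposite (positive_cell i).
Proof.
move=> xi ix.
have : #|vertices x :\: facet i| = 1%N.
  by rewrite cardsD (setIidPr ix) card_vertices// card_facet subSnn.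
move/eqP/cards1P => [v xv].
have : v \in vertices x :\: facet i by rewrite xv inE.
rewrite inE => /andP[vi /imsetP[k _ vk]].
have dinj : injective (del_vertex x k).
  by move=> a b; rewrite !ffunE => /xi/lift_inj.
have dv : vertices (del_vertex x k) = facet i.
  apply/eqP; rewrite eqEcard card_vertices// card_facet leqnn andbT.
  apply/subsetP => u /imsetP[l _ ->]; rewrite ffunE.
  apply/negPn/negP => nu; have : x (lift k l) \in vertices x :\: facet i.
    by rewrite inE nu; apply/imsetP; exists (lift k l).
  rewrite xv inE vk => /eqP/xi/eqP.
  by rewrite eq_sym (negPf (neq_lift _ _)).
have [s E] := same_vertices_permute
  (increasing_inj (increasing_incr_ordering (card_facet i))) dinj
  (etrans (vertices_incr_ordering (card_facet i)) (esym dv)).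
have Ds : orient (del_vertex x k) = positive_cell i \/
    orient (del_vertex x k) = opposite (positive_cell i).
  rewrite E; case: (boolP (odd_perm s)) => so; [right|left].
    exact: orient_permute_odd.
  exact: orient_permute_even.
exists (if odd k then opposite (orient (del_vertex x k)) else orient (del_vertex x k)).
  by apply/imset2P; exists x k; rewrite ?orient_refl.
by case: (odd k); case: Ds => ->; rewrite ?positive_cellK; [right|left|left|right].
Qed.

(** Orient the union so that it induces the positive orientation on facet i. It induces one of the
    two orientations on facet j, and this decides the alternative. *)
Lemma upper_adjacent_or i j : i != j -> #|facet i :|: facet j| = d.+1 ->
  upper_adjacent full_complex (positive_cell i) (positive_cell j) ||
  upper_adjacent full_complex (positive_cell i) (opposite (positive_cell j)).
Proof.
move=> ij Ud; set U := _ :|: _ in Ud.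
have [x [xi xU ix]] : exists x : {ffun 'I_d.+1 -> 'I_n}, [/\ injective x,
    vertices x = U & positive_cell i \in oriented_boundary (orient x)].
  pose y := incr_ordering Ud.
  have yi : injective y by exact/increasing_inj/increasing_incr_ordering.
  have yU : vertices y = U by exact: vertices_incr_ordering.
  have [|D Dy [DE|DE]] := @boundary_positive_cell y i yi.
  - by rewrite yU subsetUl.
  - by exists y; rewrite -DE.
  - have [s _ E] := opposite_orient (leqW d2) y.
    exists (permute y s); split; rewrite ?vertices_permute//; first exact: permute_inj.
    by rewrite -E -(positive_cellK i) -DE opposite_boundary.
have [|D Dx DE] := @boundary_positive_cell x j xi; first by rewrite xU subsetUr.
have TX : orient x \in oriented_cells d.+1 full_complex.
  by apply/imsetP; exists x; rewrite // !inE andbT; apply/injectiveP.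
apply/orP; case: DE => DE; [right|left]; apply/exists_inP; exists (orient x) => //.
  by rewrite ix positive_cellK -DE.
by rewrite ix -DE.
Qed.

(** The value 1 on the diagonal and the default -1 make [sign_sqr] hold for all pairs, as
    [top_block_sqr] requires. *)
Definition sign i j : R :=
  if (i == j) || upper_adjacent full_complex (positive_cell i) (positive_cell j)
  then 1 else -1.

Lemma sign_sym i j : sign i j = sign j i.
Proof. by rewrite /sign eq_sym upper_adjacent_sym. Qed.

Lemma sign_sqr i j : sign i j ^+ 2 = 1.
Proof. by rewrite /sign; case: ifP; rewrite ?sqrrN expr1n. Qed.

Lemma mem_present c i : (i \in present c) = (facet i \in lower_model d c).
Proof. exact: presentE. Qed.

Lemma positive_cellsE c :
  positive_cells d (lower_model d c) = [set positive_cell i | i : cell_index in present c].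
Proof.
apply/setP => C; apply/imsetP/imsetP => [[x]|[i ci ->]].
  rewrite inE => /andP[xinc xX] ->.
  have [i ix] := facetP (card_vertices (increasing_inj xinc)).
  exists i; first by rewrite mem_present ix.
  congr orient; apply: increasing_unique => //; first exact: increasing_incr_ordering.
  by rewrite vertices_incr_ordering.
exists (incr_ordering (card_facet i)) => //.
rewrite inE increasing_incr_ordering vertices_incr_ordering.
by move: ci; rewrite mem_present.
Qed.

Lemma cellsE c : cells (lower_model d c) d.-1 = [set facet i | i : cell_index in present c].
Proof.
apply/setP => s; rewrite !inE prednK; last exact: ltnW.
apply/andP/imsetP => [[sX /eqP sd]|[i ci ->]].
  have [i si] := facetP sd; exists i => //.
  by rewrite mem_present si inE.
move: ci; rewrite mem_present inE => ->.
by rewrite card_facet.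
Qed.

(** The adjacency matrices are indexed by enumerations of random sets; [f] carries these indices
    into the fixed index set. Injectivity and image are recorded because the spectrum does not
    depend on the order of enumeration. *)
Lemma enum_present (T : finType) (phi : cell_index -> T) c (A : {set T}) :
  injective phi -> A = [set phi i | i : cell_index in present c] ->
  exists f : 'I_#|A| -> cell_index, [/\ injective f,
    forall a, enum_val a = phi (f a) & codom f =i present c].
Proof.
move=> phi_inj AE.
have ex (a : 'I_#|A|) : exists i, present c i && (enum_val a == phi i).
  have := enum_valP a; rewrite {2}AE => /imsetP[i ci ->].
  by exists i; rewrite eqxx andbT.
pose f a := xchoose (ex a).
have fP a : present c (f a) /\ enum_val a = phi (f a).
  by have /andP[? /eqP ?] := xchooseP (ex a).
exists f; split=> [a b ab|a|i].
- by apply: enum_val_inj; rewrite (fP a).2 (fP b).2 ab.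
- exact: (fP a).2.
- apply/codomP/idP => [[a ->]|ci]; first exact: (fP a).1.
  have iA : phi i \in A by rewrite AE imset_f.
  exists (enum_rank_in iA (phi i)); apply: phi_inj.
  by rewrite -(fP _).2 enum_rankK_in.
Qed.

Lemma unsigned_adjacency_block c : exists f : 'I_#|cells (lower_model d c) d.-1| -> cell_index,
  [/\ injective f, codom f =i present c &
    forall a b, unsigned_adjacency R d (lower_model d c) a b =
      block_sum (top d) (skel d) (top_block (fun _ _ => 1)) c (f a) (f b)].
Proof.
have [f [fi fE fc]] := enum_present (@facet_inj n d) (cellsE c).
exists f; split=> // a b; rewrite mxE block_sumE ?mul1r; last exact: ltnW.
rewrite !fE; case: eqVneq => //= fab.
(* On the diagonal the union is the facet itself, which has d vertices and so is not a d-cell. *)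
by rewrite fab setUid !inE card_facet [d == _]ltn_eqF// andbF.
Qed.

Lemma signed_adjacency_block c : exists f : 'I_#|positive_cells d (lower_model d c)| -> cell_index,
  [/\ injective f, codom f =i present c &
    forall a b, signed_adjacency R d (lower_model d c) a b =
      block_sum (top d) (skel d) (top_block sign) c (f a) (f b)].
Proof.
have [f [fi fE fc]] := enum_present positive_cell_inj (positive_cellsE c).
exists f; split=> // a b; rewrite mxE /= block_sumE; last exact: ltnW.
rewrite !fE (inj_eq positive_cell_inj); case: eqVneq => /= [|fab]; first by rewrite mulr0.
have sp := positive_cell_spans; have so := opposite_cell_spans.
rewrite (upper_adjacent_full _ fab (sp _) (so _)).
have soo : spans (opposite (opposite (positive_cell (f b)))) (f b).
  by rewrite positive_cellK; exact: sp.
rewrite (upper_adjacent_full _ fab (sp _) soo).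
case: (boolP (_ \in cells _ _)) => [Uc|_]/=; last by rewrite mulr0.
rewrite mulr1 /sign (negPf fab)/=; case: ifPn => // nadj.
have Ud : #|facet (f a) :|: facet (f b)| = d.+1 by move: Uc; rewrite inE => /andP[_ /eqP].
by have := upper_adjacent_or fab Ud; rewrite (negPf nadj)/= => ->.
Qed.

End SignedCells.

(** * Moments of the skeleton *)

Section AllOn.
Variables (I : finType) (R : realFieldType) (p : I -> R).
Implicit Types (c : {ffun I -> bool}) (A B : {set I}).

Definition all_on c A : bool := [forall t in A, c t].

Lemma all_onU c A B : all_on c (A :|: B) = all_on c A && all_on c B.
Proof.
apply/forall_inP/andP => [H|[/forall_inP HA /forall_inP HB] t].
  by split; apply/forall_inP => t tA; apply: H; rewrite inE tA ?orbT.
by rewrite inE => /orP[/HA|/HB].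
Qed.

Lemma Ex_all_on A : Ex p (fun c => (all_on c A)%:R) = \prod_(t in A) p t.
Proof.
rewrite -Ex_prod; apply: eq_Ex => c.
case: (boolP (all_on c A)) => [/forall_inP H|].
  by rewrite big1// => t /H ->.
rewrite negb_forall_in => /exists_inP[t tA ct].
by rewrite (bigD1 t)//= (negPf ct) mul0r.
Qed.

Lemma prod_disjointU A B : [disjoint A & B] ->
  \prod_(t in A :|: B) p t = (\prod_(t in A) p t) * (\prod_(t in B) p t).
Proof.
by move=> AB; rewrite (eq_bigl _ _ (fun t => in_setU t A B)) bigU.
Qed.

Lemma Ex_all_onU A B : [disjoint A & B] ->
  Ex p (fun c => (all_on c A && all_on c B)%:R) =
  (\prod_(t in A) p t) * (\prod_(t in B) p t).
Proof.
move=> AB; under eq_Ex do rewrite -all_onU.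
by rewrite Ex_all_on prod_disjointU.
Qed.

End AllOn.

Lemma prod_subsets (T : finType) (R : comPzRingType) (s : {set T}) (a b : nat)
    (f : nat -> R) :
  \prod_(t : {set T} | (t \subset s) && (a <= #|t| < b)%N) f #|t| =
  \prod_(a <= r < b) f r ^+ 'C(#|s|, r).
Proof.
have -> : \prod_(a <= r < b) f r ^+ 'C(#|s|, r) =
    \prod_(a <= r < b) \prod_(t : {set T} | (t \subset s) && (#|t| == r)) f r.
  apply: eq_bigr => r _; rewrite -cards_draws -prodr_const.
  by apply: eq_bigl => t; rewrite inE.
rewrite big_nat_cond (exchange_big_dep (fun t : {set T} => (t \subset s) && (a <= #|t| < b)%N))/=.
  apply: eq_bigr => t /andP[ts tab].
  rewrite big_mkcond (bigD1_seq #|t|)/= ?mem_index_iota ?iota_uniq// ts eqxx.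
  rewrite tab big1 ?mulr1// => r rt.
  by rewrite [_ == r]eq_sym (negPf rt) !andbF.
by move=> r t /andP[rab _] /andP[-> /eqP ->].
Qed.

Section SkeletonMoments.
Variables (R : realType) (n d : nat) (p : nat -> R).
Hypothesis p01 : forall r, (1 <= r <= d)%N -> 0 < p r <= 1.
Hypothesis d2 : (2 <= d)%N.
Hypothesis dn : (d < n)%N.
Notation cell_index := 'I_#|[set s : {set 'I_n} | #|s| == d]|.
Notation cfg := {ffun {set 'I_n} -> bool}.
Implicit Types (c : cfg) (i j : cell_index) (s t u : {set 'I_n}) (v : 'I_n).

(** The value 0 outside the relevant sizes freezes those coordinates at false, matching [config],
    which sets them to false as well. *)
Definition cell_prob t : R := if (2 <= #|t| <= d.+1)%N then p #|t|.-1 else 0.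

(** Here r counts vertices, so the cells in question have dimension r - 1. *)
Definition facet_prob : R := \prod_(2 <= r < d.+1) p r.-1 ^+ 'C(d, r).
(** Chance that a new vertex completes a present facet to a potential d-cell: r vertices of the
    facet together with the new one form a cell of dimension r. The top factor r = d is split off,
    as in [variance_scaleE]. *)
Definition link_prob : R := \prod_(1 <= r < d) p r ^+ 'C(d, r).

Lemma prod_p_01 a b e (g : nat -> nat) :
  (forall r, (a <= r < b)%N -> (1 <= g r <= d)%N) ->
  0 < \prod_(a <= r < b) p (g r) ^+ e r <= 1.
Proof.
move=> gd; rewrite big_nat_cond.
apply: (big_ind (fun x : R => 0 < x <= 1)) => [|x y /andP[x0 x1] /andP[y0 y1]|r]; last move=> /andP[/gd/p01/andP[p0 p1] _].
- by rewrite ltr01 lexx.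
- by rewrite mulr_gt0//= mulr_ile1// ltW.
- by rewrite exprn_gt0//= exprn_ile1// ltW.
Qed.

Lemma cell_prob01 t : 0 <= cell_prob t <= 1.
Proof.
rewrite /cell_prob; case: ifP => [/andP[t2 td]|_]; last by rewrite lexx ler01.
have /andP[/ltW -> ->]// : 0 < p #|t|.-1 <= 1.
by apply: p01; rewrite -ltnS prednK ?(ltnW t2)//; lia.
Qed.

Lemma facet_prob01 : 0 < facet_prob <= 1.
Proof. by apply: (@prod_p_01 _ _ _ predn) => r /andP[r2 rd]; lia. Qed.

Lemma link_prob01 : 0 < link_prob <= 1.
Proof. by apply: (@prod_p_01 _ _ _ id) => r /andP[r1 rd]; rewrite r1 ltnW. Qed.

Definition facet_cells i : {set {set 'I_n}} :=
  [set t : {set 'I_n} | (t \subset facet i) && (2 <= #|t|)%N].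

Lemma presentE_all c i : present c i = all_on c (facet_cells i).
Proof. by apply: eq_forallb => t; rewrite inE. Qed.

Lemma prod_facet_cells i : \prod_(t in facet_cells i) cell_prob t = facet_prob.
Proof.
have -> : facet_prob = \prod_(t : {set 'I_n} |
    (t \subset facet i) && (2 <= #|t| < #|facet i|.+1)%N) p #|t|.-1.
  by rewrite (prod_subsets _ _ _ (fun r => p r.-1)) card_facet.
have td (t : {set 'I_n}) : t \subset facet i -> (#|t| <= #|facet i|)%N by exact: subset_leq_card.
apply: eq_big => [t|t].
  by rewrite inE ltnS; case: (boolP (_ \subset _)) => //= /td ->; rewrite andbT.
rewrite inE /cell_prob => /andP[/td ti t2]; rewrite t2/= (leq_trans ti)//.
by rewrite card_facet.
Qed.

Lemma Ex_present i : Ex cell_prob (fun c => (present c i)%:R) = facet_prob.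
Proof.
by under eq_Ex do rewrite presentE_all; rewrite Ex_all_on prod_facet_cells.
Qed.

Lemma Ex_present_disjoint i j : [disjoint facet i & facet j] ->
  Ex cell_prob (fun c => (present c i && present c j)%:R) = facet_prob ^+ 2.
Proof.
move=> ij; under eq_Ex do rewrite !presentE_all.
rewrite Ex_all_onU ?prod_facet_cells//.
apply/pred0P => t /=; rewrite !inE; apply/negP => /andP[/andP[ti t2] /andP[tj _]].
have : t \subset facet i :&: facet j by rewrite subsetI ti.
by move: ij; rewrite -setI_eq0 => /eqP ->; rewrite subset0 => /eqP t0; rewrite t0 cards0 in t2.
Qed.

(* Link cells of v over the facet s: the sets v |: u with u a nonempty proper
   subset of s; together with the cells of s they are all the proper cells of
   the potential d-cell v |: s. *)
Definition link_cells i v : {set {set 'I_n}} :=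
  [set v |: u | u in [set u : {set 'I_n} | (u \subset facet i) && (1 <= #|u| < d)%N]].

Lemma link_cellsP i v t : v \notin facet i ->
  (t \in link_cells i v) = [&& v \in t, t \subset v |: facet i & (2 <= #|t| <= d)%N].
Proof.
move=> vi; apply/imsetP/and3P => [[u]|[vt ti td]].
  rewrite inE => /andP[ui ud] ->; split; first by rewrite !inE eqxx.
    exact: setUS.
  have vu : v \notin u by apply: contra vi; exact: (subsetP ui).
  by rewrite cardsU1 vu add1n ltnS.
exists (t :\ v); last by rewrite setD1K.
rewrite inE subDset ti/=.
by move: td; rewrite (cardsD1 v t) vt add1n ltnS.
Qed.

Lemma prod_link_cells i v : v \notin facet i ->
  \prod_(t in link_cells i v) cell_prob t = link_prob.
Proof.
move=> vi; have vu u : u \subset facet i -> v \notin u.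
  by move=> ui; apply: contra vi; exact: (subsetP ui).
rewrite big_imset/=; last first.
  move=> u u'; rewrite !inE => /andP[/vu vu1 _] /andP[/vu vu2 _] /(congr1 (fun s => s :\ v)).
  by rewrite !setU1K.
have -> : link_prob =
  \prod_(t : {set 'I_n} | (t \subset facet i) && (1 <= #|t| < d)%N) p #|t|.
  by rewrite (prod_subsets _ _ _ p) card_facet.
apply: eq_big => [u|u]; first by rewrite inE.
rewrite inE /cell_prob => /andP[/vu nvu /andP[u1 ud]].
by rewrite cardsU1 nvu add1n ltnS u1 ltnS ltnW//= ltnW.
Qed.

Lemma disjoint_facet_link i v : v \notin facet i ->
  [disjoint facet_cells i & link_cells i v].
Proof.
move=> vi; apply/pred0P => t /=; rewrite link_cellsP// inE.
apply/negP => /andP[/andP[ti _] /and3P[vt _ _]].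
by move: vi; rewrite (subsetP ti).
Qed.

Lemma disjoint_link i v w : v \notin facet i -> w \notin facet i -> v != w ->
  [disjoint link_cells i v & link_cells i w].
Proof.
move=> vi wi vw; apply/pred0P => t /=; rewrite !link_cellsP//.
apply/negP => /andP[/and3P[vt _ _] /and3P[_ tw _]].
have := subsetP tw v vt; rewrite !inE (negPf vw)/= => h.
by rewrite h in vi.
Qed.

Lemma skel_link c i v : v \notin facet i ->
  skel d c (v |: facet i) = present c i && all_on c (link_cells i v).
Proof.
move=> vi; rewrite presentE_all -all_onU; apply: eq_forallb => t.
congr (_ ==> _); rewrite !inE link_cellsP//.
case: (boolP (v \in t)) => vt/=.
  have -> : (t \subset facet i) = false.
    by apply/negP => /subsetP/(_ v vt) h; rewrite h in vi.
  by [].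
rewrite orbF.
have -> : (t \subset v |: facet i) = (t \subset facet i).
  apply/subsetP/subsetP => H x xt.
    by have := H x xt; rewrite !inE => /orP[/eqP xv|//]; rewrite -xv xt in vt.
  by rewrite !inE H ?orbT.
case: (boolP (t \subset facet i)) => //= /subset_leq_card.
by rewrite card_facet => ->; rewrite andbT.
Qed.

Lemma up_degreeE c i : present c i ->
  (up_degree c i)%:R = \sum_(v in ~: facet i) (all_on c (link_cells i v))%:R :> R.
Proof.
move=> ci; rewrite -natr_sum; congr _%:R.
rewrite /up_degree -sum1_card.
pose A := [set v |: facet i | v in ~: facet i].
have inj : {in ~: facet i &, injective (fun v => v |: facet i)}.
  move=> v w; rewrite !inE => vi wi /setP/(_ v); rewrite !inE eqxx/= => /esym/orP[/eqP//|h].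
  by rewrite h in vi.
transitivity (\sum_(t in A) (skel d c t : nat))%N; last first.
  rewrite big_imset//; apply: eq_bigr => v; rewrite inE => vi.
  by rewrite skel_link// ci.
rewrite [LHS]big_mkcond [RHS]big_mkcond; apply: eq_bigr => t _; rewrite inE.
have -> : (t \in A) = top d t && is_face t i.
  apply/imsetP/andP => [[v]|[/eqP td it]].
    rewrite inE => vi ->; rewrite /top /is_face cardsU1 vi card_facet eqxx.
    by rewrite subsetUr.
  have : #|t :\: facet i| = 1%N.
    by rewrite cardsD (setIidPr it) td card_facet subSnn.
  move/eqP/cards1P => [v tv]; exists v; last first.
    by rewrite -[LHS](setID t (facet i)) (setIidPr it) tv setUC.
  have : v \in t :\: facet i by rewrite tv inE.
  by rewrite !inE => /andP[].
by case: (top d t); case: (skel d c t); case: (is_face t i).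
Qed.

(** Link cells over distinct vertices are disjoint from each other and from the cells of the facet.
    Given that the facet is present, its degree is therefore binomial with parameters n - d and
    [link_prob], of variance at most n. *)
Lemma Ex_up_degree_sqr i :
  Ex cell_prob (fun c => (present c i)%:R *
    ((up_degree c i)%:R - (n - d)%:R * link_prob) ^+ 2) <= n%:R.
Proof.
have /andP[l0 l1] := link_prob01.
have cardC : #|~: facet i| = (n - d)%N.
  by rewrite cardsCs setCK card_ord card_facet.
pose X v c : R := (all_on c (link_cells i v))%:R - link_prob.
have -> : Ex cell_prob (fun c => (present c i)%:R *
    ((up_degree c i)%:R - (n - d)%:R * link_prob) ^+ 2) =
  Ex cell_prob (fun c => (present c i)%:R * (\sum_(v in ~: facet i) X v c) ^+ 2).
  apply: eq_Ex => c; case: (boolP (present c i)) => [ci|]; last by rewrite !mul0r.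
  rewrite up_degreeE// /X sumrB sumr_const cardC; congr (_ * (_ - _) ^+ 2).
  by rewrite mulr_natl.
apply: (@le_trans _ _ (#|~: facet i|%:R * 1)); last first.
  by rewrite mulr1 cardC ler_nat leq_subr.
have E1 v : v \in ~: facet i ->
    Ex cell_prob (fun c => (present c i)%:R * (all_on c (link_cells i v))%:R) =
    facet_prob * link_prob.
  rewrite inE => vi; rewrite -(prod_facet_cells i) -(prod_link_cells vi).
  rewrite -Ex_all_onU ?disjoint_facet_link//.
  by apply: eq_Ex => c; rewrite presentE_all -natrM mulnb.
apply: Ex_sqr_sum_uncorrelated => [v w vi wi vw|v vi].
  have E2 : Ex cell_prob (fun c => (present c i)%:R *
      ((all_on c (link_cells i v))%:R * (all_on c (link_cells i w))%:R)) =
      facet_prob * (link_prob * link_prob).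
    have vi' := vi; have wi' := wi; rewrite !inE in vi' wi'.
    rewrite -{1}(prod_link_cells vi') -(prod_link_cells wi') -(prod_facet_cells i).
    rewrite -prod_disjointU ?disjoint_link// -Ex_all_onU; last first.
      by rewrite -setI_eq0 setIUr setU_eq0 !setI_eq0 !disjoint_facet_link.
    by apply: eq_Ex => c; rewrite presentE_all all_onU -!natrM !mulnb.
  transitivity (Ex cell_prob (fun c =>
    (present c i)%:R * ((all_on c (link_cells i v))%:R * (all_on c (link_cells i w))%:R)
    + ((- link_prob) * ((present c i)%:R * (all_on c (link_cells i v))%:R)
    + ((- link_prob) * ((present c i)%:R * (all_on c (link_cells i w))%:R)
    + link_prob ^+ 2 * (present c i)%:R)))).
    by apply: eq_Ex => c; rewrite /X; ring.
  by rewrite !ExD !ExZ E2 !E1// Ex_present; ring.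
rewrite -[leRHS](Ex_cst cell_prob); apply: le_Ex => [t|c]; first exact: cell_prob01.
rewrite -[leRHS]mulr1 ler_pM ?sqr_ge0//; first by case: present.
rewrite /X; case: all_on => /=; nra.
Qed.

Local Notation N := #|[set s : {set 'I_n} | #|s| == d]|.

Lemma card_cell_index : N = 'C(n, d).
Proof. by rewrite card_draws card_ord. Qed.

Lemma card_facets_through v :
  (#|[pred j : cell_index | v \in facet j]| <= 'C(n, d.-1))%N.
Proof.
have <- : #|[set s : {set 'I_n} | #|s| == d.-1]| = 'C(n, d.-1).
  by rewrite card_draws card_ord.
rewrite -(card_in_imset (f := fun j : cell_index => facet j :\ v)).
  apply/subset_leq_card/subsetP => s /imsetP[j]; rewrite !inE => vj ->.
  by have := cardsD1 v (facet j); rewrite vj card_facet add1n => /(congr1 predn)/= ->.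
move=> j k; rewrite !inE => vj vk /(congr1 (fun s => v |: s)).
by rewrite !setD1K// => /facet_inj.
Qed.

(** Union bound over the d vertices of the facet, combined with d C(n,d) = (n-d+1) C(n,d-1). A facet
    thus meets only a fraction of order 1/n of all facets. *)
Lemma card_meeting_facets i :
  (#|[pred j : cell_index | ~~ [disjoint facet i & facet j]]| * (n - d.-1) <= d * (d * N))%N.
Proof.
have d0 : (0 < d)%N by exact: ltnW.
have le_mul M : (M <= d * 'C(n, d.-1) -> M * (n - d.-1) <= d * (d * N))%N.
  move=> Md; rewrite card_cell_index.
  have -> : (d * 'C(n, d) = (n - d.-1) * 'C(n, d.-1))%N.
    by rewrite -{1 2}(prednK d0) mul_bin_left.
  by rewrite mulnC mulnCA leq_mul2l Md orbT.
apply: le_mul; suff : (#|[pred j : cell_index | ~~ [disjoint facet i & facet j]]| <=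
    \sum_(v in facet i) 'C(n, d.-1))%N by rewrite sum_nat_const card_facet.
apply: (@leq_trans (\sum_(v in facet i) #|[pred j : cell_index | v \in facet j]|)).
  rewrite -[leqLHS]sum1_card.
  have -> : (\sum_(v in facet i) #|[pred j : cell_index | v \in facet j]| =
      \sum_(j : cell_index) \sum_(v in facet i) (v \in facet j))%N.
    rewrite exchange_big/=; apply: eq_bigr => v _.
    by rewrite -[LHS]sum1_card big_mkcond; apply: eq_bigr => j _; rewrite inE; case: (v \in _).
  rewrite big_mkcond; apply: leq_sum => j _; rewrite inE.
  case: (boolP [disjoint _ & _]) => //= /pred0Pn[v /= /andP[vi vj]].
  by rewrite (bigD1 v)//= vj.
by apply: leq_sum => v _; exact: card_facets_through.
Qed.

(** Disjoint facets are present independently, so only meeting pairs contribute, each at most 1. *)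
Lemma Ex_present_variance :
  Ex cell_prob (fun c => (\sum_(i : cell_index) ((present c i)%:R - facet_prob)) ^+ 2) *
    (n - d.-1)%:R <= d%:R ^+ 2 * N%:R ^+ 2.
Proof.
have /andP[f0 f1] := facet_prob01.
pose X c i : R := (present c i)%:R - facet_prob.
have EXX i j : Ex cell_prob (fun c => X c i * X c j) <=
    (~~ [disjoint facet i & facet j])%:R.
  case: (boolP [disjoint _ & _]) => [ij|_] /=.
    have -> : Ex cell_prob (fun c => X c i * X c j) =
      Ex cell_prob (fun c => (present c i && present c j)%:R +
        ((- facet_prob) * (present c i)%:R + ((- facet_prob) * (present c j)%:R +
         facet_prob ^+ 2))).
      by apply: eq_Ex => c; rewrite /X -mulnb natrM; ring.
    rewrite !ExD !ExZ Ex_cst Ex_present_disjoint// !Ex_present.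
    by rewrite le_eqVlt; apply/orP; left; apply/eqP; ring.
  rewrite -[leRHS](Ex_cst cell_prob); apply: le_Ex => [t|c]; first exact: cell_prob01.
  by rewrite /X; case: (present c i); case: (present c j) => /=; nra.
have -> : Ex cell_prob (fun c => (\sum_i X c i) ^+ 2) =
    \sum_i \sum_j Ex cell_prob (fun c => X c i * X c j).
  transitivity (Ex cell_prob (fun c => \sum_i \sum_j X c i * X c j)).
    by apply: eq_Ex => c; rewrite expr2 mulr_suml; apply: eq_bigr => i _; rewrite mulr_sumr.
  by rewrite Ex_sum; apply: eq_bigr => i _; rewrite Ex_sum.
rewrite mulr_suml.
have -> : d%:R ^+ 2 * N%:R ^+ 2 = \sum_(i : cell_index) (d * (d * N))%:R :> R.
  by rewrite sumr_const card_ord -mulr_natl !natrM; ring.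
apply: ler_sum => i _.
apply: le_trans (_ : (#|[pred j : cell_index | ~~ [disjoint facet i & facet j]]| * (n - d.-1))%:R <= _); last first.
  by rewrite ler_nat card_meeting_facets.
have cardE (Q : pred cell_index) : #|Q|%:R = \sum_j (Q j)%:R :> R.
  rewrite -natr_sum; congr _%:R; rewrite -[LHS]sum1_card [LHS]big_mkcond.
  by apply: eq_bigr => j _; rewrite unfold_in; case: (Q j).
by rewrite natrM ler_wpM2r// cardE; apply: ler_sum => j _; exact: EXX.
Qed.

Lemma Ex_few_present :
  Ex cell_prob (fun c => (\sum_(i : cell_index) (present c i)%:R < N%:R * facet_prob / 2)%R%:R) <=
  4 * d%:R ^+ 2 / ((n - d.-1)%:R * facet_prob ^+ 2).
Proof.
have /andP[f0 f1] := facet_prob01.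
have N0 : 0 < N%:R :> R by rewrite ltr0n card_cell_index bin_gt0 ltnW.
have nd0 : 0 < (n - d.-1)%:R :> R by rewrite ltr0n subn_gt0 (leq_ltn_trans (leq_pred _)).
rewrite ler_pdivlMr ?mulr_gt0 ?exprn_gt0//.
have := Ex_present_variance; set E2 := Ex _ _ => V.
(* Chebyshev: below half the mean, the squared deviation is at least a quarter of the squared
   mean. *)
pose a : R := 4 / (N%:R * facet_prob) ^+ 2.
have a0 : 0 <= a by rewrite divr_ge0 ?sqr_ge0.
have : Ex cell_prob (fun c => (\sum_(i : cell_index) (present c i)%:R < N%:R * facet_prob / 2)%R%:R) <= a * E2.
  rewrite -ExZ; apply: le_Ex => [t|c]; first exact: cell_prob01.
  case: ltP => [few|_]; last by rewrite mulr_ge0 ?sqr_ge0.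
  rewrite /a mulrAC ler_pdivlMr ?exprn_gt0 ?mulr_gt0// mul1r.
  rewrite sumrB sumr_const card_ord -(mulr_natl facet_prob).
  move: few; set S := \sum_i _; have : 0 < N%:R * facet_prob by rewrite mulr_gt0.
  set T := _ * facet_prob => T0 few.
  have h1 : 0 < T - 2 * S by lra.
  have h2 : 0 < 3 * T - 2 * S by lra.
  by have := mulr_gt0 h1 h2; nra.
set F := Ex _ _ => Fa.
have : F * ((n - d.-1)%:R * facet_prob ^+ 2) <= a * E2 * ((n - d.-1)%:R * facet_prob ^+ 2).
  by rewrite ler_wpM2r// mulr_ge0 ?sqr_ge0// ltW.
move=> /le_trans; apply.
have -> : a * E2 * ((n - d.-1)%:R * facet_prob ^+ 2) =
   (E2 * (n - d.-1)%:R) * (4 / N%:R ^+ 2).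
  by rewrite /a; field; rewrite !gt_eqF.
apply: le_trans (ler_wpM2r _ V) _; first by rewrite divr_ge0 ?sqr_ge0.
by rewrite le_eqVlt; apply/orP; left; apply/eqP; field; rewrite gt_eqF.
Qed.

(* Cauchy-Schwarz applied to [Ex_up_degree_sqr], written without square root. *)
Lemma Ex_up_degree_dev i (a : R) : 0 < a ->
  Ex cell_prob (fun c => (present c i)%:R *
    `|(up_degree c i)%:R - (n - d)%:R * link_prob|) <= (a * n%:R + a^-1) / 2.
Proof.
move=> a0; set x := fun c : cfg => (up_degree c i)%:R - (n - d)%:R * link_prob.
apply: (@le_trans _ _ (Ex cell_prob (fun c => a / 2 * ((present c i)%:R * x c ^+ 2) + a^-1 / 2))).
  apply: le_Ex => [t|c]; first exact: cell_prob01.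
  rewrite -[x c ^+ 2]real_normK ?num_real//; set y := `|x c|.
  have y0 : 0 <= y by exact: normr_ge0.
  have ai : 0 < a^-1 by rewrite invr_gt0.
  case: (present c i); last by rewrite !mul0r mulr0 add0r divr_ge0// ltW.
  rewrite !mul1r -(ler_pM2l (x := 2 * a)) ?mulr_gt0//.
  have -> : 2 * a * (a / 2 * y ^+ 2 + a^-1 / 2) = (a * y) ^+ 2 + 1 by field; rewrite gt_eqF.
  by have := sqr_ge0 (a * y - 1); nra.
rewrite ExD ExZ Ex_cst mulrDl lerD2r [leRHS]mulrAC ler_wpM2l ?divr_ge0 ?(ltW a0)//.
exact: Ex_up_degree_sqr.
Qed.

End SkeletonMoments.

(** * Averages of the Green function *)

Section FixedSize.
Variables (R : realType) (n d : nat) (p : nat -> R).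
Hypothesis p01 : forall r, (1 <= r <= d)%N -> 0 < p r <= 1.
Hypothesis d2 : (2 <= d)%N.
Hypothesis dn : (d < n)%N.
Notation cell_index := 'I_#|[set s : {set 'I_n} | #|s| == d]|.
Notation cfg := {ffun {set 'I_n} -> bool}.
Local Notation N := #|[set s : {set 'I_n} | #|s| == d]|.
Variable sg : cell_index -> cell_index -> R.
Hypothesis sg_sym : forall i j, sg i j = sg j i.
Hypothesis sg_sqr : forall i j, sg i j ^+ 2 = 1.
Variable k : R.
Hypothesis k0 : 0 < k.
Hypothesis k_link : k <= link_prob d p.
Hypothesis k_facet : k <= facet_prob d p.
Local Notation q := (p d).
Hypothesis q_half : q <= 2^-1.
Variables (z s : R[i]).
Local Notation K0 := (4 / k).
Hypothesis Imz : 1 <= complex.Im z.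
Hypothesis z_large : 2 * K0 + 1 <= cabs z.
Hypothesis s_eq : 1 + s * z + s ^+ 2 = 0.
Hypothesis s_le1 : cabs s <= 1.

Definition variance_scale : R :=
  n%:R * d%:R * (\prod_(1 <= r < d.+1) p r ^+ 'C(d, r)) * (1 - q).
Local Notation m := variance_scale.
Local Notation CF := (1 + cabs z + K0).
Local Notation L := (d.+1%:R ^+ 2 * (cabs z + 2 * K0)).

Definition defect_error : R := CF * Num.sqrt (K0 * q) +
    K0 * ((d.+1%:R ^+ 5 + d.+1%:R ^+ 2 + d.+1%:R) * CF + (d.+1%:R ^+ 3 + 1) * L) * scal m +
    K0 * d.+1%:R ^+ 3 * CF * q.

Let d0 : (0 < d)%N. Proof. exact: ltnW. Qed.
Let q01 : 0 < q <= 1. Proof. by apply: p01; rewrite leqnn d0. Qed.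
Let q0 : 0 < q. Proof. by have /andP[] := q01. Qed.
Let n0 : (0 : R) < n%:R. Proof. by rewrite ltr0n (leq_trans _ dn). Qed.
Let dR0 : (0 : R) < d%:R. Proof. by rewrite ltr0n. Qed.
Let link01 : 0 < link_prob d p <= 1. Proof. exact: link_prob01. Qed.
Let link0 : 0 < link_prob d p. Proof. by have /andP[] := link01. Qed.
Let q1 : 0 < 1 - q. Proof. by move: q_half; lra. Qed.

Lemma variance_scaleE : m = n%:R * d%:R * (link_prob d p * q) * (1 - q).
Proof. by rewrite /variance_scale big_nat_recr//= binn expr1. Qed.

Let m0 : 0 < m. Proof. by rewrite variance_scaleE !mulr_gt0. Qed.

Let m_le : m <= n%:R * d.+1%:R.
Proof.
rewrite variance_scaleE -!mulrA ler_wpM2l ?(ltW n0)//.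
have /andP[_ l1] := link01; have /andP[_ q1'] := q01.
apply: (@le_trans _ _ (d%:R * 1)); last by rewrite mulr1 ler_nat.
rewrite ler_wpM2l// !mulr_ile1 ?mulr_ge0 ?(ltW link0) ?(ltW q0) ?(ltW q1)//.
by rewrite gerBl ltW.
Qed.

(** Origin of K0 = 4/k: [link_prob] is at least k, and the bounds d + 1 <= 2 d and 1 - q >= 1/2 cost
    a factor 2 each. *)
Let qm : q * (n%:R * d.+1%:R) <= K0 * m.
Proof.
rewrite variance_scaleE.
have -> : K0 * (n%:R * d%:R * (link_prob d p * q) * (1 - q)) =
   q * (n%:R * ((link_prob d p / k) * (4 * (1 - q)) * d%:R)) by ring.
rewrite ler_wpM2l ?(ltW q0)// ler_wpM2l ?(ltW n0)//.
apply: (@le_trans _ _ (1 * 2 * d%:R)).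
  by rewrite mul1r -natrM ler_nat mul2n -addnn -addn1 leq_add2l.
rewrite ler_wpM2r//; apply: ler_pM => //; first by rewrite ler_pdivlMr// mul1r.
by move: q_half; lra.
Qed.

Let cp01 := cell_prob01 p01 d2 dn.
Let cp_top (t : {set 'I_n}) : top d t -> cell_prob d p t = q.
Proof. by move=> /eqP td; rewrite /cell_prob td leqnn ltnS d0. Qed.

Let Bsq (t : {set 'I_n}) (_ : top d t) := @top_block_sqr R n d sg sg_sqr t.
Let fc (t : {set 'I_n}) (tt : top d t) : (#|@is_face n d t| <= d.+1)%N.
Proof. by rewrite card_is_face. Qed.

Notation G := (green (top d) (skel d) (top_block sg) m z).
Notation F := (defect q (top d) (skel d) (top_block sg) m z).

Lemma Ex_defect_bound :
  \sum_i Ex (cell_prob d p) (fun c : cfg => cabs (F c i) ^+ 2) <= N%:R * defect_error.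
Proof.
apply: (@Ex_defect_le R _ N d.+1 n (cell_prob d p) q (top d) (skel d) (@is_face n d)
  (top_block sg) m K0 z) => //.
- exact: ltW.
- by move=> c t b t' tt; rewrite skel_upd.
- exact: top_block_sym.
- exact: is_face_degree.
- by move=> i j t t'; exact: is_face_uniq.
Qed.

Lemma stability c :
  \sum_(i | present c i) cabs (G c i i - s) <= \sum_i cabs (F c i) +
  \sum_(i | present c i) `|scaled_degree q (top d) (skel d) (top_block sg) m c i - 1|.
Proof.
apply: (@green_stability R _ N d.+1 n q (top d) (skel d) (@is_face n d)
  (top_block sg) m K0 z) => //.
- exact: ltW.
- exact: top_block_sym.
- exact: is_face_degree.
- by move=> i j _; exact: weight_present.
Qed.

Lemma scaled_degreeE c i :
  scaled_degree q (top d) (skel d) (top_block sg) m c i =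
  (up_degree c i)%:R / (n%:R * link_prob d p * (1 - q)).
Proof.
rewrite /scaled_degree sum_weightE// scal_sqr// variance_scaleE.
by field; rewrite !gt_eqF.
Qed.

(** Two sources of deviation: the fluctuation of the degree around (n - d) [link_prob], and the bias
    (q - d/n)/(1 - q) left by normalizing with n (1 - q). *)
Lemma Ex_scaled_degree i (a : R) : 0 < a ->
  Ex (cell_prob d p) (fun c => (present c i)%:R *
    `|scaled_degree q (top d) (skel d) (top_block sg) m c i - 1|) <=
  a / k + (a * n%:R * k)^-1 + 2 * (q + d%:R / n%:R).
Proof.
move=> a0; have nk : 0 < n%:R * k by rewrite mulr_gt0.
set u := fun c : cfg => `|(up_degree c i)%:R - (n - d)%:R * link_prob d p|.
have pt c : `|scaled_degree q (top d) (skel d) (top_block sg) m c i - 1| <=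
    2 / (n%:R * k) * u c + 2 * (q + d%:R / n%:R).
  rewrite scaled_degreeE.
  have -> : (up_degree c i)%:R / (n%:R * link_prob d p * (1 - q)) - 1 =
    ((up_degree c i)%:R - (n - d)%:R * link_prob d p) / (n%:R * link_prob d p * (1 - q)) +
    (q - d%:R / n%:R) / (1 - q).
    by rewrite natrB ?(ltnW dn)//; field; rewrite !gt_eqF.
  have h2 : (1 - q)^-1 <= 2.
    by rewrite -[leRHS]invrK lef_pV2 ?posrE ?invr_gt0//; move: q_half; lra.
  apply: le_trans (ler_normD _ _) _; apply: lerD.
    rewrite normrM mulrC ler_wpM2r ?normr_ge0//.
    rewrite ger0_norm ?invr_ge0 ?mulr_ge0 ?(ltW n0) ?(ltW link0) ?(ltW q1)//.
    rewrite invfM mulrC; apply: ler_pM; rewrite ?invr_ge0 ?mulr_ge0 ?(ltW n0) ?(ltW link0) ?(ltW q1)//.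
    by rewrite lef_pV2 ?posrE ?mulr_gt0// ler_pM2l.
  rewrite normrM [X in _ * X]ger0_norm ?invr_ge0 ?(ltW q1)// mulrC.
  apply: ler_pM; rewrite ?invr_ge0 ?(ltW q1)//.
  apply: le_trans (ler_normB _ _) _.
  by rewrite !ger0_norm ?divr_ge0 ?(ltW q0) ?(ltW dR0) ?(ltW n0).
have qdn : 0 <= 2 * (q + d%:R / n%:R).
  by rewrite mulr_ge0// addr_ge0 ?divr_ge0 ?(ltW q0) ?(ltW dR0) ?(ltW n0).
apply: (@le_trans _ _ (Ex (cell_prob d p) (fun c =>
   2 / (n%:R * k) * ((present c i)%:R * u c) + 2 * (q + d%:R / n%:R)))).
  apply: le_Ex => // c; case: (present c i); first by rewrite !mul1r.
  by rewrite !mul0r mulr0 add0r.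
rewrite ExD ExZ Ex_cst lerD2r.
apply: le_trans (ler_wpM2l _ (Ex_up_degree_dev p01 d2 dn i a0)) _.
  by rewrite divr_ge0 ?(ltW nk).
by rewrite le_eqVlt; apply/orP; left; apply/eqP; field; rewrite !gt_eqF.
Qed.

(** The parameter [a] comes from using x <= a/2 + x^2/(2a) in place of Cauchy-Schwarz. For fixed [a]
    all terms but those linear in [a] vanish as n grows; [a] is sent to 0 afterwards. *)
Definition green_error (a : R) : R :=
  (a + a^-1 * defect_error) / 2 +
  (a / k + (a * n%:R * k)^-1 + 2 * (q + d%:R / n%:R)).

Lemma Ex_green_error (a : R) : 0 < a ->
  Ex (cell_prob d p) (fun c => \sum_(i | present c i) cabs (G c i i - s)) <=
  N%:R * green_error a.
Proof.
move=> a0; have ai : 0 < a^-1 by rewrite invr_gt0.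
pose D c i := `|scaled_degree q (top d) (skel d) (top_block sg) m c i - 1|.
have Ncst (b : R) : N%:R * b = \sum_(i : cell_index) b.
  by rewrite sumr_const card_ord mulr_natl.
apply: (@le_trans _ _ (Ex (cell_prob d p) (fun c =>
   \sum_i (a / 2 + a^-1 / 2 * cabs (F c i) ^+ 2) + \sum_i (present c i)%:R * D c i))).
  apply: le_Ex => // c; apply: le_trans (stability c) _; apply: lerD.
    apply: ler_sum => i _; set y := cabs _.
    rewrite -(ler_pM2l (x := 2 * a)) ?mulr_gt0//.
    have -> : 2 * a * (a / 2 + a^-1 / 2 * y ^+ 2) = a ^+ 2 + y ^+ 2 by field; rewrite gt_eqF.
    by have := sqr_ge0 (a - y); nra.
  rewrite big_mkcond; apply: ler_sum => i _.
  by case: (present c i); rewrite ?mul1r ?mul0r.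
rewrite ExD !Ex_sum /green_error mulrDr; apply: lerD.
  under eq_bigr do rewrite ExD Ex_cst ExZ.
  rewrite big_split/= -Ncst -mulr_sumr.
  apply: le_trans (lerD (lexx _) (ler_wpM2l _ Ex_defect_bound)) _.
    by rewrite divr_ge0 ?(ltW ai).
  by rewrite le_eqVlt; apply/orP; left; apply/eqP; field; rewrite gt_eqF.
by rewrite Ncst; apply: ler_sum => i _; exact: Ex_scaled_degree.
Qed.

(** Markov's inequality on the event that at least half the expected number of facets is present,
    where dividing by their random number is harmless; [Ex_few_present] bounds the rest, including
    the event that no facet is present. *)
Lemma Ex_green_average (a e : R) : 0 < a -> 0 < e ->
  Ex (cell_prob d p) (fun c =>
    ((\sum_(i : cell_index) (present c i)%:R == 0 :> R) ||
     (e <= cabs ((\sum_(i : cell_index) (present c i)%:R)^-1%:C%C *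
        \sum_(i | present c i) G c i i - s))%R)%:R) <=
  4 * d%:R ^+ 2 / ((n - d.-1)%:R * k ^+ 2) + 2 / (e * k) * green_error a.
Proof.
move=> a0 e0; have /andP[f0 f1] := @facet_prob01 R n d p p01 d2 dn.
have N0 : 0 < N%:R :> R by rewrite ltr0n card_cell_index bin_gt0 ltnW.
have Nf : 0 < N%:R * facet_prob d p by rewrite mulr_gt0.
pose S c := \sum_(i | present c i) cabs (G c i i - s).
have S0 c : 0 <= S c by apply: sumr_ge0 => i _; exact: cabs_ge0.
pose few c := (\sum_(i : cell_index) (present c i)%:R < N%:R * facet_prob d p / 2)%R.
apply: (@le_trans _ _ (Ex (cell_prob d p) (fun c =>
    (few c)%:R + 2 / (e * (N%:R * facet_prob d p)) * S c))).
  apply: le_Ex => // c; rewrite /few; set M := \sum_i _.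
  have c0 : 0 <= 2 / (e * (N%:R * facet_prob d p)) by rewrite divr_ge0// mulr_ge0// ltW.
  have [_|many] := ltP M.
    by apply: (@le_trans _ _ 1); [case: (_ || _)|rewrite lerDl mulr_ge0].
  have M0 : 0 < M by rewrite (lt_le_trans _ many)// divr_gt0.
  rewrite add0r gt_eqF//=; case: (leP e) => [le_e|_]; last exact: mulr_ge0.
  have avg : cabs ((M^-1)%:C%C * \sum_(i | present c i) G c i i - s) <= M^-1 * S c.
    have -> : (M^-1)%:C%C * \sum_(i | present c i) G c i i - s =
      (M^-1)%:C%C * \sum_(i | present c i) (G c i i - s).
      rewrite sumrB mulrBr; congr (_ - _).
      have -> : \sum_(i : cell_index | present c i) s = M%:C%C * s.
        rewrite /M raddf_sum mulr_suml [LHS]big_mkcond; apply: eq_bigr => i _ /=.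
        by case: (present c i); rewrite ?rmorph1 ?rmorph0 ?mul1r ?mul0r.
      by rewrite mulrA -rmorphM mulVf ?gt_eqF// rmorph1 mul1r.
    rewrite cabsM cabs_real ger0_norm ?invr_ge0 ?(ltW M0)//.
    by rewrite ler_wpM2l ?invr_ge0 ?(ltW M0)// cabs_sum.
  have : e <= 2 / (N%:R * facet_prob d p) * S c.
    apply: le_trans le_e (le_trans avg _); rewrite ler_wpM2r//.
    by rewrite -[leRHS]invrK invf_div lef_pV2 ?posrE ?divr_gt0.
  rewrite -(ler_pM2l (x := e^-1)) ?invr_gt0// mulVf ?gt_eqF//.
  by move=> /le_trans; apply; rewrite le_eqVlt; apply/orP; left; apply/eqP; field; rewrite !gt_eqF.
rewrite ExD ExZ; apply: lerD.
  apply: le_trans (Ex_few_present p01 d2 dn) _.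
  rewrite ler_wpM2l ?mulr_ge0 ?sqr_ge0//.
  have nd : 0 < (n - d.-1)%:R :> R by rewrite ltr0n subn_gt0 (leq_ltn_trans (leq_pred _)).
  rewrite lef_pV2 ?posrE ?mulr_gt0 ?exprn_gt0// ler_wpM2l ?(ltW nd)//.
  by rewrite lerXn2r ?nnegrE ?(ltW k0) ?(ltW f0).
apply: le_trans (ler_wpM2l _ (Ex_green_error a0)) _.
  by rewrite divr_ge0// mulr_ge0// ltW.
have E0 : 0 <= green_error a.
  have : 0 <= N%:R * green_error a.
    by apply: le_trans (Ex_green_error a0); apply: Ex_ge0.
  by rewrite pmulr_rge0.
have -> : 2 / (e * (N%:R * facet_prob d p)) * (N%:R * green_error a) =
   2 / (e * facet_prob d p) * green_error a by field; rewrite !gt_eqF.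
rewrite ler_wpM2r// ler_wpM2l// lef_pV2 ?posrE ?mulr_gt0//.
by rewrite ler_wpM2l// ltW.
Qed.

End FixedSize.

From mathcomp Require unstable.
From mathcomp Require Import all_classical all_analysis.
From mathcomp Require Import measurable_realfun.
Import Order.TTheory GRing.Theory Num.Theory.
Import numFieldNormedType.Exports.

(** * The semicircle law *)

Section LawIntegrals.
Local Open Scope classical_set_scope.
Context {R : realType}.
Notation law := (probability (measurableTypeR R) R).

Lemma integrable_bounded_continuous (nu : law) (f : R -> R) :
  continuous f -> bounded_fun f -> nu.-integrable setT (EFin \o f).
Proof.
move=> fc fb; apply: measurable_bounded_integrable => //.
- by rewrite (le_lt_trans (probability_le1 nu measurableT))// ltry.
- exact: continuous_measurable_fun.
Qed.

Lemma norm_le_bounded_fun (f : R -> R) M : (forall x, `|f x| <= M) -> bounded_fun f.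
Proof.
move=> fM; exists M; split; first exact: num_real.
by move=> x Mx y _; apply: le_trans (fM y) (ltW Mx).
Qed.

End LawIntegrals.

Section SemicircleStieltjes.
Local Open Scope classical_set_scope.
Context {R : realType}.
Notation mu := (@lebesgue_measure R).
Notation law := (probability (measurableTypeR R) R).

Lemma semicircle_dom : (semicircle : set (measurableTypeR R) -> \bar R) `<< mu.
Proof.
apply/null_content_dominatesP => A mA muA0; rewrite /semicircle.
apply: null_set_integral => //.
by apply/measurable_EFinP; apply: measurable_funTS; exact: measurable_semicircle_pdf.
Qed.

(** [semicircle] is given as a set function; by uniqueness its Radon-Nikodym derivative agrees
    almost everywhere with the density. *)
Lemma integral_semicircle_pdf_mul (f : R -> R) : continuous f -> bounded_fun f ->
  (\int[semicircle]_x (f x)%:E = \int[mu]_x (f x * semicircle_pdf x)%:E)%E.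
Proof.
move=> fc fb.
have mpdf : measurable_fun setT (EFin \o (@semicircle_pdf R)).
  by apply/measurable_EFinP; exact: measurable_semicircle_pdf.
have mf : measurable_fun setT (EFin \o f).
  by apply/measurable_EFinP; exact: continuous_measurable_fun.
rewrite -(Radon_Nikodym_change_of_variables semicircle_dom)//=; last first.
  exact: integrable_bounded_continuous.
apply: ae_eq_integral => //.
- apply: emeasurable_funM => //; apply: (measurable_int mu).
  by apply: Radon_Nikodym_integrable; exact: semicircle_dom.
- by under eq_fun do rewrite EFinM; apply: emeasurable_funM.
- under [X in ae_eq _ _ _ X]eq_fun do rewrite EFinM.
  apply: ae_eqe_mul2l => /=.
  rewrite Radon_NikodymE//=; first exact: semicircle_dom.
  move=> ?; case: cid => /= h [h1 h2 h3].
  apply: integral_ae_eq => //=.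
  by move=> E _ mE; rewrite -h3.
Qed.


Lemma derive1_2sin : (fun t : R => 2 * sin t)^`() = (fun t => 2 * cos t).
Proof.
apply/funext => t; rewrite derive1E.
by have /@derive_val -> : is_derive t 1 (fun t : R => 2 * sin t) (2 * cos t)
  by apply: is_deriveZ.
Qed.

Let pihalf_lt : - (pi / 2) < pi / 2 :> R.
Proof. by rewrite gtrN// divr_gt0 ?pi_gt0. Qed.

Let continuous_2cos : continuous (fun t : R => 2 * cos t).
Proof. by move=> t; apply: cvgM; [exact: cvg_cst|exact: continuous_cos]. Qed.

Let continuous_2sin : continuous (fun t : R => 2 * sin t).
Proof. by move=> t; apply: cvgM; [exact: cvg_cst|exact: continuous_sin]. Qed.

(** The substitution x = 2 sin t turns the square root into 2 cos t, nonnegative on this interval,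
    and makes the density smooth up to the end points. *)
Lemma integral_semicircle_subst (f : R -> R) : continuous f -> bounded_fun f ->
  (\int[semicircle]_x (f x)%:E =
   \int[mu]_(t in `[(- (pi / 2))%R, (pi / 2)%R])
     (f (2 * sin t) * ((2 * pi)^-1 * (2 * cos t) ^+ 2))%:E)%E.
Proof.
move=> fc fb; rewrite integral_semicircle_pdf_mul//.
pose G (x : R) := f x * ((2 * pi)^-1 * Num.sqrt (4 - x ^+ 2)).
have Gc : continuous G.
  move=> x; apply: cvgM; first exact: fc.
  apply: cvgM; first exact: cvg_cst.
  apply: (@continuous_comp _ _ _ (fun s : R => 4 - s ^+ 2)).
    by apply: continuousB; [exact: cst_continuous|exact: exprn_continuous].
  exact: sqrt_continuous.
transitivity (\int[mu]_(x in `[(- 2)%R, 2%R]) (G x)%:E)%E.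
  rewrite [RHS]integral_mkcond; apply: eq_integral => x _.
  rewrite patchE /semicircle_pdf indicE /G.
  by case: ifPn => _; rewrite ?mulr1 ?mulr0.
have F2 : 2 * sin (pi / 2) = 2 :> R by rewrite sin_pihalf mulr1.
have FN2 : 2 * sin (- (pi / 2)) = - 2 :> R by rewrite sinN sin_pihalf mulrN1.
rewrite -[X in `[_, X]]F2 -[X in `[X, _]]FN2.
rewrite (@integration_by_substitution_increasing _ (fun t => 2 * sin t)).
- rewrite derive1_2sin; apply: eq_integral => t; rewrite inE/= in_itv/= => tpi.
  congr EFin; rewrite /G fctE/=.
  have -> : 4 - (2 * sin t) ^+ 2 = (2 * cos t) ^+ 2.
    by rewrite !exprMn cos2sin2 mulrBr mulr1 -natrX.
  rewrite sqrtr_sqr ger0_norm ?mulr_ge0 ?cos_ge0_pihalf// expr2.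
  by rewrite -!mulrA.
- exact: ltW.
- by move=> x y xI yI xy; rewrite ltr_pM2l// ltr_sin.
- by rewrite derive1_2sin => t _; exact: continuous_2cos.
- rewrite derive1_2sin; apply: cvgP; apply: cvg_at_right_filter.
  exact: continuous_2cos.
- rewrite derive1_2sin; apply: cvgP; apply: cvg_at_left_filter.
  exact: continuous_2cos.
- split.
  + by move=> t _; exact: derivableM.
  + by apply: cvg_at_right_filter; exact: continuous_2sin.
  + by apply: cvg_at_left_filter; exact: continuous_2sin.
- exact: continuous_subspaceT.
Qed.

Lemma integral_semicircle_odd (f : R -> R) : continuous f -> bounded_fun f ->
  (forall x, f (- x) = - f x) -> (\int[semicircle]_x (f x)%:E = 0)%E.
Proof.
move=> fc fb fodd; rewrite integral_semicircle_subst//.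
set G := fun t => f (2 * sin t) * ((2 * pi)^-1 * (2 * cos t) ^+ 2).
have Gc : continuous G.
  move=> t; apply: cvgM.
    by apply: (@continuous_comp _ _ _ (fun t : R => 2 * sin t) f); [exact: continuous_2sin|exact: fc].
  by apply: cvgM; [exact: cvg_cst|apply: cvgM; exact: continuous_2cos].
have Gi : mu.-integrable `[(- (pi / 2))%R, (pi / 2)%R] (EFin \o G).
  by apply: continuous_compact_integrable; [exact: segment_compact|exact: continuous_subspaceT].
have Gfin : (\int[mu]_(t in `[(- (pi / 2))%R, (pi / 2)%R]) (G t)%:E)%E \is a fin_num.
  exact: integrable_fin_num.
have IN : (\int[mu]_(t in `[(- (pi / 2))%R, (pi / 2)%R]) (G t)%:E =
    - \int[mu]_(t in `[(- (pi / 2))%R, (pi / 2)%R]) (G t)%:E)%E.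
  rewrite -[in RHS]integralN//; last exact: integrable_add_def.
  have := @integration_by_substitution_oppr R G (- (pi / 2)) (pi / 2).
  rewrite opprK => -> //; [|exact: ltW|exact: continuous_subspaceT].
  apply: eq_integral => t _; rewrite -EFinN /G/=.
  by rewrite sinN cosN mulrN fodd mulNr.
rewrite -/G; move: IN Gfin.
case: (\int[mu]_(t in _) (G t)%:E)%E => [r| |]//= [rr] _.
by congr EFin; lra.
Qed.

(** The value is Im s / eta, where s = i (sqrt(eta^2 + 4) - eta) / 2 is the Stieltjes transform of
    the semicircle law at i eta. *)
Lemma integral_semicircle_poisson (eta : R) : 0 < eta ->
  (\int[semicircle]_x ((x ^+ 2 + eta ^+ 2)^-1)%:E =
   ((Num.sqrt (eta ^+ 2 + 4) - eta) / (2 * eta))%:E)%E.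
Proof.
move=> eta0.
have e2 : 0 < eta ^+ 2 by rewrite exprn_gt0.
have den0 (x : R) : 0 < x ^+ 2 + eta ^+ 2 by rewrite ltr_wpDl ?sqr_ge0.
rewrite integral_semicircle_subst; first last.
- apply: (@norm_le_bounded_fun _ _ (eta ^- 2)) => x.
  rewrite ger0_norm ?invr_ge0 ?(ltW (den0 _))// lef_pV2 ?posrE//.
  by rewrite lerDr sqr_ge0.
- move=> x; apply: cvgV; first by rewrite gt_eqF.
  by apply: cvgD; [exact: exprn_continuous|exact: cvg_cst].
(* This c satisfies eta^2 (c^2 - 1) = 4, so that (2 sin t)^2 + eta^2 = eta^2 (cos^2 t + c^2 sin^2
   t), the denominator in the derivative of atan (c tan t). *)
have [c cE] : exists c : R, c = Num.sqrt (eta ^+ 2 + 4) / eta by eexists.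
have c2 : c ^+ 2 * eta ^+ 2 = eta ^+ 2 + 4.
  rewrite cE exprMn sqr_sqrtr ?addr_ge0 ?sqr_ge0// exprVn mulfVK ?gt_eqF//.
have c0 : 0 < c by rewrite cE divr_gt0// sqrtr_gt0 addr_gt0.
pose D (t : R) := cos t ^+ 2 + c * sin t ^+ 2.
have D0 t : 0 < D t.
  have := cos2Dsin2 t; have := sqr_ge0 (cos t); have := sqr_ge0 (sin t).
  rewrite /D => s0 co0 cs.
  have [s1|s1] := ltP 0 (sin t ^+ 2).
    by rewrite ltr_wpDl// mulr_gt0.
  by apply: ltr_pwDl; [lra|rewrite mulr_ge0 ?(ltW c0)].
pose H (t : R) := (c - 1) * (sin t * cos t) / D t.
(* the last summand is atan (c tan t) - t, in a form without poles *)
pose F (t : R) := (2 * pi)^-1 * (- t + c * (t + atan (H t))).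
have dH (t : R) : is_derive t 1 H (((c - 1) * (cos t ^+ 2 - sin t ^+ 2) * D t -
    (c - 1) * (sin t * cos t) * (2 * (c - 1) * (sin t * cos t))) / D t ^+ 2).
  have dD : is_derive t 1 D (2 * (c - 1) * (sin t * cos t)).
    by apply: is_derive_eq; rewrite /GRing.scale/=; ring.
  have dV : is_derive t 1 (fun t : R => (D t)^-1) (- (D t) ^- 2 *: (2 * (c - 1) * (sin t * cos t))).
    by apply: is_deriveV; rewrite gt_eqF.
  apply: is_derive_eq; rewrite /GRing.scale/=.
  by field; rewrite gt_eqF.
have dF (t : R) : is_derive t 1 F
    ((((2 * sin t) ^+ 2 + eta ^+ 2)^-1) * ((2 * pi)^-1 * (2 * cos t) ^+ 2)).
  have dA : is_derive t 1 (fun t : R => atan (H t)) ((1 + H t ^+ 2)^-1 *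
     (((c - 1) * (cos t ^+ 2 - sin t ^+ 2) * D t -
    (c - 1) * (sin t * cos t) * (2 * (c - 1) * (sin t * cos t))) / D t ^+ 2)).
    exact: is_derive1_comp.
  apply: is_derive_eq; rewrite /GRing.scale/=.
  have D0t := D0 t.
  have HE : 1 + H t ^+ 2 = (D t ^+ 2 + ((c - 1) * (sin t * cos t)) ^+ 2) / D t ^+ 2.
    by rewrite /H; field; rewrite gt_eqF.
  rewrite HE; have Dt : D t = cos t ^+ 2 + c * sin t ^+ 2 by [].
  have co2 : cos t ^+ 2 = 1 - sin t ^+ 2 by rewrite cos2sin2.
  have s20 := sqr_ge0 (sin t); have c20 := sqr_ge0 (cos t).
  have Q0 : 0 < cos t ^+ 2 + c ^+ 2 * sin t ^+ 2.
    by have := exprn_gt0 2 c0; nra.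
  have QE : D t ^+ 2 + ((c - 1) * (sin t * cos t)) ^+ 2 = cos t ^+ 2 + c ^+ 2 * sin t ^+ 2.
    by rewrite Dt !exprMn co2; ring.
  have NE : (c - 1) * (cos t ^+ 2 - sin t ^+ 2) * D t -
    (c - 1) * (sin t * cos t) * (2 * (c - 1) * (sin t * cos t)) =
    (c - 1) * (cos t ^+ 2 - c * sin t ^+ 2).
    transitivity ((c - 1) * (cos t ^+ 2 - sin t ^+ 2) * D t -
      2 * (c - 1) ^+ 2 * (sin t ^+ 2 * cos t ^+ 2)); first by ring.
    by rewrite Dt co2; ring.
  rewrite NE QE.
  have -> : (2 * sin t) ^+ 2 + eta ^+ 2 =
      eta ^+ 2 * (cos t ^+ 2 + c ^+ 2 * sin t ^+ 2).
    by rewrite mulrDr mulrA [eta ^+ 2 * c ^+ 2]mulrC c2 co2 exprMn; ring.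
  have -> : ((2 * cos t) ^+ 2) = (c ^+ 2 - 1) * eta ^+ 2 * cos t ^+ 2.
    by rewrite mulrBl c2 mul1r exprMn; ring.
  have -> : -1 + c * (1 + ((cos t ^+ 2 + c ^+ 2 * sin t ^+ 2) / D t ^+ 2)^-1 *
     ((c - 1) * (cos t ^+ 2 - c * sin t ^+ 2) / D t ^+ 2)) =
     (c ^+ 2 - 1) * cos t ^+ 2 / (cos t ^+ 2 + c ^+ 2 * sin t ^+ 2).
    by field; rewrite exprMn !gt_eqF.
  by move: (2 * pi)^-1 => u; field; rewrite -?exprMn ?gt_eqF ?exprMn ?gt_eqF.
rewrite (@continuous_FTC2 _ _ F)//.
- rewrite /F /H cos_pihalf cosN cos_pihalf !mulr0 !mul0r atan0 !addr0 -EFinB.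
  congr EFin; rewrite cE; have := @pi_gt0 R; move: (@pi R) => P P0; field.
  by rewrite !gt_eqF.
- apply: continuous_subspaceT => t; apply: cvgM.
    apply: cvgV; first by rewrite gt_eqF.
    by apply: cvgD; [apply: cvgM; exact: continuous_2sin|exact: cvg_cst].
  by apply: cvgM; [exact: cvg_cst|apply: cvgM; exact: continuous_2cos].
- have cF t : {for t, continuous F}.
    apply: differentiable_continuous; apply/derivable1_diffP.
    exact: ex_derive.
  split.
  + by move=> t _; exact: ex_derive.
  + by apply: cvg_at_right_filter; exact: cF.
  + by apply: cvg_at_left_filter; exact: cF.
- by move=> t _; rewrite derive1E derive_val.
Qed.

End SemicircleStieltjes.

(** * Weak convergence and Cauchy kernels *)

Section Weierstrass.
Local Open Scope classical_set_scope.
Context {R : realType}.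

Lemma unit_interval_unif_continuous (h : R -> R) : continuous h ->
  forall e : R, 0 < e -> exists2 r : R, 0 < r &
    forall x t : R, 0 <= x <= 1 -> `|x - t| < r -> `|h x - h t| < e.
Proof.
move=> hc e e0.
have /compact_near_coveringP : compact `[(0:R), (1:R)] by exact: segment_compact.
move=> /(_ R ((0 : R)^'+)
  (fun r x => forall t, `|x - t| < r -> `|h x - h t| < e) _) cov.
have : \forall r \near (0:R)^'+, `[(0:R), 1%R] `<=`
    (fun x => forall t, `|x - t| < r -> `|h x - h t| < e).
  apply: cov => x _.
  have /cvgrPdist_lt/(_ (e / 2)) := hc x; rewrite divr_gt0// => /(_ isT).
  move=> /nbhs_ballP[r /= r0 xr].
  exists (ball x (r / 2), [set s | 0 < s < r / 2]).
    split => /=; first by apply: nbhsx_ballx; rewrite divr_gt0.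
    near=> s; apply/andP; split; near: s; first exact: nbhs_right_gt.
    by apply: nbhs_right_lt; rewrite divr_gt0.
  move=> [y s]/= [xy /andP[s0 sr]] t yt.
  have h1 : `|h x - h y| < e / 2.
    apply: xr; rewrite /ball/= (lt_trans xy)// ltr_pdivrMr//; lra.
  have h2 : `|h x - h t| < e / 2.
    apply: xr; rewrite /ball/=.
    rewrite (_ : x - t = (x - y) + (y - t)); last by ring.
    rewrite (le_lt_trans (ler_normD _ _))//.
    rewrite (_ : r = r / 2 + r / 2); last by field.
    by rewrite ltrD// (lt_trans yt).
  rewrite (_ : h y - h t = - (h x - h y) + (h x - h t)); last by ring.
  rewrite (le_lt_trans (ler_normD _ _))// normrN.
  by rewrite [ltRHS](_ : e = e / 2 + e / 2) ?ltrD//; field.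
move=> near0.
have : \forall r \near (0:R)^'+, 0 < r /\ `[(0:R), 1%R] `<=`
    (fun x => forall t, `|x - t| < r -> `|h x - h t| < e).
  by near=> r; split; near: r => //; exact: nbhs_right_gt.
move=> /filter_ex[r [r0 hr]]; exists r => // x t x01; apply: hr.
by rewrite /= in_itv.
Unshelve. all: by end_near. Qed.

(** The mean of h at the success frequency of n tosses, with the success probability taken to be the
    indeterminate. *)
Definition bernstein (n : nat) (h : R -> R) : {poly R} :=
  Ex (fun=> 'X) (fun c : {ffun 'I_n -> bool} =>
    (h (n%:R^-1 * \sum_i (c i)%:R))%:P).

Lemma bernsteinE n h x : (bernstein n h).[x] =
  Ex (fun=> x) (fun c : {ffun 'I_n -> bool} => h (n%:R^-1 * \sum_i (c i)%:R)).
Proof.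
rewrite -horner_evalE /bernstein Ex_rmorph /Ex; apply: eq_bigr => c _.
congr (_ * _); last by rewrite /= horner_evalE hornerC.
by apply: eq_bigr => i _; rewrite /= horner_evalE hornerX.
Qed.

Lemma Ex_bernoulli_variance n (x : R) : 0 <= x <= 1 ->
  Ex (fun=> x) (fun c : {ffun 'I_n -> bool} => (\sum_i ((c i)%:R - x)) ^+ 2) <= n%:R.
Proof.
move=> x01.
have Ex2 i j : i != j -> Ex (fun=> x) (fun c : {ffun 'I_n -> bool} => (c i)%:R * (c j)%:R) = x * x.
  move=> ij; have := Ex_prod (fun=> x) [set i; j]%SET.
  rewrite big_setU1/= ?inE// big_set1 => E.
  rewrite -[RHS]E; apply: eq_Ex => c.
  by rewrite big_setU1/= ?inE// big_set1.
have Exi i : Ex (fun=> x) (fun c : {ffun 'I_n -> bool} => (c i)%:R) = x.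
  have := Ex_prod (fun=> x) [set i]%SET; rewrite big_set1 => E.
  by rewrite -[RHS]E; apply: eq_Ex => c; rewrite big_set1.
have := @Ex_sqr_sum_uncorrelated 'I_n 'I_n R (fun=> x) [set: 'I_n]%SET (fun=> 1)
  (fun i c => (c i)%:R - x) 1.
rewrite cardsT card_ord mulr1 => H.
rewrite (eq_Ex _ (g := fun c : {ffun 'I_n -> bool} =>
  1 * (\sum_(j in [set: 'I_n]%SET) ((c j)%:R - x)) ^+ 2)); last first.
  by move=> c; rewrite mul1r; congr (_ ^+ 2); apply: eq_bigl => i; rewrite inE.
apply: H => [i j _ _ ij|i _].
  transitivity (Ex (fun=> x) (fun c : {ffun 'I_n -> bool} =>
      (c i)%:R * (c j)%:R + ((- x) * (c i)%:R + ((- x) * (c j)%:R + x * x)))).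
    by apply: eq_Ex => c; ring.
  by rewrite !ExD !ExZ Ex_cst Ex2// !Exi; ring.
rewrite -[leRHS](Ex_cst (fun _ : 'I_n => x)); apply: le_Ex => // c; rewrite mul1r.
by have /andP[x0 x1] := x01; case: (c i) => /=; nra.
Qed.

Lemma unit_interval_bounded (h : R -> R) : continuous h ->
  exists M : R, forall x : R, 0 <= x <= 1 -> `|h x| <= M.
Proof.
move=> hc; have /compact_bounded[M [_ MP]] : compact (h @` `[(0:R), 1%R]).
  by apply: continuous_compact; [exact: continuous_subspaceT|exact: segment_compact].
exists (M + 1) => x x01; apply: (MP (M + 1)); first by rewrite ltrDl.
by exists x => //=; rewrite in_itv.
Qed.

(** Bernstein's proof: |h x - h t| <= e/2 + C (x - t)^2 holds for close points by uniform continuity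
    and for distant points by boundedness. Taking means over t, the square becomes a variance of at
    most 1/n. *)
Lemma weierstrass_approximation (h : R -> R) : continuous h ->
  forall e : R, 0 < e -> exists P : {poly R},
    forall x : R, 0 <= x <= 1 -> `|h x - P.[x]| <= e.
Proof.
move=> hc e e0.
have [r r0 hr] := unit_interval_unif_continuous hc (divr_gt0 e0 (ltr0n _ 2)).
have [M hM] := unit_interval_bounded hc.
have M0 : 0 <= M by rewrite (le_trans _ (hM 0 _))// lexx ler01.
pose C := 2 * M / r ^+ 2.
have C0 : 0 <= C by rewrite /C divr_ge0 ?sqr_ge0 ?mulr_ge0.
have hxt x t : 0 <= x <= 1 -> 0 <= t <= 1 -> `|h x - h t| <= e / 2 + C * (x - t) ^+ 2.
  move=> x01 t01; have [xt|xt] := ltP `|x - t| r.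
    by rewrite (le_trans (ltW (hr _ _ x01 xt)))// lerDl mulr_ge0 ?sqr_ge0.
  apply: (@le_trans _ _ (2 * M)).
    rewrite (le_trans (ler_normB _ _))//.
    by have := hM x x01; have := hM t t01; lra.
  apply: (@le_trans _ _ (C * (x - t) ^+ 2)); last by rewrite lerDr divr_ge0// ltW.
  rewrite /C mulrAC ler_pdivlMr ?exprn_gt0// ler_wpM2l ?mulr_ge0//.
  by rewrite -[leRHS]real_normK ?num_real// lerXn2r ?nnegrE ?(ltW r0).
(* Chosen so that the variance term C/n is at most the remaining e/2. *)
pose n := (Num.truncn (2 * C / e)).+1.
have n0 : (0 : R) < n%:R by rewrite ltr0n.
have nC : C / n%:R <= e / 2.
  have : 2 * C / e < n%:R by apply: truncnS_gt.
  rewrite ltr_pdivrMr// ler_pdivrMr// => ?; lra.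
exists (bernstein n h) => x x01; rewrite bernsteinE.
have p01 (i : 'I_n) : 0 <= x <= 1 by [].
pose avg (c : {ffun 'I_n -> bool}) : R := n%:R^-1 * \sum_i (c i)%:R.
have avg01 c : 0 <= avg c <= 1.
  rewrite /avg mulr_ge0 ?invr_ge0 ?sumr_ge0//= ler_pdivrMl// mulr1.
  rewrite -[leRHS](_ : \sum_(i < n) 1 = _) ?ler_sum// ?sumr_const ?card_ord//.
  by move=> i _; case: (c i).
have key c : `|h x - h (avg c)| <=
    e / 2 + C / n%:R ^+ 2 * (\sum_i ((c i)%:R - x)) ^+ 2.
  rewrite (le_trans (hxt _ _ x01 (avg01 c)))// lerD2l.
  have -> : x - avg c = - (n%:R^-1 * \sum_i ((c i)%:R - x)).
    rewrite sumrB sumr_const card_ord mulrBr -[x *+ n]mulr_natl mulKf ?gt_eqF//.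
    by rewrite opprB.
  by rewrite sqrrN exprMn exprVn mulrA.
rewrite -[h x](Ex_cst (fun _ : 'I_n => x)) -ExB; apply: (@le_trans _ _ (Ex (fun=> x)
    (fun c : {ffun 'I_n -> bool} => e / 2 + C / n%:R ^+ 2 * (\sum_i ((c i)%:R - x)) ^+ 2))).
  rewrite ler_norml -ExN; apply/andP; split; apply: le_Ex => // c.
    by have /ler_normlP[] := key c; rewrite lerNl.
  by have /ler_normlP[] := key c.
rewrite ExD Ex_cst ExZ.
have : C / n%:R ^+ 2 * Ex (fun=> x) (fun c : {ffun 'I_n -> bool} => (\sum_i ((c i)%:R - x)) ^+ 2) <= C / n%:R.
  apply: le_trans (ler_wpM2l _ (Ex_bernoulli_variance n x01)) _.
    by rewrite divr_ge0 ?exprn_ge0.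
  by rewrite expr2 invfM -!mulrA mulVf ?mulr1// gt_eqF.
move=> /le_trans/(_ nC) hE.
by rewrite [leRHS](splitr e) lerD2l.
Qed.

End Weierstrass.

(** * Means of bounded continuous functions *)

Section BoundedContinuous.
Local Open Scope classical_set_scope.
Context {R : realType}.
Notation law := (probability (measurableTypeR R) R).
Implicit Types (f g : R -> R) (nu : law).

Definition bcont f : Prop :=
  continuous f /\ exists M : R, forall x, `|f x| <= M.

Lemma bcont_cst a : bcont (fun=> a).
Proof. by split; [move=> x; exact: cvg_cst|exists `|a|]. Qed.

Lemma bcontD f g : bcont f -> bcont g -> bcont (fun x => f x + g x).
Proof.
move=> [fc [M fM]] [gc [M' gM]]; split; first by move=> x; apply: cvgD; [exact: fc|exact: gc].
by exists (M + M') => x; rewrite (le_trans (ler_normD _ _))// lerD.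
Qed.

Lemma bcontM f g : bcont f -> bcont g -> bcont (fun x => f x * g x).
Proof.
move=> [fc [M fM]] [gc [M' gM]]; split; first by move=> x; apply: cvgM; [exact: fc|exact: gc].
by exists (M * M') => x; rewrite normrM ler_pM.
Qed.

Lemma bcontZ a f : bcont f -> bcont (fun x => a * f x).
Proof. exact/bcontM/bcont_cst. Qed.

Definition mean nu f : R := (\int[nu]_x f x)%R.

Lemma bcont_integrable nu f : bcont f -> nu.-integrable setT (EFin \o f).
Proof.
move=> [fc [M fM]]; have fb := norm_le_bounded_fun fM.
exact: integrable_bounded_continuous.
Qed.

Lemma integral_mean nu f : bcont f -> (\int[nu]_x (f x)%:E = (mean nu f)%:E)%E.
Proof.
by move=> fb; rewrite fineK//; apply: integrable_fin_num => //; exact: bcont_integrable.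
Qed.

Lemma meanD nu f g : bcont f -> bcont g ->
  mean nu (fun x => f x + g x) = mean nu f + mean nu g.
Proof. by move=> fb gb; rewrite /mean RintegralD//; exact: bcont_integrable. Qed.

Lemma meanB nu f g : bcont f -> bcont g ->
  mean nu (fun x => f x - g x) = mean nu f - mean nu g.
Proof. by move=> fb gb; rewrite /mean RintegralB//; exact: bcont_integrable. Qed.

Lemma meanZ nu a f : bcont f -> mean nu (fun x => a * f x) = a * mean nu f.
Proof. by move=> fb; rewrite /mean RintegralZl//; exact: bcont_integrable. Qed.

Lemma mean_cst nu a : mean nu (fun=> a) = a.
Proof.
have nu1 : fine (nu setT) = 1 := congr1 fine (probability_setT nu).
by rewrite -[RHS]mulr1 -nu1; exact: Rintegral_cst.
Qed.

Lemma le_mean nu f g : bcont f -> bcont g -> (forall x, f x <= g x) ->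
  mean nu f <= mean nu g.
Proof.
by move=> fb gb fg; apply: le_Rintegral => //; exact: bcont_integrable.
Qed.

Lemma mean_close nu f g e : bcont f -> bcont g ->
  (forall x, `|f x - g x| <= e) -> `|mean nu f - mean nu g| <= e.
Proof.
move=> fb gb fg.
have fgb : bcont (fun x => f x - g x).
  have -> : (fun x => f x - g x) = (fun x => f x + (-1) * g x).
    by apply/funext => x; rewrite mulN1r.
  by apply: bcontD => //; exact: bcontZ.
rewrite -meanB// ler_norml -{1}(mean_cst nu (- e)) -{2}(mean_cst nu e).
by apply/andP; split; apply: le_mean => //; try exact: bcont_cst;
  move=> x; have := fg x; rewrite ler_norml => /andP[].
Qed.

End BoundedContinuous.

Section ConvergenceClass.
Local Open Scope classical_set_scope.
Context {R : realType}.
Notation law := (probability (measurableTypeR R) R).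
Variables (nu_ : nat -> law) (nu : law).
Implicit Types (f g : R -> R).

(** These functions form a vector space closed under uniform limits, so the kernels can be enlarged
    step by step to all bounded continuous functions. *)
Definition cvg_test f : Prop :=
  bcont f /\ (mean (nu_ n) f @[n --> \oo] --> mean nu f).
Local Notation S := cvg_test.

Lemma cvg_test_cst a : S (fun=> a).
Proof.
split; first exact: bcont_cst.
by under eq_fun do rewrite mean_cst; rewrite mean_cst; exact: cvg_cst.
Qed.

Lemma cvg_testD f g : S f -> S g -> S (fun x => f x + g x).
Proof.
move=> [fb fS] [gb gS]; split; first exact: bcontD.
by under eq_fun do rewrite meanD//; rewrite meanD//; exact: cvgD.
Qed.

Lemma cvg_testZ a f : S f -> S (fun x => a * f x).
Proof.
move=> [fb fS]; split; first exact: bcontZ.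
by under eq_fun do rewrite meanZ//; rewrite meanZ//; apply: cvgM => //; exact: cvg_cst.
Qed.

Lemma cvg_test_sum n (F : nat -> R -> R) : (forall i, (i < n)%N -> S (F i)) ->
  S (fun x => \sum_(i < n) F i x).
Proof.
elim: n => [|n IH] SF.
  by under eq_fun do rewrite big_ord0; exact: cvg_test_cst.
under eq_fun do rewrite big_ord_recr/=.
by apply: cvg_testD; [apply: IH => i ni; apply: SF; exact: ltnW|exact: SF].
Qed.

Lemma cvg_test_unif f : bcont f ->
  (forall e : R, 0 < e -> exists2 g, S g & forall x, `|f x - g x| <= e) -> S f.
Proof.
move=> fb fg; split => //; apply/cvgrPdist_le => e e0.
have [g [gb gS] fge] := fg (e / 3) (divr_gt0 e0 (ltr0n _ 3)).
have /cvgrPdist_le/(_ (e / 3) (divr_gt0 e0 (ltr0n _ 3))) := gS.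
apply: filterS => n gn.
have h1 := mean_close (nu_ n) fb gb fge.
have h2 := mean_close nu fb gb fge.
rewrite (_ : mean nu f - mean (nu_ n) f = (mean nu f - mean nu g) +
  (mean nu g - mean (nu_ n) g) - (mean (nu_ n) f - mean (nu_ n) g)); last by ring.
rewrite (le_trans (ler_normB _ _))//.
have := ler_normD (mean nu f - mean nu g) (mean nu g - mean (nu_ n) g).
lra.
Qed.

Variable a0 : R.
Hypothesis a0_gt0 : 0 < a0.

(** The values of eta^2 at which kernels are tested. They are distinct, for partial fractions, and
    accumulate at [a0], so that powers of the kernel at [a0] are reached in the limit. *)
Definition pole k : R := a0 + k.+1%:R^-1.
Definition cauchy_kernel (a x : R) : R := (x ^+ 2 + a)^-1.
Local Notation y := cauchy_kernel.

Lemma cauchy_kernel_gt0 a x : 0 < a -> 0 < y a x.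
Proof. by move=> a_gt0; rewrite invr_gt0 ltr_wpDl ?sqr_ge0. Qed.

Lemma cauchy_kernel_le a x : 0 < a -> y a x <= a^-1.
Proof.
by move=> a_gt0; rewrite lef_pV2 ?posrE ?ltr_wpDl ?sqr_ge0// lerDr sqr_ge0.
Qed.

Lemma cauchy_kernelK a x : 0 < a -> y a x * (x ^+ 2 + a) = 1.
Proof. by move=> a_gt0; rewrite mulVf// gt_eqF// ltr_wpDl ?sqr_ge0. Qed.

Lemma continuous_cauchy_kernel a : 0 < a -> continuous (y a).
Proof.
move=> a_gt0 x; apply: cvgV; first by rewrite gt_eqF// ltr_wpDl ?sqr_ge0.
by apply: cvgD; [exact: exprn_continuous|exact: cvg_cst].
Qed.

Lemma bcont_cauchy_kernel a : 0 < a -> bcont (y a).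
Proof.
move=> a_gt0; split; first exact: continuous_cauchy_kernel.
exists a^-1 => x; rewrite ger0_norm; last exact/ltW/cauchy_kernel_gt0.
exact: cauchy_kernel_le.
Qed.

Lemma bcont_id_cauchy_kernel a : 0 < a -> bcont (fun x => x * y a x).
Proof.
move=> a_gt0; split.
  by move=> x; apply: cvgM; [exact: cvg_id|exact: continuous_cauchy_kernel].
exists (a^-1 + 1) => x; rewrite normrM [X in _ * X]ger0_norm; last exact/ltW/cauchy_kernel_gt0.
rewrite -(ler_pM2r (x := x ^+ 2 + a)) ?ltr_wpDl ?sqr_ge0//.
rewrite -mulrA cauchy_kernelK// mulr1 mulrDl mul1r mulrDr mulVf ?gt_eqF//.
have := sqr_ge0 (`|x| - 1); rewrite sqrrB real_normK ?num_real// mulr1 expr1n => h.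
have : 0 <= a^-1 * x ^+ 2 by rewrite mulr_ge0 ?invr_ge0 ?sqr_ge0// ltW.
have := sqr_ge0 x; have := normr_ge0 x; nra.
Qed.

Lemma pole_gt0 k : 0 < pole k.
Proof. by rewrite addr_gt0 ?invr_gt0. Qed.

Section Powers.
Variable phi : R -> R.
Hypothesis phi_y : bcont (fun x => phi x * y a0 x).
Hypothesis S_phi : forall k, S (fun x => phi x * y (pole k) x).

(* Partial fractions: for a <> b, y a * y b = (y a - y b) / (b - a). *)
Lemma cvg_test_prod_poles k (s : seq nat) : uniq (k :: s) ->
  S (fun x => phi x * \prod_(i <- k :: s) y (pole i) x).
Proof.
have [n] := ubnP (size s); elim: n s k => // n IH [|l s] k /=.
  by move=> _ _; under eq_fun do rewrite big_seq1; exact: S_phi.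
rewrite ltnS => sn; rewrite inE negb_or => /andP[/andP[kl ks] /andP[ls us]].
have dif : pole l - pole k != 0.
  rewrite /pole opprD addrACA subrr add0r subr_eq0 (inj_eq invr_inj) eqr_nat.
  by rewrite eqSS eq_sym.
have -> : (fun x => phi x * \prod_(i <- [:: k, l & s]) y (pole i) x) =
  (fun x => (pole l - pole k)^-1 * (phi x * \prod_(i <- k :: s) y (pole i) x +
    (-1) * (phi x * \prod_(i <- l :: s) y (pole i) x))).
  apply/funext => x; rewrite !big_cons; set r := \prod_(i <- s) _.
  have yE : y (pole k) x * y (pole l) x =
      (pole l - pole k)^-1 * (y (pole k) x - y (pole l) x).
    rewrite /y; field.
    by rewrite dif !gt_eqF// ltr_wpDl ?sqr_ge0 ?pole_gt0.
  transitivity (phi x * r * (y (pole k) x * y (pole l) x)); first by ring.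
  by rewrite yE; ring.
apply: cvg_testZ; apply: cvg_testD; first by apply: IH => //=; rewrite ks.
by apply: cvg_testZ; apply: IH => //=; rewrite ls.
Qed.

(** The factors are exchanged one at a time, each at relative cost at most a0^-1/(l+1). The error is
    kept proportional to the power of the kernel, so that it stays bounded after multiplication by
    the unbounded function [phi x = x]. *)
Lemma prod_poles_close n l x :
  `|y a0 x ^+ n - \prod_(i < n) y (pole (l + i)) x| <=
  n%:R * (a0^-1 * l.+1%:R^-1) * y a0 x ^+ n.
Proof.
have y0 := cauchy_kernel_gt0 x a0_gt0.
have ygt i : 0 <= y (pole i) x by apply/ltW/cauchy_kernel_gt0/pole_gt0.
have yle i : y (pole i) x <= y a0 x.
  have Bx : 0 < x ^+ 2 + pole i by rewrite ltr_wpDl ?sqr_ge0 ?pole_gt0.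
  have Ax : 0 < x ^+ 2 + a0 by rewrite ltr_wpDl ?sqr_ge0.
  by rewrite /cauchy_kernel lef_pV2 ?posrE// lerD2l lerDl invr_ge0.
have yB i : y a0 x - y (pole (l + i)) x <= a0^-1 * l.+1%:R^-1 * y a0 x.
  have -> : y a0 x - y (pole (l + i)) x = y (pole (l + i)) x * (l + i).+1%:R^-1 * y a0 x.
    have := pole_gt0 (l + i); rewrite /cauchy_kernel /pole; set u := _^-1 => u0.
    by field; rewrite !gt_eqF// -?addrA ltr_wpDl ?sqr_ge0.
  rewrite ler_wpM2r ?(ltW y0)//; apply: ler_pM; rewrite ?ygt ?[0 <= _^-1]invr_ge0//.
    exact: le_trans (yle _) (cauchy_kernel_le _ a0_gt0).
  by rewrite lef_pV2 ?posrE// ler_nat ltnS leq_addr.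
elim: n => [|n IH]; first by rewrite big_ord0 expr0 subrr normr0 !mul0r.
rewrite big_ord_recr/= exprSr.
set P := \prod_(i < n) _ in IH *; set z := y (pole _) x.
have P0 : 0 <= P by apply: prodr_ge0.
have PY : P <= y a0 x ^+ n.
  rewrite /P -[n in X in _ <= X]card_ord -prodr_const.
  by apply: ler_prod => i _; rewrite ygt yle.
rewrite (_ : _ - _ = (y a0 x ^+ n - P) * y a0 x + P * (y a0 x - z)); last by ring.
rewrite (le_trans (ler_normD _ _))//.
set q := a0^-1 * _ in yB IH *.
have -> : n.+1%:R * q * (y a0 x ^+ n * y a0 x) =
    n%:R * q * y a0 x ^+ n * y a0 x + y a0 x ^+ n * (q * y a0 x).
  by rewrite -[n.+1%:R]natr1; ring.
apply: lerD.
  by rewrite normrM [X in _ * X]ger0_norm ?(ltW y0)// ler_wpM2r// ltW.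
rewrite ger0_norm; last by rewrite mulr_ge0// subr_ge0 yle.
apply: ler_pM; [exact: P0|by rewrite subr_ge0 yle|exact: PY|exact: yB].
Qed.

(** Products over n + 1 consecutive distinct poles, taken far out in the sequence, approximate the
    power uniformly. *)
Lemma cvg_test_powers n : S (fun x => phi x * y a0 x ^+ n.+1).
Proof.
have ybn m : bcont (fun x => y a0 x ^+ m).
  elim: m => [|m IH]; first by under eq_fun do rewrite expr0; exact: bcont_cst.
  by under eq_fun do rewrite exprS; apply: bcontM => //; exact: bcont_cauchy_kernel.
have fb : bcont (fun x => phi x * y a0 x ^+ n.+1).
  by under eq_fun do rewrite exprS mulrA; exact: bcontM.
apply: cvg_test_unif => // e e0.
have [_ [M fM]] := fb.
have M0 : 0 <= M by rewrite (le_trans _ (fM 0)).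
pose C := n.+1%:R * a0^-1 * (M + 1).
have C0 : 0 < C by rewrite !mulr_gt0 ?invr_gt0// ltr_wpDl.
pose l := Num.truncn (C / e).
have lC : C * l.+1%:R^-1 <= e.
  by rewrite ler_pdivrMr// -ler_pdivrMl// mulrC ltW// truncnS_gt.
exists (fun x => phi x * \prod_(i < n.+1) y (pole (l + i)) x).
  have := @cvg_test_prod_poles l [seq l + i.+1 | i <- iota 0 n]%N.
  have -> : (l :: [seq l + i.+1 | i <- iota 0 n])%N = [seq l + i | i <- iota 0 n.+1]%N.
    rewrite /= addn0; congr (_ :: _).
    by rewrite -[1%N]addn0 iotaDl -map_comp; apply: eq_map => i /=; rewrite add1n.
  have -> : uniq [seq (l + i)%N | i <- iota 0 n.+1].
    by rewrite map_inj_uniq ?iota_uniq// => i j /addnI.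
  move=> /(_ isT); congr S; apply/funext => x; congr (_ * _).
  by rewrite big_map -[iota 0 n.+1]/(index_iota 0 n.+1) big_mkord.
move=> x; rewrite -mulrBr normrM.
apply: le_trans (ler_wpM2l (normr_ge0 _) (prod_poles_close _ _ _)) _.
rewrite mulrCA.
have -> : `|phi x| * y a0 x ^+ n.+1 = `|phi x * y a0 x ^+ n.+1|.
  by rewrite normrM (ger0_norm (exprn_ge0 _ (ltW (cauchy_kernel_gt0 x a0_gt0)))).
apply: le_trans lC; rewrite mulrA mulrAC /C ler_wpM2r ?invr_ge0//.
by rewrite ler_wpM2l ?mulr_ge0 ?invr_ge0 ?(ltW a0_gt0)// (le_trans (fM x))// lerDl.
Qed.

Lemma cvg_test_poly (P : {poly R}) : S (fun x => phi x * y a0 x * P.[y a0 x]).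
Proof.
under eq_fun do rewrite horner_coef mulr_sumr.
apply: (@cvg_test_sum _ (fun i x => phi x * y a0 x * (P`_i * y a0 x ^+ i))) => i _.
have -> : (fun x => phi x * y a0 x * (P`_i * y a0 x ^+ i)) =
    (fun x => P`_i * (phi x * y a0 x ^+ i.+1)).
  by apply/funext => x; rewrite exprS; ring.
by apply: cvg_testZ; exact: cvg_test_powers.
Qed.

End Powers.
End ConvergenceClass.

(** * From Cauchy kernels to all bounded continuous functions *)

Section CauchyKernelsDetermine.
Local Open Scope classical_set_scope.
Context {R : realType}.
Notation law := (probability (measurableTypeR R) R).
Variables (nu_ : nat -> law) (nu : law) (a0 : R).
Hypothesis a0_ge1 : 1 <= a0.
Local Notation S := (cvg_test nu_ nu).
Local Notation y := (cauchy_kernel a0).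
Implicit Types (f : R -> R).

Let a0_gt0 : 0 < a0. Proof. exact: lt_le_trans a0_ge1. Qed.

(** The kernel tends to 0 at infinity, so for t > 0 this has compact support; being a function of
    [y x], it is accessible to polynomials in the kernel. *)
Definition cutoff (t x : R) : R := Num.max 0 (y x - t).

Lemma y01 x : 0 <= y x <= 1.
Proof.
rewrite (ltW (cauchy_kernel_gt0 _ _))//= (le_trans (cauchy_kernel_le x a0_gt0))//.
by rewrite invf_le1.
Qed.

Lemma cutoff_ge0 t x : 0 <= cutoff t x.
Proof. by rewrite /cutoff le_max lexx. Qed.

Lemma cutoff_le1 t x : 0 <= t -> cutoff t x <= 1.
Proof.
move=> t0; rewrite /cutoff ge_max ler01/=.
by have /andP[_ y1] := y01 x; rewrite lerBlDr (le_trans y1)// lerDl.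
Qed.

Lemma continuous_cutoff t : continuous (cutoff t).
Proof.
move=> x; apply: (@continuous_max R R (fun=> 0) (fun x => y x - t) x).
  exact: cvg_cst.
by apply: cvgB; [exact: continuous_cauchy_kernel|exact: cvg_cst].
Qed.

Section Even.
Variable phi : R -> R.
Hypothesis phi_y : bcont (fun x => phi x * y x).
Hypothesis S_phi : forall k, S (fun x => phi x * cauchy_kernel (pole a0 k) x).

(** An even function localized by the cutoff is a continuous function of u = y(x), because |x| =
    sqrt(1/u - a0). Weierstrass approximation in u on [0,1] then reduces it to polynomials in the
    kernel. *)
Lemma cvg_test_even (E : R -> R) t : continuous E -> (forall x, E (- x) = E x) ->
  0 < t -> S (fun x => phi x * y x * (E x * cutoff t x)).
Proof.
move=> Ec Eeven t0.
(* [Num.max u t] keeps the inverse continuous at u = 0 and changes nothing in the product, whose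
   second factor vanishes for u <= t. *)
pose h (u : R) := E (Num.sqrt ((Num.max u t)^-1 - a0)) * Num.max 0 (u - t).
have hc : continuous h.
  have mc : continuous (fun u : R => Num.max u t).
    by move=> u; apply: (@continuous_max R R id (fun=> t) u); [exact: cvg_id|exact: cvg_cst].
  move=> u; apply: cvgM.
    apply: (@continuous_comp _ _ _ (fun u : R => Num.sqrt ((Num.max u t)^-1 - a0)) E); last exact: Ec.
    apply: (@continuous_comp _ _ _ (fun u : R => (Num.max u t)^-1 - a0) Num.sqrt); last exact: sqrt_continuous.
    apply: cvgB; last exact: cvg_cst.
    by apply: cvgV; [rewrite gt_eqF// lt_max t0 orbT|exact: mc].
  apply: (@continuous_max R R (fun=> 0) (fun u => u - t) u); first exact: cvg_cst.
  by apply: cvgB; [exact: cvg_id|exact: cvg_cst].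
have hE x : E x * cutoff t x = h (y x).
  rewrite /h /cutoff; have [yt|ty] := leP (y x) t.
    by rewrite max_l ?mulr0// subr_le0.
  congr (_ * _); rewrite /cauchy_kernel invrK addrK sqrtr_sqr.
  by have [|] := ler0P x; rewrite ?Eeven.
have [M hM] := unit_interval_bounded hc.
have [_ [M' yM']] := phi_y.
have M'0 : 0 <= M' by rewrite (le_trans _ (yM' 0)).
have hb : bcont (fun x => E x * cutoff t x).
  split; first by move=> x; apply: cvgM; [exact: Ec|exact: continuous_cutoff].
  by exists M => x; rewrite hE hM// y01.
apply: cvg_test_unif => [|e e0]; first exact: bcontM.
have e1 : 0 < e / (M' + 1) by rewrite divr_gt0// ltr_wpDl.
have [P hP] := weierstrass_approximation hc e1.
exists (fun x => phi x * y x * P.[y x]); first exact: cvg_test_poly.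
move=> x; rewrite hE -mulrBr normrM.
apply: (@le_trans _ _ (M' * (e / (M' + 1)))); first by rewrite ler_pM// hP// y01.
by rewrite mulrCA -[leRHS]mulr1 ler_wpM2l ?(ltW e0)// ler_pdivrMr ?ltr_wpDl// mul1r lerDl.
Qed.

End Even.

Hypothesis S_pole : forall k, S (cauchy_kernel (pole a0 k)).
Hypothesis S_id_pole : forall k, S (fun x => x * cauchy_kernel (pole a0 k) x).

(** The even part of f is handled with [phi = 1], the odd part with [phi = x]. Dividing the odd part
    by x may be discontinuous at 0, so 1/x is replaced by x/(x^2 + D), with an error small uniformly
    in x. *)
Lemma cvg_test_cutoff f t : bcont f -> 0 < t -> S (fun x => f x * cutoff t x).
Proof.
move=> [fc [M fM]] t0.
have fNc : continuous (fun x => f (- x)).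
  by move=> x; apply: (@continuous_comp _ _ _ (@GRing.opp R) f); [exact: opp_continuous|exact: fc].
pose fe x := 2^-1 * (f x + f (- x)); pose fo x := 2^-1 * (f x - f (- x)).
have fec : continuous fe by move=> x; apply: cvgM; [exact: cvg_cst|apply: cvgD; [exact: fc|exact: fNc]].
have foc : continuous fo by move=> x; apply: cvgM; [exact: cvg_cst|apply: cvgB; [exact: fc|exact: fNc]].
have sqc (a : R) : continuous (fun x : R => x ^+ 2 + a).
  by move=> x; apply: cvgD; [exact: exprn_continuous|exact: cvg_cst].
have -> : (fun x => f x * cutoff t x) =
    (fun x => fe x * cutoff t x + fo x * cutoff t x).
  by apply/funext => x; rewrite /fe /fo; field.
apply: cvg_testD.
  have := @cvg_test_even (fun=> 1) _ _ (fun x => (x ^+ 2 + a0) * fe x) t.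
  have -> : (fun x => 1 * y x * ((x ^+ 2 + a0) * fe x * cutoff t x)) =
      (fun x => fe x * cutoff t x).
    by apply/funext => x; rewrite mul1r !mulrA cauchy_kernelK// mul1r.
  apply => //.
  - by under eq_fun do rewrite mul1r; exact: bcont_cauchy_kernel.
  - by move=> k; under eq_fun do rewrite mul1r; exact: S_pole.
  - by move=> x; apply: cvgM; [exact: sqc|exact: fec].
  - by move=> x; rewrite /fe sqrrN opprK [f (- x) + _]addrC.
have M0 : 0 <= M by rewrite (le_trans _ (fM 0)).
have foM x : `|fo x| <= M.
  rewrite normrM ger0_norm ?invr_ge0// ler_pdivrMl//.
  rewrite (le_trans (ler_normB _ _))//; have := fM x; have := fM (- x); lra.
have fob : bcont fo by split => //; exists M.
have cb : bcont (cutoff t).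
  split; first exact: continuous_cutoff.
  by exists 1 => x; rewrite ger0_norm ?cutoff_ge0// cutoff_le1// ltW.
apply: cvg_test_unif => [|e e0]; first exact: bcontM.
have fo0 : fo 0 = 0 by rewrite /fo oppr0 subrr mulr0.
have /cvgrPdist_lt/(_ e e0)/nbhs_ballP[r /= r0 hr] := foc 0.
(* The error carries the factor D/(x^2 + D). For |x| < r the odd part itself is below e; for |x| >=
   r the error is at most M D/r^2 = e M/(M+1). *)
have [D DE] : exists D, D = e * r ^+ 2 / (M + 1) by eexists.
have D0 : 0 < D by rewrite DE divr_gt0 ?mulr_gt0 ?exprn_gt0// ltr_wpDl.
exists (fun x => x * y x * (fo x * x * (x ^+ 2 + a0) / (x ^+ 2 + D) * cutoff t x)).
  apply: cvg_test_even => //.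
  - exact: bcont_id_cauchy_kernel.
  - move=> x; apply: cvgM.
      by apply: cvgM; [apply: cvgM; [exact: foc|exact: cvg_id]|exact: sqc].
    by apply: cvgV; [rewrite gt_eqF// ltr_wpDl ?sqr_ge0|exact: sqc].
  - move=> x; rewrite /fo !sqrrN opprK; congr (_ / _); ring.
move=> x.
have xD : 0 < x ^+ 2 + D by rewrite ltr_wpDl ?sqr_ge0.
have -> : fo x * cutoff t x -
    x * y x * (fo x * x * (x ^+ 2 + a0) / (x ^+ 2 + D) * cutoff t x) =
    fo x * (D / (x ^+ 2 + D)) * cutoff t x.
  have -> : x * y x * (fo x * x * (x ^+ 2 + a0) / (x ^+ 2 + D) * cutoff t x) =
    (y x * (x ^+ 2 + a0)) * (fo x * (x ^+ 2 / (x ^+ 2 + D)) * cutoff t x) by ring.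
  by rewrite cauchy_kernelK//; field; rewrite gt_eqF.
rewrite normrM -[leRHS]mulr1 ler_pM//; last first.
  by rewrite ger0_norm ?cutoff_ge0// cutoff_le1// ltW.
rewrite normrM [X in _ * X]ger0_norm ?divr_ge0 ?(ltW D0) ?(ltW xD)//.
have [xr|rx] := ltP `|x| r.
  have : `|fo x| < e.
    by have := hr x; rewrite /ball/= sub0r normrN => /(_ xr); rewrite fo0 sub0r normrN.
  move=> foe; rewrite -[leRHS]mulr1 ler_pM ?divr_ge0 ?(ltW D0) ?(ltW xD) ?(ltW foe)//.
  by rewrite ler_pdivrMr// mul1r lerDr sqr_ge0.
apply: (@le_trans _ _ (M * (D / r ^+ 2))).
  rewrite ler_pM ?divr_ge0 ?(ltW D0) ?(ltW xD)// ler_wpM2l ?(ltW D0)//.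
  rewrite lef_pV2 ?posrE ?exprn_gt0//.
  rewrite (@le_trans _ _ (x ^+ 2)) ?lerDl ?(ltW D0)//.
  by rewrite -[leRHS]real_normK ?num_real// lerXn2r ?nnegrE ?(ltW r0).
have -> : M * (D / r ^+ 2) = e * (M / (M + 1)).
  by rewrite DE; field; rewrite !gt_eqF// ltr_wpDl.
by rewrite -[leRHS]mulr1 ler_wpM2l ?(ltW e0)// ler_pdivrMr ?ltr_wpDl// mul1r lerDl.
Qed.

(** A compactly supported function with values in [0,1] that tends to 1 pointwise as t -> 0. *)
Definition plateau (t x : R) : R := cutoff t x / (cutoff t x + t).

Lemma plateau01 t x : 0 < t -> 0 <= plateau t x <= 1.
Proof.
move=> t0; have c0 := cutoff_ge0 t x.
have ct : 0 < cutoff t x + t by rewrite ltr_wpDl.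
by rewrite divr_ge0 ?(ltW ct)//= ler_pdivrMr// mul1r lerDl ltW.
Qed.

Lemma cvg_test_plateau f t : bcont f -> 0 < t -> S (fun x => f x * plateau t x).
Proof.
move=> fb t0.
have -> : (fun x => f x * plateau t x) =
    (fun x => f x * (cutoff t x + t)^-1 * cutoff t x).
  by apply/funext => x; rewrite /plateau; ring.
apply: cvg_test_cutoff => //; apply: bcontM => //.
have ct x : 0 < cutoff t x + t by rewrite ltr_wpDl ?cutoff_ge0.
split.
  move=> x; apply: cvgV; first by rewrite gt_eqF.
  by apply: cvgD; [exact: continuous_cutoff|exact: cvg_cst].
exists t^-1 => x; rewrite ger0_norm ?invr_ge0 ?(ltW (ct x))//.
by rewrite lef_pV2 ?posrE// lerDr cutoff_ge0.
Qed.

Lemma plateau_cvg1 x : plateau k.+1%:R^-1 x @[k --> \oo] --> (1 : R).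
Proof.
have tc : (k.+1%:R^-1 : R) @[k --> \oo] --> (0 : R) := @cvg_harmonic R.
have cc : cutoff k.+1%:R^-1 x @[k --> \oo] --> y x.
  have y0 : 0 < y x by exact: cauchy_kernel_gt0.
  have : (y x - k.+1%:R^-1 : R) @[k --> \oo] --> y x.
    by rewrite -[X in _ --> X]subr0; apply: cvgB => //; exact: cvg_cst.
  apply: cvg_trans; apply: near_eq_cvg.
  have /cvgrPdist_lt/(_ _ y0) := tc; apply: filterS => k.
  rewrite sub0r normrN ger0_norm ?invr_ge0// => ky.
  by rewrite /cutoff max_r// subr_ge0 ltW.
rewrite -[X in _ --> X](@divff _ (y x + 0)) ?addr0 ?gt_eqF ?cauchy_kernel_gt0//.
rewrite -[X in _ / X]addr0; apply: cvgM => //; apply: cvgV; last exact: cvgD.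
by rewrite addr0 gt_eqF ?cauchy_kernel_gt0.
Qed.

Lemma bcont_plateau t : 0 < t -> bcont (plateau t).
Proof.
move=> t0; have [] := cvg_test_plateau (bcont_cst 1) t0.
by under eq_fun do rewrite mul1r.
Qed.

Lemma mean_plateau_cvg1 : mean nu (plateau k.+1%:R^-1) @[k --> \oo] --> (1 : R).
Proof.
have t0 k : (0 : R) < k.+1%:R^-1 by rewrite invr_gt0.
have := @dominated_cvg _ _ _ nu setT measurableT
  (fun k x => (plateau k.+1%:R^-1 x)%:E) (fun=> 1%E) (fun=> 1%E).
move=> H.
have {}H : (\int[nu]_x (plateau k.+1%:R^-1 x)%:E)%E @[k --> \oo] -->
    (\int[nu]_x (1%E : \bar R))%E.
  apply: H => //.
  - move=> k; apply/measurable_EFinP; apply: continuous_measurable_fun.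
    by have [] := bcont_plateau (t0 k).
  - by move=> x _; apply: cvg_EFin; [exact: nearW|exact: plateau_cvg1].
  - exact: (bcont_integrable nu (bcont_cst 1)).
  - move=> k x _; have /andP[p0 p1] := plateau01 x (t0 k).
    by rewrite /= lee_fin ger0_norm.
have e1 : (\int[nu]_x (1%E : \bar R))%E = 1%:E.
  by rewrite (integral_mean nu (bcont_cst 1)) mean_cst.
move: H; rewrite e1 => /fine_cvgP[_].
by apply: cvg_trans; apply: near_eq_cvg; apply: nearW.
Qed.

(** No mass escapes: some plateau has mean close to 1 under the limit, which is a probability
    measure, and hence under the approximating laws for large n. Outside the plateau f is bounded by
    M times the missing mass. *)
Lemma cvg_test_bcont f : bcont f -> S f.
Proof.
move=> fb; split => //; apply/cvgrPdist_le => e e0.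
have [_ [M fM]] := fb.
have M0 : 0 <= M by rewrite (le_trans _ (fM 0)).
(* Makes M d <= e/4. The three errors are e/4 for the tail of [nu], e/4 for the localized means, and
   2 M d <= e/2 for the tail of [nu_ n]. *)
pose d := e / (4 * (M + 1)).
have d0 : 0 < d by rewrite divr_gt0// mulr_gt0// ltr_wpDl.
have [k /= dk] : exists k, 1 - mean nu (plateau k.+1%:R^-1) < d.
  have /cvgrPdist_lt/(_ d d0) := mean_plateau_cvg1.
  move=> /filter_ex[k hk]; exists k; exact: le_lt_trans (ler_norm _) hk.
pose t : R := k.+1%:R^-1; have t0 : 0 < t by rewrite invr_gt0.
have gb := bcont_plateau t0.
have [fgb fgS] := cvg_test_plateau fb t0.
have [_ gS] := cvg_test_plateau (bcont_cst 1) t0.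
have close (mu : law) : `|mean mu f - mean mu (fun x => f x * plateau t x)| <=
    M * (1 - mean mu (plateau t)).
  rewrite -meanB// -{1}(mean_cst mu 1) -(meanB mu (bcont_cst 1) gb).
  have b1 : bcont (fun x => 1 - plateau t x).
    have -> : (fun x => 1 - plateau t x) = (fun x => 1 + (-1) * plateau t x).
      by apply/funext => x; rewrite mulN1r.
    by apply: bcontD; [exact: bcont_cst|exact: bcontZ].
  rewrite -meanZ// ler_norml.
  have fE x : f x - f x * plateau t x = f x * (1 - plateau t x) by ring.
  have b2 : bcont (fun x => f x - f x * plateau t x).
    by under eq_fun do rewrite fE; exact: bcontM.
  have ab x : `|f x - f x * plateau t x| <= M * (1 - plateau t x).
    have /andP[p0 p1] := plateau01 x t0.
    by rewrite fE normrM [X in _ * X]ger0_norm ?subr_ge0// ler_wpM2r ?subr_ge0.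
  apply/andP; split.
    rewrite -mulN1r -meanZ; last exact: bcontZ.
    apply: le_mean => //; first by apply: bcontZ; exact: bcontZ.
    by move=> x; rewrite mulN1r; have := ab x; rewrite ler_norml => /andP[].
  apply: le_mean => //; first exact: bcontZ.
  by move=> x; have := ab x; rewrite ler_norml => /andP[].
have /cvgrPdist_le/(_ (e / 4)) := fgS; rewrite divr_gt0// => /(_ isT).
move=> N1.
have gS' : mean (nu_ n) (plateau t) @[n --> \oo] --> mean nu (plateau t).
  by have <- : (fun x => 1 * plateau t x) = plateau t by apply/funext => x; rewrite mul1r.
have /cvgrPdist_le/(_ d d0) := gS'; move=> N2.
near=> n.
have h1 : `|mean nu (fun x => f x * plateau t x) -
    mean (nu_ n) (fun x => f x * plateau t x)| <= e / 4 by near: n; exact: N1.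
have h2 : `|mean nu (plateau t) - mean (nu_ n) (plateau t)| <= d.
  by near: n; exact: N2.
have c1 := close nu; have c2 := close (nu_ n).
have Md : M * d <= e / 4.
  have -> : M * d = e / 4 * (M / (M + 1)) by rewrite /d; field; rewrite gt_eqF// ltr_wpDl.
  by rewrite -[leRHS]mulr1 ler_wpM2l ?divr_ge0 ?(ltW e0)// ler_pdivrMr ?ltr_wpDl// mul1r lerDl.
have Md1 : M * (1 - mean nu (plateau t)) <= e / 4.
  by rewrite (le_trans _ Md)// ler_wpM2l// ltW.
have Md2 : M * (1 - mean (nu_ n) (plateau t)) <= e / 2.
  rewrite (_ : e / 2 = e / 4 + e / 4); last by field.
  apply: (@le_trans _ _ (M * (d + d))); last by rewrite mulrDr lerD.
  rewrite ler_wpM2l//; move: h2; rewrite ler_norml => /andP[_ h2].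
  by rewrite /t in h2 *; lra.
rewrite (_ : mean nu f - mean (nu_ n) f =
   (mean nu f - mean nu (fun x => f x * plateau t x)) +
   (mean nu (fun x => f x * plateau t x) - mean (nu_ n) (fun x => f x * plateau t x))
   - (mean (nu_ n) f - mean (nu_ n) (fun x => f x * plateau t x))); last by ring.
rewrite (le_trans (ler_normB _ _))//.
have := ler_normD (mean nu f - mean nu (fun x => f x * plateau t x))
  (mean nu (fun x => f x * plateau t x) - mean (nu_ n) (fun x => f x * plateau t x)).
lra.
Unshelve. all: by end_near. Qed.

Lemma weak_cvg_of_poles : weak_cvg nu_ nu.
Proof.
move=> f fc [M [_ fM]].
have fb : bcont f by split => //; exists (M + 1) => x; apply: (fM (M + 1)) => //; rewrite ltrDl.
have [_ fS] := cvg_test_bcont fb.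
rewrite integral_mean//; under eq_fun do rewrite integral_mean//.
by apply: cvg_EFin => //; exact: nearW.
Qed.

End CauchyKernelsDetermine.

(** * Weak convergence in probability through countably many tests *)

Section WeakInProbability.
Local Open Scope classical_set_scope.
Context {R : realType}.
Notation law := (probability (measurableTypeR R) R).
Variables (a0 : R) (nu : law).
Hypothesis a0_ge1 : 1 <= a0.

(** For eta^2 = [pole a0 k] these are Re (1/(x - i eta)), for [b = true], and Im (1/(x - i eta)) /
    eta. *)
Definition pole_test (b : bool) k (x : R) : R :=
  (if b then x else 1) * cauchy_kernel (pole a0 k) x.

Lemma pole_test_false k : pole_test false k = cauchy_kernel (pole a0 k).
Proof. by apply/funext => x; rewrite /pole_test mul1r. Qed.

(** Otherwise, for every j some law would pass the tests up to j within 1/(j+1) and stay at distance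
    at least eps. Such a sequence converges weakly by the determination result, contradicting that
    rho metrizes weak convergence. *)
Lemma pole_tests_control rho : metrizes_weak_cvg rho -> forall eps : R, 0 < eps ->
  exists j, forall mu : law, (forall b k, (k <= j)%N ->
    `|mean mu (pole_test b k) - mean nu (pole_test b k)| < j.+1%:R^-1) ->
  rho mu nu < eps.
Proof.
move=> [_ _ _ _ rho_cvg] eps eps0; apply: contrapT => noj.
have /choice[nu_ nu_P] : forall j, exists mu : law, (forall b k, (k <= j)%N ->
    `|mean mu (pole_test b k) - mean nu (pole_test b k)| < j.+1%:R^-1) /\
    eps <= rho mu nu.
  move=> j; apply: contrapT => nomu; apply: noj; exists j => mu muj.
  by rewrite ltNge; apply/negP => eps_le; apply: nomu; exists mu.
have a0_gt0 : 0 < a0 by exact: lt_le_trans a0_ge1.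
have pole0 k : 0 < pole a0 k by exact: pole_gt0.
have tb b k : bcont (pole_test b k).
  case: b; first exact: bcont_id_cauchy_kernel.
  by rewrite pole_test_false; exact: bcont_cauchy_kernel.
have S b k : cvg_test nu_ nu (pole_test b k).
  split=> //; apply/cvgrPdist_lt => e e0.
  have /cvgrPdist_lt/(_ e e0) := @cvg_harmonic R.
  move=> ev; near=> j; rewrite distrC.
  have [nuj _] := nu_P j.
  apply: lt_trans (nuj b k _) _; first by near: j; exact: nbhs_infty_ge.
  rewrite -[ltLHS]ger0_norm ?invr_ge0// -normrN -[- _]sub0r.
  by near: j; exact: ev.
have : weak_cvg nu_ nu.
  apply: (weak_cvg_of_poles a0_ge1) => k.
    by have := S false k; rewrite pole_test_false.
  exact: S true k.
move=> /rho_cvg/cvgrPdist_lt/(_ eps eps0) /filter_ex[j].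
have [_ ej] := nu_P j; rewrite sub0r normrN => /(le_lt_trans (ler_norm _)).
by rewrite ltNge ej.
Unshelve. all: by end_near. Qed.

Lemma cvg_bern_prob_rho (I : nat -> finType) (p : forall n, I n -> R)
    (nu_ : forall n, {ffun I n -> bool} -> law) :
  (forall n i, 0 <= p n i <= 1) ->
  (forall b k (e : R), 0 < e ->
    Ex (p n) (fun c => (e <= `|mean (nu_ n c) (pole_test b k) -
      mean nu (pole_test b k)|)%R%:R) @[n --> \oo] --> (0 : R)) ->
  forall rho, metrizes_weak_cvg rho -> forall eps : R, 0 < eps ->
    Ex (p n) (fun c => (eps <= rho (nu_ n c) nu)%R%:R) @[n --> \oo] --> (0 : R).
Proof.
move=> p01 tests rho rhoP eps eps0.
have [j jP] := pole_tests_control rhoP eps0.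
pose far b k n (c : {ffun I n -> bool}) : R := (j.+1%:R^-1 <=
  `|mean (nu_ n c) (pole_test b k) - mean nu (pole_test b k)|)%R%:R.
pose F n : R := \sum_(k < j.+1) (Ex (p n) (far true k n) + Ex (p n) (far false k n)).
have F0 : F n @[n --> \oo] --> (0 : R).
  have -> : (0 : R) = \sum_(k < j.+1) (0 + 0) by rewrite big1// => k _; rewrite addr0.
  apply: cvg_big => [|k _]; first exact: add_continuous.
  by apply: cvgD; apply: tests; rewrite invr_gt0.
have le1 n c : (eps <= rho (nu_ n c) nu)%R%:R <=
    \sum_(k < j.+1) (far true k n c + far false k n c).
  case: (leP eps _) => [epsr|_]; last first.
    by apply: sumr_ge0 => k _; rewrite addr_ge0.
  rewrite leNgt; apply/negP => lt1.
  have far0 b (k : 'I_j.+1) : far b k n c = 0.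
    rewrite /far; case: leP => // le_far; exfalso; move: lt1.
    rewrite (bigD1 k)//= ltNge => /negP; apply.
    have rest0 : 0 <= \sum_(i < j.+1 | i != k) (far true i n c + far false i n c).
      by apply: sumr_ge0 => i _; rewrite addr_ge0.
    have fb : far b k n c = 1 by rewrite /far le_far.
    have f0 b' : 0 <= far b' k n c by [].
    case: b le_far fb => _ ->; have := f0 true; have := f0 false; lra.
  have : rho (nu_ n c) nu < eps.
    apply: jP => b k kj; have := far0 b (Ordinal (kj : k < j.+1)%N).
    rewrite /far/=; case: leP => // _ /eqP; by rewrite oner_eq0.
  by rewrite ltNge epsr.
apply: (@squeeze_cvgr _ _ _ _ (fun=> 0) F) => //; last exact: cvg_cst.
apply: nearW => n; apply/andP; split; first exact: Ex_ge0.
rewrite /F; under eq_bigr do rewrite -ExD.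
by rewrite -Ex_sum; apply: le_Ex.
Qed.

End WeakInProbability.

(** * Spectral measures and resolvents *)

Section SpectralMeasure.
Context {R : realType}.
Local Open Scope complex_scope.

Lemma eigenvalues_perm N (M : 'M[R]_N) (s : seq R) :
  char_poly M = \prod_(a <- s) ('X - a%:P) -> perm_eq (eigenvalues M) s.
Proof.
move=> Ms; apply: prod_XsubC_eq; rewrite -Ms /eigenvalues.
by case: xgetP => [t _ /= <-|/(_ s)].
Qed.

Lemma mean_empirical (s : seq R) (f : R -> R) : s != [::] -> bcont f ->
  mean (empirical s) f = (size s)%:R^-1 * \sum_(a <- s) f a.
Proof.
case: s => // a s _ [fc [M fM]].
set s' := a :: s.
have ge0_case (g : R -> R) : continuous g -> (forall x, 0 <= g x) ->
    (\int[empirical s']_x (g x)%:E)%E = ((size s')%:R^-1 * \sum_(a <- s') g a)%:E.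
  move=> gc g0.
  have mg : measurable_fun setT (EFin \o g : measurableTypeR R -> \bar R).
    by apply/measurable_EFinP; exact: continuous_measurable_fun.
  rewrite (eq_measure_integral (mscale ((size s')%:R^-1%:nng : {nonneg R})
    (msum (fun k => \d_(nth 0 s' k : measurableTypeR R)) (size s')))); last first.
    move=> A mA _; rewrite /= /mscale/= /msum/= /empirical.
    by rewrite (big_nth 0) big_mkord.
  rewrite ge0_integral_mscale//=; last by move=> x _; rewrite lee_fin.
  rewrite ge0_integral_measure_sum//=; last by move=> x _; rewrite lee_fin.
  rewrite EFinM -sumEFin; congr (_ * _)%E.
  rewrite [RHS](big_nth 0) [RHS]big_mkord.
  apply: eq_bigr => i _; rewrite integral_dirac//.
  by rewrite diracT mul1e.
have M0 : 0 <= M by rewrite (le_trans _ (fM 0)).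
have fb : bcont f by split => //; exists M.
(* Adding the bound M makes the function nonnegative, as the integral formulas for scaled and finite
   sums of measures ask. *)
have -> : mean (empirical s') f = mean (empirical s') (fun x => f x + M) - M.
  by rewrite meanD//; [rewrite mean_cst addrK|exact: bcont_cst].
rewrite /mean /Rintegral ge0_case/=; first last.
- by move=> x; have := fM x; rewrite ler_norml => /andP[]; lra.
- by move=> x; apply: cvgD; [exact: fc|exact: cvg_cst].
rewrite big_split/= mulrDr big_const_seq count_predT iter_addr_0.
by rewrite -[M *+ _]mulr_natl mulKf ?addrK// pnatr_eq0.
Qed.

Lemma bcont_pole_test (a0 : R) b k : 0 < a0 -> bcont (pole_test a0 b k).
Proof.
move=> a0_gt0; case: b; first by apply: bcont_id_cauchy_kernel; exact: pole_gt0.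
by rewrite pole_test_false; apply: bcont_cauchy_kernel; exact: pole_gt0.
Qed.

(** Imaginary part of the purely imaginary Stieltjes transform s of the semicircle law at z = i eta;
    [sc_rootE] is 1 + s z + s^2 = 0 in real terms. *)
Definition sc_root (eta : R) : R := (Num.sqrt (eta ^+ 2 + 4) - eta) / 2.

Lemma sc_rootE eta : 1 - eta * sc_root eta - sc_root eta ^+ 2 = 0.
Proof.
have h : Num.sqrt (eta ^+ 2 + 4) ^+ 2 = eta ^+ 2 + 4.
  by rewrite sqr_sqrtr// addr_ge0 ?sqr_ge0.
have -> : 1 - eta * sc_root eta - sc_root eta ^+ 2 =
   (eta ^+ 2 + 4 - Num.sqrt (eta ^+ 2 + 4) ^+ 2) / 4 by rewrite /sc_root; field.
by rewrite h subrr mul0r.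
Qed.

Lemma sc_root01 eta : 0 < eta -> 0 <= sc_root eta <= 1.
Proof.
move=> eta0; have h : Num.sqrt (eta ^+ 2 + 4) ^+ 2 = eta ^+ 2 + 4.
  by rewrite sqr_sqrtr// addr_ge0 ?sqr_ge0.
have s0 := sqrtr_ge0 (eta ^+ 2 + 4).
by apply/andP; split; rewrite /sc_root ?ler_pdivrMr ?divr_ge0//; nra.
Qed.

Lemma sc_root_fixpoint eta :
  1 + (0 +i* sc_root eta) * (0 +i* eta) + (0 +i* sc_root eta) ^+ 2 = 0.
Proof.
have := sc_rootE eta; set t := sc_root eta => h.
apply/eqP; rewrite eq_complex /=; apply/andP; split; apply/eqP; lra.
Qed.

Lemma mean_semicircle_test (a0 : R) b k : 0 < a0 ->
  mean semicircle (pole_test a0 b k) =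
  if b then 0 else sc_root (Num.sqrt (pole a0 k)) / Num.sqrt (pole a0 k).
Proof.
move=> a0_gt0; have pk := pole_gt0 a0_gt0 k.
set eta := Num.sqrt _; have eta0 : 0 < eta by rewrite sqrtr_gt0.
have eta2 : eta ^+ 2 = pole a0 k by rewrite sqr_sqrtr// ltW.
have [tc tb] := bcont_pole_test b k a0_gt0.
have tbd : bounded_fun (pole_test a0 b k).
  by case: tb => M; exact: norm_le_bounded_fun.
rewrite /mean /Rintegral; case: b tc tbd {tb} => tc tbd.
  rewrite integral_semicircle_odd// => x.
  by rewrite /pole_test /cauchy_kernel sqrrN mulNr.
rewrite pole_test_false /cauchy_kernel -eta2 integral_semicircle_poisson//=.
by rewrite /sc_root invfM mulrA.
Qed.

(** The two tests are the real part of the normalized trace and its imaginary part divided by eta;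
    since eta >= 1, this division only decreases the deviation. *)
Lemma pole_test_spectral (a0 : R) b k N (M : 'M[R]_N) : 1 <= a0 -> M^T = M ->
  (0 < N)%N ->
  `|mean (spectral_measure M) (pole_test a0 b k) - mean semicircle (pole_test a0 b k)| <=
  cabs (N%:R^-1%:C * \tr (resolvent M (0 +i* Num.sqrt (pole a0 k))) -
        (0 +i* sc_root (Num.sqrt (pole a0 k)))).
Proof.
move=> a0_ge1 Msym N0; set eta := Num.sqrt _.
have a0_gt0 : 0 < a0 by exact: lt_le_trans a0_ge1.
have pk := pole_gt0 a0_gt0 k.
have eta1 : 1 <= eta.
  rewrite -sqrtr1 ler_wsqrtr// (le_trans a0_ge1)// lerDl invr_ge0 ler0n//.
have eta0 : 0 < eta by exact: lt_le_trans eta1.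
have eta2 : eta ^+ 2 = pole a0 k by rewrite sqr_sqrtr// ltW.
have [s [sN Ms trE]] := real_symmetric_spectrum Msym.
have ps := eigenvalues_perm Ms.
have sz : size (eigenvalues M) = N by rewrite (perm_size ps).
rewrite mean_empirical; last 2 first.
- by rewrite -size_eq0 sz -lt0n.
- exact: bcont_pole_test.
rewrite (perm_big _ ps)/= sz mean_semicircle_test// -/eta trE//.
have invE (x : R) : (x%:C - (0 +i* eta))^-1 =
    (x * cauchy_kernel (pole a0 k) x) +i* (eta * cauchy_kernel (pole a0 k) x).
  have x0 : x ^+ 2 + eta ^+ 2 != 0 by rewrite gt_eqF// ltr_wpDl ?sqr_ge0 ?exprn_gt0.
  apply: (mulfI (x := x%:C - (0 +i* eta))).
    by apply/negP => /eqP/(congr1 (@complex.Im R))/=/eqP; rewrite sub0r oppr_eq0 gt_eqF.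
  rewrite divff; last first.
    by apply/negP => /eqP/(congr1 (@complex.Im R))/=/eqP; rewrite sub0r oppr_eq0 gt_eqF.
  apply/eqP; rewrite eq_complex/= /cauchy_kernel -eta2.
  by apply/andP; split; apply/eqP; field.
have -> : N%:R^-1%:C * (\sum_(a <- s) (a%:C - (0 +i* eta))^-1) - (0 +i* sc_root eta) =
  (N%:R^-1 * \sum_(a <- s) a * cauchy_kernel (pole a0 k) a) +i*
  (eta * (N%:R^-1 * (\sum_(a <- s) cauchy_kernel (pole a0 k) a) - sc_root eta / eta)).
  under eq_bigr do rewrite invE.
  have -> : \sum_(a <- s) ((a * cauchy_kernel (pole a0 k) a) +i* (eta * cauchy_kernel (pole a0 k) a)) =
     (\sum_(a <- s) a * cauchy_kernel (pole a0 k) a) +i* (eta * \sum_(a <- s) cauchy_kernel (pole a0 k) a).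
    elim: (s) => [|a s' IH]; first by rewrite !big_nil mulr0.
    by rewrite !big_cons IH mulrDr.
  apply/eqP; rewrite eq_complex/=; apply/andP; split; apply/eqP; first by ring.
  by move: (N%:R^-1) => u; field; rewrite gt_eqF.
case: b.
  rewrite subr0; apply: le_trans _ (Re_le_cabs _).
  by rewrite /= /pole_test.
under eq_bigr do rewrite /pole_test mul1r.
apply: le_trans _ (Im_le_cabs _); rewrite /= normrM ger0_norm ?(ltW eta0)//.
by rewrite -[leLHS]mul1r ler_wpM2r.
Qed.

End SpectralMeasure.

(** The rows of M indexed by the image of f are supported on that image, so M is block diagonal and
    the corner of its resolvent is the resolvent of the corner. *)
Lemma resolvent_submatrix (R : rcfType) N N' (M : 'M[R]_N) (M' : 'M[R]_N')
    (f : 'I_N' -> 'I_N) (z : R[i]) :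
  M^T = M -> M'^T = M' -> (0 < complex.Im z)%R -> injective f ->
  (forall a b, M' a b = M (f a) (f b)) ->
  (forall a j, j \notin codom f -> M (f a) j = 0) ->
  forall a b, resolvent M' z a b = resolvent M z (f a) (f b).
Proof.
move=> Msym Msym' z0 finj MM' M0 a b.
suff : \matrix_(a, b) resolvent M z (f a) (f b) = resolvent M' z.
  by move=> <-; rewrite mxE.
apply: resolvent_unique => //; apply/matrixP => x y; rewrite !mxE.
have /matrixP/(_ (f x) (f y)) := resolventVr Msym z0; rewrite !mxE (inj_eq finj).
move=> <-; rewrite [RHS](bigID (mem (codom f)))/= [X in _ = _ + X]big1 ?addr0.
  rewrite (reindex_onto f (fun j => odflt x [pick a | f a == j])) /=.
    apply: eq_big => [w|w _].
      rewrite codom_f/=; case: pickP => [u /eqP/finj ->|/(_ w)]; rewrite eqxx//.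
    by rewrite !mxE MM' (inj_eq finj).
  move=> j /codomP[w ->]; case: pickP => [u /eqP|/(_ w)]; by rewrite ?eqxx.
move=> j jf; rewrite !mxE M0//.
have -> : (f x == j) = false by apply/negP => /eqP fj; rewrite -fj codom_f in jf.
by rewrite mulr0n subr0 mul0r.
Qed.

(** * Convergence in probability *)

Section ConfigurationLaw.
Local Open Scope classical_set_scope.
Variables (R : realType) (disp : measure_display) (T : measurableType disp).
Variables (P : probability T R) (I : finType) (D : {set I}) (p : I -> R).
Variable X : I -> {RV P >-> bool}.
Hypothesis p01 : forall i, i \in D -> 0 <= p i <= 1.
Hypothesis pD : forall i, i \notin D -> p i = 0.
Hypothesis X_law : forall i, i \in D -> distribution P (X i) =1 bernoulli_prob (p i).
Hypothesis X_indep : mutually_independent D X.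

Definition config (w : T) : {ffun I -> bool} := [ffun i => (i \in D) && X i w].

Lemma measurable_config c : measurable [set w | config w = c].
Proof.
have -> : [set w | config w = c] =
    \bigcap_(i in [set` [set: I]%SET]) [set w | config w i = c i].
  apply/seteqP; split => w /=; first by move=> <- i _.
  by move=> H; apply/ffunP => i; apply: H; rewrite /= inE.
apply: fin_bigcap_measurable => // i _.
have -> : [set w | config w i = c i] =
    X i @^-1` [set b | (i \in D) && b = c i].
  by apply/seteqP; split => w /=; rewrite ffunE.
by rewrite -[X in measurable X]setTI; exact: measurable_funP.
Qed.

Lemma config_point c : P [set w | config w = c] = (bern_wt p c)%:E.
Proof.
have [[i [iD ci]]|nbad] := pselect (exists i, i \notin D /\ c i).
  have -> : [set w | config w = c] = set0.
    apply/seteqP; split => // w /= /ffunP/(_ i).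
    by rewrite ffunE (negPf iD) ci.
  rewrite measure0 /bern_wt (bigD1 i)//= ci pD//= ?mul0r//.
have cD i : i \notin D -> c i = false.
  by move=> iD; apply/negbTE/negP => ci; apply: nbad; exists i.
have -> : [set w | config w = c] = \bigcap_(i in [set` D]) X i @^-1` [set c i].
  apply/seteqP; split => w /=; first by move=> <- i /= iD; rewrite ffunE iD.
  move=> H; apply/ffunP => i; rewrite ffunE.
  by case: (boolP (i \in D)) => [iD|/cD ->//]; rewrite (H i).
rewrite X_indep//.
have -> : bern_wt p c = \prod_(i in D) (if c i then p i else 1 - p i).
  rewrite /bern_wt (bigID (mem D))/= [X in _ * X]big1 ?mulr1// => i iD.
  by rewrite cD// pD// subr0.
rewrite -prodEFin; apply: eq_bigr => i iD.
have := X_law iD [set c i]; rewrite /distribution/= /pushforward => ->.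
rewrite bernoulli_probE ?p01// !diracE.
case: (c i).
  by rewrite mem_set// memNset ?mule1 ?mule0 ?adde0.
by rewrite memNset// mem_set// mule0 add0e mule1.
Qed.

(** Only finitely many configurations exist, so every event depending on the configuration is
    measurable. This covers events expressed through an arbitrary metric on laws and turns their
    probabilities into finite sums. *)
Lemma config_law (Q : pred {ffun I -> bool}) :
  P [set w | Q (config w)] = (Ex p (fun c => (Q c)%:R))%:E.
Proof.
have -> : [set w | Q (config w)] =
    \bigcup_(c in [set` enum Q]) [set w | config w = c].
  apply/seteqP; split => w /=.
    by move=> Qw; exists (config w); rewrite //= mem_enum.
  by move=> [c]; rewrite /= mem_enum => Qc ->.
rewrite measure_fin_bigcup//=.
- rewrite -fsbig_seq ?enum_uniq// big_enum/= big_mkcond /Ex -sumEFin.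
  apply: eq_bigr => c _; rewrite config_point unfold_in.
  by case: (Q c); rewrite ?mulr1 ?mulr0.
- by move=> c c' _ _ [w [<- <-]].
- by move=> c _; exact: measurable_config.
Qed.

End ConfigurationLaw.

Section Limits.
Local Open Scope classical_set_scope.
Variable R : realType.

Lemma limn_einf_gt0 (u : nat -> R) : (0 < limn_einf (fun n => (u n)%:E))%E ->
  exists2 c : R, 0 < c & \forall n \near \oo, c <= u n.
Proof.
rewrite limn_einf_lim (cvg_lim _ (@cvg_einfs_sup _ _))//.
move=> /ereal_sup_gt[_ [N _ <-]].
have le_u n : (N <= n)%N -> (einfs (fun n => (u n)%:E) N <= (u n)%:E)%E.
  by move=> Nn; apply: ereal_inf_lbound; exists n.
case: (einfs _ N) le_u => [c| |] le_u c0.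
- exists c => //; near=> n; rewrite -lee_fin le_u//.
  by near: n; exact: nbhs_infty_ge.
- by have := le_u N (leqnn N); rewrite leye_eq.
- by [].
Unshelve. all: by end_near. Qed.

(** Order of limits: [a] is fixed first so that the linear part is e/2, then n is taken large
    depending on [a]. *)
Lemma cvg0_of_le_linear (u : nat -> R) (al : R) (h : R -> nat -> R) :
  (forall n, 0 <= u n) -> 0 < al ->
  (forall a, 0 < a -> \forall n \near \oo, u n <= al * a + h a n) ->
  (forall a, 0 < a -> h a n @[n --> \oo] --> 0) -> u n @[n --> \oo] --> 0.
Proof.
move=> u0 al0 uh h0; apply/cvgrPdist_lt => e e0.
pose a := e / (2 * al); have a0 : 0 < a by rewrite divr_gt0 ?mulr_gt0.
have /cvgrPdist_lt/(_ (e / 2)) := h0 a a0; rewrite divr_gt0// => /(_ isT) ha.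
near=> n; rewrite sub0r normrN ger0_norm//.
apply: (@le_lt_trans _ _ (al * a + h a n)); first by near: n; exact: uh.
have -> : al * a = e / 2 by rewrite /a; field; rewrite gt_eqF.
rewrite [ltRHS](splitr e) ltrD2l; apply: le_lt_trans (ler_norm _) _.
by rewrite -normrN -[- _]sub0r; near: n; exact: ha.
Unshelve. all: by end_near. Qed.

Lemma cvg_inv_natB (j : nat) : (n - j)%:R^-1 @[n --> \oo] --> (0 : R).
Proof.
have near_ge A : \forall n \near \oo, A <= (n - j)%:R :> R.
  near=> n; have jn : (j <= n)%N by near: n; exact: nbhs_infty_ge.
  rewrite natrB// lerBrDr; near: n.
  by have /cvgryPge := @cvgr_idn R; apply.
have -> : (fun n => (n - j)%:R^-1) = unstable.inv_fun (fun n => (n - j)%:R : R) by [].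
apply/gtr0_cvgV0; last by apply/cvgryPge.
by near=> n; apply: (@lt_le_trans _ _ 1) => //; near: n; exact: near_ge.
Unshelve. all: by end_near. Qed.

End Limits.

(** * Limits of the error terms *)

Section Asymptotics.
Local Open Scope classical_set_scope.
Variables (R : realType) (d : nat) (p : nat -> nat -> R).
Hypothesis d2 : (2 <= d)%N.
Hypothesis p01 : forall n i, (1 <= i <= d)%N -> 0 < p n i <= 1.
Hypothesis liminf_p :
  (0 < \big[Order.min/+oo]_(1 <= i < d) limn_einf (fun n => (p n i)%:E))%E.
Hypothesis np_cvg : (n%:R * p n d * (1 - p n d)) @[n --> \oo] --> +oo.
Hypothesis p_cvg : p n d @[n --> \oo] --> 0.

Lemma skeleton_prob_bound : exists2 c : R, 0 < c <= 1 &
  \forall n \near \oo, forall i, (1 <= i < d)%N -> c <= p n i.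
Proof.
suff H j : (j <= d)%N -> exists2 c : R, 0 < c <= 1 &
    \forall n \near \oo, forall i, (1 <= i < j)%N -> c <= p n i by exact: H.
elim: j => [_|j IH jd].
  exists 1; first by rewrite lexx ltr01.
  by near=> n; move=> i; rewrite ltn0 andbF.
have [c /andP[c0 c1] cp] := IH (ltnW jd).
have [->|j0] := posnP j.
  by exists 1; [rewrite lexx ltr01|near=> n; move=> i; case: i].
have [|c' c'0 c'p] := @limn_einf_gt0 _ (p ^~ j).
  apply: lt_le_trans liminf_p _; apply: ge_bigmin_seq => //.
  by rewrite mem_index_iota j0.
exists (Order.min c c'); first by rewrite lt_min c0 c'0 ge_min c1.
near=> n; move=> i /andP[i1]; rewrite ltnS leq_eqVlt => /orP[/eqP ->|ij].
  by rewrite ge_min; apply/orP; right; near: n; exact: c'p.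
rewrite ge_min; apply/orP; left.
have : (1 <= i < j)%N by rewrite i1.
by move: (i); near: n; exact: cp.
Unshelve. all: by end_near. Qed.

Lemma density_bound : exists2 k : R, 0 < k &
  \forall n \near \oo, k <= link_prob d (p n) /\ k <= facet_prob d (p n).
Proof.
have [c /andP[c0 c1] cp] := skeleton_prob_bound.
pose k1 := \prod_(1 <= r < d) c ^+ 'C(d, r).
pose k2 := \prod_(2 <= r < d.+1) c ^+ 'C(d, r).
have k10 : 0 < k1 by apply: prodr_gt0 => r _; exact: exprn_gt0.
have k20 : 0 < k2 by apply: prodr_gt0 => r _; exact: exprn_gt0.
have le1 j l : \prod_(j <= r < l) c ^+ 'C(d, r) <= 1.
  by apply: prodr_ile1 => r _; rewrite exprn_ge0 ?exprn_ile1 ?(ltW c0).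
exists (k1 * k2); first exact: mulr_gt0.
near=> n; have cpn i : (1 <= i < d)%N -> c <= p n i by move: i; near: n; exact: cp.
split.
  apply: (@le_trans _ _ k1); first by rewrite ler_piMr ?(ltW k10) ?le1.
  rewrite /k1 /link_prob big_nat [leRHS]big_nat; apply: ler_prod => r rd.
  by rewrite exprn_ge0 ?(ltW c0)// lerXn2r ?nnegrE ?(ltW c0) ?cpn// (le_trans (ltW c0)) ?cpn.
apply: (@le_trans _ _ k2); first by rewrite ler_piMl ?(ltW k20) ?le1.
rewrite /k2 /facet_prob big_nat [leRHS]big_nat; apply: ler_prod => r /andP[r2 rd].
have r1 : (1 <= r.-1 < d)%N by case: r r2 rd => [|[|r]].
by rewrite exprn_ge0 ?(ltW c0)// lerXn2r ?nnegrE ?(ltW c0) ?cpn// (le_trans (ltW c0)) ?cpn.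
Unshelve. all: by end_near. Qed.

Variables (k : R) (z s : R[i]).
Hypothesis k0 : 0 < k.
Hypothesis k_le : \forall n \near \oo, k <= link_prob d (p n) /\ k <= facet_prob d (p n).

(** The variance scale is at least k times n p_d (1 - p_d), because d [link_prob] >= k; so it tends
    to infinity with the latter. *)
Lemma cvg_scal_variance_scale : scal (variance_scale n d (p n)) @[n --> \oo] --> 0.
Proof.
have mE : (fun n => (variance_scale n d (p n))^-1) @ \oo --> (0 : R).
  have -> : (fun n => (variance_scale n d (p n))^-1) =
    (unstable.inv_fun (fun n => variance_scale n d (p n))) by [].
  have big_m : \forall n \near \oo,
      k * (n%:R * p n d * (1 - p n d)) <= variance_scale n d (p n).
    near=> n; have [kl _] : k <= link_prob d (p n) /\ k <= facet_prob d (p n).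
      by near: n; exact: k_le.
    rewrite variance_scaleE//.
    have /andP[q0 q1] : 0 < p n d <= 1 by apply: p01; rewrite leqnn ltnW.
    have -> : n%:R * d%:R * (link_prob d (p n) * p n d) * (1 - p n d) =
      (d%:R * link_prob d (p n)) * (n%:R * p n d * (1 - p n d)) by ring.
    apply: ler_wpM2r; first by rewrite !mulr_ge0 ?subr_ge0// ltW.
    by rewrite -[leLHS]mul1r ler_pM ?(ltW k0)// ler1n ltnW.
  have cm : variance_scale n d (p n) @[n --> \oo] --> +oo.
    apply: (ger_cvgy big_m); apply/cvgryPge => A.
    have /cvgryPge/(_ (A / k)) := np_cvg; apply: filterS => n.
    by rewrite ler_pdivrMr// [leRHS]mulrC.
  apply/gtr0_cvgV0 => //; move/cvgryPgt : cm; exact.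
have -> : (fun n => scal (variance_scale n d (p n))) =
    (fun n => Num.sqrt (variance_scale n d (p n))^-1).
  apply/funext => n; rewrite /scal sqrtrV// /variance_scale.
  have pi i : (1 <= i <= d)%N -> 0 <= p n i.
    by move=> /(p01 n)/andP[/ltW].
  rewrite !mulr_ge0//.
    rewrite big_nat; apply: prodr_ge0 => i id; apply: exprn_ge0; exact: pi.
  by rewrite subr_ge0; have /andP[] : 0 < p n d <= 1 by apply: p01; rewrite leqnn ltnW.
rewrite -[X in _ --> X]sqrtr0.
by apply: continuous_cvg mE; exact: sqrt_continuous.
Unshelve. all: by end_near. Qed.

Lemma cvg_defect_error : defect_error n d (p n) k z @[n --> \oo] --> 0.
Proof.
rewrite /defect_error -[X in _ --> X](addr0 0); apply: cvgD; last first.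
  by rewrite -[X in _ --> X](mulr0 (4 / k * d.+1%:R ^+ 3 * (1 + cabs z + 4 / k)));
    apply: cvgMr.
rewrite -[X in _ --> X](addr0 0); apply: cvgD; last first.
  rewrite -[X in _ --> X](mulr0 (4 / k *
    ((d.+1%:R ^+ 5 + d.+1%:R ^+ 2 + d.+1%:R) * (1 + cabs z + 4 / k) +
     (d.+1%:R ^+ 3 + 1) * (d.+1%:R ^+ 2 * (cabs z + 2 * (4 / k))))));
  apply: cvgMr; exact: cvg_scal_variance_scale.
rewrite -[X in _ --> X](mulr0 (1 + cabs z + 4 / k)); apply: cvgMr.
rewrite -[X in _ --> X]sqrtr0; apply: continuous_cvg; first exact: sqrt_continuous.
by rewrite -[X in _ --> X](mulr0 (4 / k)); apply: cvgMr.
Qed.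

Hypothesis Imz : 1 <= complex.Im z.
Hypothesis z_large : 2 * (4 / k) + 1 <= cabs z.
Hypothesis s_eq : 1 + s * z + s ^+ 2 = 0.
Hypothesis s_le1 : cabs s <= 1.
Notation cell_index n := 'I_#|[set s : {set 'I_n} | #|s| == d]|%SET.
Variable sg : forall n, cell_index n -> cell_index n -> R.
Hypothesis sg_sym : forall n (i j : cell_index n), sg i j = sg j i.
Hypothesis sg_sqr : forall n (i j : cell_index n), sg i j ^+ 2 = 1.

Lemma cvg_green_average (e : R) : 0 < e ->
  Ex (@cell_prob R n d (p n)) (fun c =>
    ((\sum_(i : cell_index n) (present c i)%:R == 0 :> R) ||
     (e <= cabs ((\sum_(i : cell_index n) (present c i)%:R)^-1%:C%C *
        \sum_(i | present c i) green (top d) (skel d) (top_block (@sg n))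
          (variance_scale n d (p n)) z c i i - s))%R)%:R) @[n --> \oo] --> 0.
Proof.
move=> e0; pose ek := 2 / (e * k); have ek0 : 0 < ek by rewrite divr_gt0 ?mulr_gt0.
pose F (n : nat) := fun c : {ffun {set 'I_n} -> bool} =>
    (((\sum_(i : cell_index n) (present c i)%:R == 0 :> R) ||
     (e <= cabs ((\sum_(i : cell_index n) (present c i)%:R)^-1%:C%C *
        \sum_(i | present c i) green (top d) (skel d) (top_block (@sg n))
          (variance_scale n d (p n)) z c i i - s))%R)%:R : R).
(* The part of the bound of [Ex_green_average] that vanishes for fixed [a]; what remains is linear
   with slope [ek * (2^-1 + k^-1)]. Writing [n - 0] gives 1/n the shape of [cvg_inv_natB]. *)
pose h (a : R) n := 4 * d%:R ^+ 2 * k ^- 2 * (n - d.-1)%:R^-1 + ek *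
  (a^-1 / 2 * defect_error n d (p n) k z + ((a * k)^-1 * (n - 0)%:R^-1 +
   2 * (p n d + d%:R * (n - 0)%:R^-1))).
have P0 n (t : {set 'I_n}) : 0 <= cell_prob d (p n) t <= 1.
  rewrite /cell_prob; case: ifP => [/andP[t2 td]|_]; last by rewrite lexx ler01.
  have /andP[q0 q1] : 0 < p n #|t|.-1 <= 1.
    by apply: p01; case: #|t| t2 td => [|[|l]].
  by rewrite ltW.
apply: (@cvg0_of_le_linear _ (fun n => Ex (@cell_prob R n d (p n)) (F n))
    (ek * (2^-1 + k^-1)) h).
- by move=> n; apply: Ex_ge0 => // c; exact: ler0n.
- by rewrite mulr_gt0// addr_gt0 ?invr_gt0.
- move=> a a0; near=> n.
  have dn : (d < n)%N by near: n; exact: nbhs_infty_gt.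
  have [kl kf] : k <= link_prob d (p n) /\ k <= facet_prob d (p n).
    by near: n; exact: k_le.
  have qh : p n d <= 2^-1.
    near: n; have /cvgrPdist_le/(_ 2^-1) := p_cvg; rewrite invr_gt0 ltr0n => /(_ isT).
    apply: filterS => n; rewrite sub0r normrN; exact: le_trans (ler_norm _).
  apply: le_trans (Ex_green_average (p01 n) d2 dn (@sg_sym n) (@sg_sqr n) k0 kl kf qh
    Imz z_large s_eq s_le1 a0 e0) _.
  rewrite le_eqVlt; apply/orP; left; apply/eqP.
  rewrite /h /ek /green_error subn0 !invfM; field.
  by rewrite !gt_eqF// ltr0n ?subn_gt0 ?(leq_ltn_trans (leq_pred _))// (leq_trans _ dn).
move=> a a0.
have cV j := @cvg_inv_natB R j.
rewrite /h -[X in _ --> X](addr0 0); apply: cvgD.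
  by rewrite -[X in _ --> X](mulr0 (4 * d%:R ^+ 2 * k ^- 2)); apply: cvgMr.
rewrite -[X in _ --> X](mulr0 ek); apply: cvgMr.
rewrite -[X in _ --> X](addr0 0); apply: cvgD.
  by rewrite -[X in _ --> X](mulr0 (a^-1 / 2)); apply: cvgMr; exact: cvg_defect_error.
rewrite -[X in _ --> X](addr0 0); apply: cvgD.
  by rewrite -[X in _ --> X](mulr0 ((a * k)^-1)); apply: cvgMr.
rewrite -[X in _ --> X](mulr0 2); apply: cvgMr.
rewrite -[X in _ --> X](addr0 0); apply: cvgD => //.
by rewrite -[X in _ --> X](mulr0 d%:R); apply: cvgMr.
Unshelve. all: by end_near. Qed.

End Asymptotics.

Lemma eq_lower_model d n (c c' : {set 'I_n} -> bool) :
  (forall t : {set 'I_n}, (2 <= #|t| <= d.+1)%N -> c t = c' t) ->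
  lower_model d c = lower_model d c'.
Proof.
move=> cc'.
have E : lower_faces d c = lower_faces d c'.
  apply/setP => s; rewrite !inE; case: leqP => //= sd.
  apply: eq_forallb => t; case: (boolP (t \subset s)) => //= ts.
  case: leqP => //= t2; rewrite cc'// t2.
  exact: leq_trans (subset_leq_card ts) sd.
rewrite /lower_model; move: (@lower_faces_closed d n c) (@lower_faces_closed d n c').
rewrite E => h h'; congr SimplicialComplex; exact: Prop_irrelevance.
Qed.

Section SpectralDeviation.
Local Open Scope complex_scope.
Variables (R : realType) (n d : nat).
Notation cell_index := 'I_#|[set s : {set 'I_n} | #|s| == d]|%SET.
Hypothesis d0 : (0 < d)%N.
Variable sg : cell_index -> cell_index -> R.
Hypothesis sg_sym : forall i j, sg i j = sg j i.
Variables (c : {ffun {set 'I_n} -> bool}) (N : nat) (M : 'M[R]_N).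
Variable f : 'I_N -> cell_index.
Hypothesis f_inj : injective f.
Hypothesis codom_f : codom f =i present c.
Hypothesis ME : forall a b,
  M a b = block_sum (top d) (skel d) (top_block sg) c (f a) (f b).

Lemma sum_present (V : nmodType) (F : cell_index -> V) :
  \sum_(i | present c i) F i = \sum_a F (f a).
Proof.
have -> : \sum_(i | present c i) F i = \sum_(i in f @: [set: 'I_N]%SET) F i.
  apply: eq_bigl => i; have -> : present c i = (i \in codom f) by rewrite codom_f.
  by apply/codomP/imsetP => [[a ->]|[a _ ->]]; exists a.
rewrite big_imset/=; last by move=> a b _ _; exact: f_inj.
by apply: eq_bigl => a; rewrite inE.
Qed.

Lemma spectral_deviation (m a0 : R) b k : 1 <= a0 ->
  \sum_(i : cell_index) ((present c i)%:R : R) != 0 ->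
  `|mean (spectral_measure (scal m *: M)) (pole_test a0 b k) -
    mean semicircle (pole_test a0 b k)| <=
  cabs ((\sum_(i : cell_index) (present c i)%:R)^-1%:C *
    \sum_(i | present c i) green (top d) (skel d) (top_block sg) m
      (0 +i* Num.sqrt (pole a0 k)) c i i -
    (0 +i* sc_root (Num.sqrt (pole a0 k)))).
Proof.
move=> a0_ge1 present_neq0; set eta := Num.sqrt (pole a0 k).
have NE : \sum_(i : cell_index) (present c i)%:R = N%:R :> R.
  transitivity (\sum_(i : cell_index | present c i) (1 : R)).
    by rewrite [RHS]big_mkcond; apply: eq_bigr => i _; case: (present c i).
  by rewrite sum_present sumr_const card_ord.
have N0 : (0 < N)%N by rewrite lt0n -(pnatr_eq0 R) -NE.
have Msym : (scal m *: M)^T = scal m *: M.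
  apply/matrixP => x y; rewrite !mxE !ME.
  have /matrixP/(_ (f x) (f y)) := block_sum_sym (top d) (skel d) m (top_block_sym sg_sym) c.
  by rewrite !mxE.
apply: le_trans (pole_test_spectral b k a0_ge1 Msym N0) _.
rewrite -/eta NE sum_present /mxtrace /green.
have eta0 : 0 < eta.
  by rewrite sqrtr_gt0 pole_gt0// (lt_le_trans ltr01).
under eq_bigr => x _.
  rewrite (@resolvent_submatrix _ _ _ (scal m *: block_sum (top d) (skel d) (top_block sg) c)
    _ f) //; first over.
  - exact: block_sum_sym (top_block_sym sg_sym) c.
  - by move=> y z; rewrite !mxE ME.
  move=> y j; rewrite codom_f mem_present => nj.
  rewrite mxE block_sumE//.
  case: (boolP (_ && _)) => [/andP[_]|_]; last by rewrite !mulr0.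
  (* A nonzero entry would make the union a cell, and closure would make facet j present. *)
  rewrite inE => /andP[/faces_closed X _]; case/negP: nj.
  by apply: X; exact: finset.subsetUr.
by [].
Qed.

End SpectralDeviation.

(** * The limit theorem common to both adjacency matrices *)

Section SemicircleLaw.
Local Open Scope classical_set_scope.
Variables (R : realType) (d : nat) (p : nat -> nat -> R).
Variables (disp : nat -> measure_display) (Omega : forall n, measurableType (disp n)).
Variables (P : forall n, probability (Omega n) R).
Variable chi : forall n, {set 'I_n} -> {RV (P n) >-> bool}.
Hypothesis d2 : (2 <= d)%N.
Hypothesis p01 : forall n i, (1 <= i <= d)%N -> 0 < p n i <= 1.
Hypothesis chi_law : forall n (tau : {set 'I_n}), (2 <= #|tau| <= d.+1)%N ->
  distribution (P n) (chi tau) =1 bernoulli_prob (p n #|tau|.-1).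
Hypothesis chi_indep : forall n, mutually_independent
  [set tau : {set 'I_n} | (2 <= #|tau| <= d.+1)%N]%SET (@chi n).
Hypothesis liminf_p :
  (0 < \big[Order.min/+oo]_(1 <= i < d) limn_einf (fun n => (p n i)%:E))%E.
Hypothesis np_cvg : (n%:R * p n d * (1 - p n d)) @[n --> \oo] --> +oo.
Hypothesis p_cvg : p n d @[n --> \oo] --> 0.
Notation cell_index n := 'I_#|[set s : {set 'I_n} | #|s| == d]|%SET.
Variable sg : forall n, cell_index n -> cell_index n -> R.
Hypothesis sg_sym : forall n (i j : cell_index n), sg i j = sg j i.
Hypothesis sg_sqr : forall n (i j : cell_index n), sg i j ^+ 2 = 1.
Variables (N : forall n, simplicial_complex n -> nat).
Variable A : forall n (X : simplicial_complex n), 'M[R]_(N X).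
Hypothesis A_block : forall n (c : {ffun {set 'I_n} -> bool}),
  exists f : 'I_(N (lower_model d c)) -> cell_index n,
  [/\ injective f, codom f =i present c &
    forall a b, A (lower_model d c) a b =
      block_sum (top d) (skel d) (top_block (@sg n)) c (f a) (f b)].

Lemma semicircle_law : weak_cvg_in_probability P
  (fun n w => spectral_measure ((Num.sqrt (variance_scale n d (p n)))^-1 *:
    A (lower_model d (fun tau => chi tau w)))) semicircle.
Proof.
move=> rho rho_w eps eps0.
have [k k0 k_le] := density_bound liminf_p.
pose K := 4 / k; have K0 : 0 < K by rewrite divr_gt0.
(* With this base point every pole has eta >= 2 K + 1, which serves at once as the contraction
   threshold and as the bound Im z >= 1. *)
pose a0 := (2 * K + 1) ^+ 2.
have a0_ge1 : 1 <= a0 by rewrite exprn_ege1// lerDr mulr_ge0// ltW.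
have P0 n (t : {set 'I_n}) : 0 <= cell_prob d (p n) t <= 1.
  rewrite /cell_prob; case: ifP => [/andP[t2 td]|_]; last by rewrite lexx ler01.
  have /andP[q0 q1] : 0 < p n #|t|.-1 <= 1.
    by apply: p01; case: #|t| t2 td => [|[|l]].
  by rewrite ltW.
pose nu_ n (c : {ffun {set 'I_n} -> bool}) : probability (measurableTypeR R) R :=
  spectral_measure (scal (variance_scale n d (p n)) *: A (lower_model d c)).
have lawE n : P n [set w | eps <= rho (spectral_measure
    ((Num.sqrt (variance_scale n d (p n)))^-1 *: A (lower_model d (fun tau => chi tau w))))
    semicircle] =
    (Ex (cell_prob d (p n)) (fun c => (eps <= rho (nu_ n c) semicircle)%R%:R))%:E.
  pose D := [set tau : {set 'I_n} | (2 <= #|tau| <= d.+1)%N]%SET.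
  rewrite -(@config_law _ _ _ (P n) _ D _ (@chi n)) //; first last.
  - move=> t; rewrite inE => tD; rewrite /cell_prob tD; exact: chi_law.
  - by move=> t; rewrite inE /cell_prob => /negPf ->.
  congr (P n _); apply/seteqP; split => w /=; rewrite /nu_ /scal;
    suff -> : lower_model d (fun tau => chi tau w) = lower_model d (config D (@chi n) w) by [].
  - by apply: eq_lower_model => t tD; rewrite ffunE inE tD.
  - by apply: eq_lower_model => t tD; rewrite ffunE inE tD.
under eq_cvg do rewrite lawE.
apply/fine_cvgP; split; first exact: nearW.
apply: (@cvg_bern_prob_rho _ a0 semicircle a0_ge1 (fun n => {set 'I_n}%type)
  (fun n => cell_prob d (p n)) nu_ _ _ rho rho_w eps eps0) => // b j e e0.
have K1 : 0 <= 2 * K + 1 by rewrite addr_ge0// mulr_ge0// ltW.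
set eta := Num.sqrt (pole a0 j).
have eta_ge : 2 * K + 1 <= eta.
  by rewrite -[leLHS](ger0_norm K1) -sqrtr_sqr ler_wsqrtr// lerDl invr_ge0.
have eta0 : 0 < eta by apply: lt_le_trans eta_ge; rewrite ltr_wpDl// mulr_ge0// ltW.
have /andP[s0 s1] := sc_root01 eta0.
have cabsI (x : R) : 0 <= x -> cabs (0 +i* x)%C = x.
  by move=> x0; rewrite /cabs normc_def/= expr0n add0r sqrtr_sqr ger0_norm.
have Imz : 1 <= complex.Im (0 +i* eta)%C.
  by apply: le_trans eta_ge => /=; rewrite lerDr mulr_ge0// ltW.
have zl : 2 * K + 1 <= cabs (0 +i* eta)%C by rewrite cabsI// ltW.
have := cvg_green_average d2 p01 np_cvg p_cvg k0 k_le Imz zl (sc_root_fixpoint eta) _ sg_sym sg_sqr e0.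
rewrite cabsI// => /(_ s1) lim.
apply: squeeze_cvgr lim; last exact: cvg_cst.
near=> n; apply/andP; split; first by apply: Ex_ge0 => // c; exact: ler0n.
apply: le_Ex => // c; case: (boolP (e <= `|_|)) => [dev|_]; last exact: ler0n.
(* If no facet is present, the first alternative of the event in [cvg_green_average] holds;
   otherwise the test is bounded by the deviation of the average. *)
rewrite ler_nat lt0b; case: eqP => //= /eqP present0.
have [f [fi fp fA]] := A_block c.
apply: le_trans dev _.
exact: (spectral_deviation (ltnW d2) (@sg_sym n) fi fp fA (variance_scale n d (p n)) b j a0_ge1 present0).
Unshelve. all: by end_near. Qed.

End SemicircleLaw.

Local Open Scope classical_set_scope.
Local Open Scope ring_scope.

Theorem theorem4 (R : realType) (d : nat) (p : nat -> nat -> R)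
    (disp : nat -> measure_display)
    (Omega : forall n, measurableType (disp n))
    (P : forall n, probability (Omega n) R)
    (chi : forall n, {set 'I_n} -> {RV (P n) >-> bool}) :
  (2 <= d)%N ->
  (forall n i, (1 <= i <= d)%N -> 0 < p n i <= 1) ->
  (forall n (tau : {set 'I_n}), (2 <= #|tau| <= d.+1)%N ->
    distribution (P n) (chi n tau) =1 bernoulli_prob (p n #|tau|.-1)) ->
  (forall n, mutually_independent
    [set tau : {set 'I_n} | (2 <= #|tau| <= d.+1)%N]%SET (chi n)) ->
  (0 < \big[mine/+oo]_(1 <= i < d) limn_einf (fun n => (p n i)%:E))%E ->
  (n%:R * p n d * (1 - p n d)) @[n --> \oo] --> +oo ->
  p n d @[n --> \oo] --> 0 ->
  let Y n (w : Omega n) : simplicial_complex n :=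
    lower_model d (fun tau => chi n tau w) in
  let m n : R :=
    n%:R * d%:R * (\prod_(1 <= r < d.+1) p n r ^+ 'C(d, r)) * (1 - p n d) in
  weak_cvg_in_probability P
    (fun n w => spectral_measure
      ((Num.sqrt (m n))^-1 *: unsigned_adjacency R d (Y n w)))
    semicircle
  /\
  weak_cvg_in_probability P
    (fun n w => spectral_measure
      ((Num.sqrt (m n))^-1 *: signed_adjacency R d (Y n w)))
    semicircle.
Proof.
move=> d2 p01 chi_law chi_indep liminf_p np_cvg p_cvg Y m; split.
  apply: (semicircle_law d2 p01 chi_law chi_indep liminf_p np_cvg p_cvg
    (sg := fun _ _ _ => 1) _ _ (A := fun n => @unsigned_adjacency R d n)) => //.
  - by move=> n i j; rewrite expr1n.
  - by move=> n c; exact: unsigned_adjacency_block.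
apply: (semicircle_law d2 p01 chi_law chi_indep liminf_p np_cvg p_cvg
  (sg := fun n => @sign R n d) _ _ (A := fun n => @signed_adjacency R d n)).
- by move=> n i j; exact: sign_sym.
- by move=> n i j; exact: sign_sqr.
- by move=> n c; exact: signed_adjacency_block.
Qed.
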